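(* Let $m\ge 1$ be an integer and let $\alpha,\beta$ be real numbers satisfying: $\alpha,\beta>-1$; $\alpha+1-m-\beta\notin\{0,1,\ldots,m-1\}$; and $\operatorname{sgn}(\alpha+1-m)=\operatorname{sgn}\beta$. Let $S_{\alpha,\beta,m}$ be the self-adjoint operator in $L^2((-1,1);W_{\alpha,\beta,m})$ defined in the context. Then the exceptional $X_m$-Jacobi polynomials $\{P_{m,n}^{(\alpha,\beta)}\}_{n=m}^\infty$ form a complete set of eigenfunctions of $S_{\alpha,\beta,m}$ in $L^2((-1,1);W_{\alpha,\beta,m})$ (that is, each $P_{m,n}^{(\alpha,\beta)}$, $n\ge m$, is an eigenfunction of $S_{\alpha,\beta,m}$, and their linear span is dense in $L^2((-1,1);W_{\alpha,\beta,m})$). Additionally, the spectrum $\sigma(S_{\alpha,\beta,m})$ is pure discrete spectrum consisting of the simple eigenvalues $$\sigma(S_{\alpha,\beta,m})=\sigma_p(S_{\alpha,\beta,m})=\{-(n-m)(1+\alpha+\beta+n-m) : n\in\mathbb Z,\ n\ge m\}.$$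
   Context: For real $a,b$ and an integer $k\ge 0$, $P_k^{(a,b)}$ denotes the classical Jacobi polynomial $P_k^{(a,b)}(x)=\sum_{s=0}^{k}\binom{k+a}{k-s}\binom{k+b}{s}\left(\frac{x-1}{2}\right)^{s}\left(\frac{x+1}{2}\right)^{k-s}$ (generalized binomial coefficients; arbitrary real parameters allowed), and $P_{-1}^{(a,b)}=0$. $\operatorname{sgn}$ is the sign function with $\operatorname{sgn}0=0$. For $n\ge m$ the exceptional $X_m$-Jacobi polynomial of degree $n$ is $$P_{m,n}^{(\alpha,\beta)}(x)=\frac{(-1)^m}{\alpha+1+n-m}\left[\tfrac12(\alpha+\beta+n-m+1)(x-1)P_m^{(-\alpha-1,\beta-1)}(x)P_{n-m-1}^{(\alpha+2,\beta)}(x)+(\alpha-m+1)P_m^{(-\alpha-2,\beta)}(x)P_{n-m}^{(\alpha+1,\beta-1)}(x)\right].$$ Write $\eta(x)=P_m^{(-\alpha-1,\beta-1)}(x)$. The exceptional $X_m$-Jacobi differential expression is, for $x\in(-1,1)$, $$T_{\alpha,\beta,m}[y](x)=(1-x^2)y''(x)+\left(\beta-\alpha-(\beta+\alpha+2)x-2(1-x^2)\frac{\eta'(x)}{\eta(x)}\right)y'(x)+\left((\alpha-\beta-m+1)m-2\beta(1-x)\frac{\eta'(x)}{\eta(x)}\right)y(x).$$ The exceptional $X_m$-Jacobi weight is $W_{\alpha,\beta,m}(x)=\frac{(1-x)^\alpha(1+x)^\beta}{\eta(x)^2}$ for $x\in(-1,1)$, and $L^2((-1,1);W_{\alpha,\beta,m})$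 is the Hilbert space of (classes of) measurable $f:(-1,1)\to\mathbb C$ with $\int_{-1}^1|f|^2W_{\alpha,\beta,m}\,dx<\infty$. The maximal domain is $\Delta=\{f:(-1,1)\to\mathbb C : f,f'\in AC_{loc}(-1,1);\ f,\,T_{\alpha,\beta,m}[f]\in L^2((-1,1);W_{\alpha,\beta,m})\}$, where $AC_{loc}(-1,1)$ is the set of functions absolutely continuous on every compact subinterval of $(-1,1)$. The self-adjoint operator $S_{\alpha,\beta,m}$ acts by $S_{\alpha,\beta,m}[f]=T_{\alpha,\beta,m}[f]$ on the domain $\mathcal D(S_{\alpha,\beta,m})$ given by: $\Delta$ if $\alpha,\beta\ge 1$; $\{f\in\Delta:\lim_{x\to-1^+}(1+x)^{\beta+1}f'(x)=0\}$ if $\alpha\ge1$ and $0<\beta<1$; $\{f\in\Delta:\lim_{x\to1^-}(1-x)^{\alpha+1}f'(x)=0\}$ if $0<\alpha<1$ and $\beta\ge1$; and $\{f\in\Delta:\lim_{x\to1^-}(1-x)^{\alpha+1}f'(x)=\lim_{x\to-1^+}(1+x)^{\beta+1}f'(x)=0\}$ for all other $\alpha,\beta$ allowed by the three conditions in the claim. $\sigma_p$ denotes the point spectrum (set of eigenvalues).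
   Formalization: Two hypotheses are added, without which the claim fails (e.g. m=2, α=β=−1/2; m=2, α=0, β=−1/2): η(x)=P_m^{(−α−1,β−1)}(x) has no zero in (−1,1), and P_{m,n}^{(α,β)} has degree exactly n for every n≥m. *)

(* Defs.v *)
From mathcomp Require Import all_boot all_order all_algebra.
From mathcomp Require Import all_classical all_reals all_analysis.
From mathcomp Require Import complex.

Set Implicit Arguments.
Unset Strict Implicit.
Unset Printing Implicit Defensive.

Import Order.TTheory GRing.Theory Num.Theory.
Import numFieldNormedType.Exports.

Local Open Scope classical_set_scope.
Local Open Scope ring_scope.
Local Open Scope complex_scope.

Notation normc := complex.ComplexField.Normc.normc.

Definition gbinom (R : realType) (a : R) (k : nat) : R :=
  (\prod_(j < k) (a - j%:R)) / (k`!)%:R.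

Definition jacobi (R : realType) (a b : R) (k : nat) : {poly R} :=
  \sum_(s < k.+1)
    (gbinom (k%:R + a) (k - s) * gbinom (k%:R + b) s) *:
      ((2^-1 *: ('X - 1)) ^+ s * (2^-1 *: ('X + 1)) ^+ (k - s)).

(* [jacobi_pred a b k] is P_{k-1}^{(a,b)}, with P_{-1}^{(a,b)} = 0. *)
Definition jacobi_pred (R : realType) (a b : R) (k : nat) : {poly R} :=
  if k is k'.+1 then jacobi a b k' else 0.

Definition eta (R : realType) (alpha beta : R) (m : nat) : {poly R} :=
  jacobi (- alpha - 1) (beta - 1) m.

(* Only meant for [m <= n], so that [n - m] is the true difference. *)
Definition xjacobi (R : realType) (alpha beta : R) (m n : nat) : {poly R} :=
  ((-1) ^+ m / (alpha + 1 + (n - m)%:R)) *: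
    ((2^-1 * (alpha + beta + (n - m)%:R + 1)) *:
       (('X - 1) * jacobi (- alpha - 1) (beta - 1) m
                 * jacobi_pred (alpha + 2) beta (n - m))
     + (alpha - m%:R + 1) *:
       (jacobi (- alpha - 2) beta m
        * jacobi (alpha + 1) (beta - 1) (n - m))).

(* Complex-valued functions on (-1,1) are represented by total functions
   [R -> R[i]]; every notion below depends only on their restriction to (-1,1). *)
Definition Ioo11 (R : realType) : set R := `]-1, 1[.
Arguments Ioo11 : clear implicits.

Definition polyfun (R : realType) (p : {poly R}) : R -> R[i] :=
  fun x => (p.[x])%:C.

Definition cderivable (R : realType) (f : R -> R[i]) (x : R) : Prop :=
  derivable (fun t => complex.Re (f t)) x 1 /\
  derivable (fun t => complex.Im (f t)) x 1.

Definition cderiv (R : realType) (f : R -> R[i]) : R -> R[i] :=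
  fun x => derive1 (fun t => complex.Re (f t)) x
           +i* derive1 (fun t => complex.Im (f t)) x.

Definition abs_continuous (R : realType) (c d : R) (f : R -> R[i]) : Prop :=
  forall eps : R, 0 < eps -> exists2 delta : R, 0 < delta &
    forall s : seq (R * R),
      all (fun p => [&& c <= p.1, p.1 <= p.2 & p.2 <= d]) s ->
      pairwise (fun p q => (p.2 <= q.1) || (q.2 <= p.1)) s ->
      \sum_(p <- s) (p.2 - p.1) < delta ->
      \sum_(p <- s) normc (f p.2 - f p.1) < eps.

Definition AC_loc (R : realType) (f : R -> R[i]) : Prop :=
  forall c d : R, -1 < c -> c <= d -> d < 1 -> abs_continuous c d f.

(* Elements of L^2((-1,1); w dx) are represented by functions, compared up to
   [ae_eq11].  The library's measurable sets of reals are the Borel sets, which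
   yields the same classes as Lebesgue measurability. *)
Definition cmeasurable (R : realType) (f : R -> R[i]) : Prop :=
  measurable_fun (Ioo11 R) (fun x => complex.Re (f x)) /\
  measurable_fun (Ioo11 R) (fun x => complex.Im (f x)).

Definition L2sqnorm (R : realType) (w : R -> R) (f : R -> R[i]) : \bar R :=
  (\int[@lebesgue_measure R]_(x in Ioo11 R) ((normc (f x)) ^+ 2 * w x)%:E)%E.

Definition L2norm (R : realType) (w : R -> R) (f : R -> R[i]) : \bar R :=
  (L2sqnorm w f `^ 2^-1)%E.

Definition inL2 (R : realType) (w : R -> R) (f : R -> R[i]) : Prop :=
  cmeasurable f /\ (L2sqnorm w f < +oo)%E.

Definition ae_eq11 (R : realType) (f g : R -> R[i]) : Prop :=
  {ae @lebesgue_measure R, forall x, Ioo11 R x -> f x = g x}.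

Definition span_dense (R : realType) (w : R -> R) (e : nat -> R -> R[i]) : Prop :=
  forall f : R -> R[i], inL2 w f -> forall eps : R, 0 < eps ->
    exists (N : nat) (c : nat -> R[i]),
      (L2norm w (fun x => f x - \sum_(k < N) c k * e k x)%R < eps%:E)%E.

Record L2operator (R : realType) := L2Operator {
  opweight : R -> R;
  opdom : (R -> R[i]) -> Prop;
  opact : (R -> R[i]) -> R -> R[i] }.

Definition op_shift (R : realType) (S : L2operator R) (lam : R[i])
    (f : R -> R[i]) : R -> R[i] :=
  fun x => opact S f x - lam * f x.

Definition resolvent_set (R : realType) (S : L2operator R) : set R[i] :=
  [set lam : R[i] |
    [/\ forall f, opdom S f -> ae_eq11 (op_shift S lam f) (fun=> 0) ->
          ae_eq11 f (fun=> 0),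
        forall g, inL2 (opweight S) g ->
          exists2 f, opdom S f & ae_eq11 (op_shift S lam f) g
      & exists C : R, forall f, opdom S f ->
          (L2norm (opweight S) f
             <= C%:E * L2norm (opweight S) (op_shift S lam f))%E]].

Definition spectrum (R : realType) (S : L2operator R) : set R[i] :=
  ~` resolvent_set S.

Definition in_eigenspace (R : realType) (S : L2operator R) (lam : R[i])
    (f : R -> R[i]) : Prop :=
  opdom S f /\ ae_eq11 (opact S f) (fun x => lam * f x).

Definition eigenfunction_for (R : realType) (S : L2operator R) (lam : R[i])
    (f : R -> R[i]) : Prop :=
  in_eigenspace S lam f /\ ~ ae_eq11 f (fun=> 0).

Definition eigenfunction (R : realType) (S : L2operator R)
    (f : R -> R[i]) : Prop :=
  exists lam : R[i], eigenfunction_for S lam f.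

Definition point_spectrum (R : realType) (S : L2operator R) : set R[i] :=
  [set lam : R[i] | exists f, eigenfunction_for S lam f].

Definition finite_multiplicity (R : realType) (S : L2operator R)
    (lam : R[i]) : Prop :=
  exists (d : nat) (e : 'I_d -> R -> R[i]),
    forall f, in_eigenspace S lam f ->
      exists c : 'I_d -> R[i], ae_eq11 f (fun x => \sum_(i < d) c i * e i x).

Definition simple_eigenvalue (R : realType) (S : L2operator R)
    (lam : R[i]) : Prop :=
  exists2 e, eigenfunction_for S lam e &
    forall f, in_eigenspace S lam f ->
      exists c : R[i], ae_eq11 f (fun x => c * e x).

(* The complement, in the spectrum, of the essential spectrum of a self-adjoint
   operator. *)
Definition discrete_spectrum (R : realType) (S : L2operator R) : set R[i] :=
  [set lam : R[i] |
    [/\ point_spectrum S lam, finite_multiplicity S lam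
      & exists2 eps : R, 0 < eps &
          forall mu, spectrum S mu -> normc (mu - lam) < eps -> mu = lam]].

Definition pure_discrete_spectrum (R : realType) (S : L2operator R) : Prop :=
  spectrum S = discrete_spectrum S.

(* The second derivative is taken to be that of the derivative; it exists
   almost everywhere when [cderiv y] is locally absolutely continuous, which is
   all that matters for membership and equality in L^2. *)
Definition xjacobi_expr (R : realType) (alpha beta : R) (m : nat)
    (y : R -> R[i]) : R -> R[i] :=
  fun x =>
    let h := ((eta alpha beta m)^`()).[x] / (eta alpha beta m).[x] in
    (1 - x ^+ 2)%:C * cderiv (cderiv y) x
    + (beta - alpha - (beta + alpha + 2) * x - 2 * (1 - x ^+ 2) * h)%:C
        * cderiv y x
    + ((alpha - beta - m%:R + 1) * m%:R - 2 * beta * (1 - x) * h)%:C * y x.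

Definition xjacobi_weight (R : realType) (alpha beta : R) (m : nat) : R -> R :=
  fun x => (1 - x) `^ alpha * (1 + x) `^ beta / (eta alpha beta m).[x] ^+ 2.

Definition maxdom (R : realType) (alpha beta : R) (m : nat)
    (f : R -> R[i]) : Prop :=
  [/\ AC_loc f, (forall x, Ioo11 R x -> cderivable f x), AC_loc (cderiv f),
      inL2 (xjacobi_weight alpha beta m) f
    & inL2 (xjacobi_weight alpha beta m) (xjacobi_expr alpha beta m f)].

(* A complex limit is 0 exactly when the limit of the moduli is 0. *)
Definition bc_right (R : realType) (alpha : R) (f : R -> R[i]) : Prop :=
  normc (((1 - x) `^ (alpha + 1))%:C * cderiv f x) @[x --> (1 : R)^'-] --> (0 : R).

Definition bc_left (R : realType) (beta : R) (f : R -> R[i]) : Prop :=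
  normc (((1 + x) `^ (beta + 1))%:C * cderiv f x) @[x --> (-1 : R)^'+] --> (0 : R).

Definition xjacobi_dom (R : realType) (alpha beta : R) (m : nat)
    (f : R -> R[i]) : Prop :=
  maxdom alpha beta m f /\
  if (1 <= alpha) && (1 <= beta) then True
  else if (1 <= alpha) && (0 < beta < 1) then bc_left beta f
  else if (0 < alpha < 1) && (1 <= beta) then bc_right alpha f
  else bc_right alpha f /\ bc_left beta f.

Definition xjacobi_op (R : realType) (alpha beta : R) (m : nat) : L2operator R :=
  {| opweight := xjacobi_weight alpha beta m;
     opdom := xjacobi_dom alpha beta m;
     opact := xjacobi_expr alpha beta m |}.

(* Main.v *)
From HB Require Import structures.
Require Import Defs.
From mathcomp Require Import all_boot all_order all_algebra.
From mathcomp Require Import all_classical all_reals all_analysis.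
From mathcomp Require Import measurable_realfun.
From mathcomp Require Import complex ring lra zify.

(* On (-1,1) the operator is formally symmetric: T u = (p u')'/W + q u with
   p = (1 - x^2) W.  Bilinear identities for the classical Jacobi polynomials,
   with eta = P_m^(-alpha-1,beta-1) and its Jacobi equation, give
   T e_k = lambda_k e_k for e_k = P_{m,m+k}.  By induction on degrees the
   span of the e_k is the set of polynomials v such that eta divides
   (1+x) v' + beta v; it contains eta^2 v for every polynomial v, so it is dense,
   polynomials being dense for the finite measure eta^4 W dx.

   Near an endpoint with exponent >= 1, p u' -> 0 holds for every u in the maximal
   domain, since otherwise u' blows up too fast for u to be in L^2(W) (limit
   point case); at the other endpoints it is the boundary condition.  So all u in
   the domain satisfy Green's identity against the e_k, which yields simplicity of
   the lambda_k and injectivity of T - lambda off the lambda_k.  For such lambda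
   the equation (T - lambda) u = g is solved coefficientwise for g in the span,
   with norm at most |g| / dist(lambda, {lambda_k}), and the solution operator
   extends to L^2(W) because T, integrated once from -1, is closed. *)

Set Implicit Arguments.
Unset Strict Implicit.
Unset Printing Implicit Defensive.

Import Order.TTheory GRing.Theory Num.Theory.
Import numFieldNormedType.Exports.

Local Open Scope classical_set_scope.
Local Open Scope ring_scope.

(** * Jacobi polynomials *)

Section JacobiPolynomials.
Context {R : realType}.
Implicit Types (a b x : R) (k s : nat) (p q : {poly R}).

(** Functions of the maximal domain only have a locally absolutely continuous derivative, in the
    epsilon-delta sense. Green's identity and the limit-point argument need such functions to be
    integrals of their almost-everywhere derivatives; this is derived through total variation,
    Stieltjes measures and the Radon-Nikodym theorem. The analysis is carried out for real
    functions. With lambda = a + i t, the equation (T - lambda)(u + i v) = g1 + i g2 is a real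
    system coupling u and v, and its block on the k-th eigenfunction has determinant |lambda_k -
    lambda|^2. Norms are compared through |f + g|^2 <= 2 |f|^2 + 2 |g|^2, so the sharp bound on the
    span becomes a bound with a factor 4 on squared norms after extension to L^2(W). That beta + j
    and alpha + 1 - m + j do not vanish, and hence that eta does not vanish at -1 and 1, is read off
    from the degree hypothesis: alpha + 1 - m + j is a factor of the coefficient of degree m + j of
    P_{m,m+j}, and the sign condition then excludes beta = 0. *)

Lemma gbinomS a k : k.+1%:R * gbinom a k.+1 = (a - k%:R) * gbinom a k.
Proof.
rewrite /gbinom big_ord_recr /= factS natrM.
have h1 : (k`!)%:R != 0 :> R by rewrite pnatr_eq0 -lt0n fact_gt0.
have h2 : k.+1%:R != 0 :> R by rewrite pnatr_eq0.
by field; rewrite h1 /= nat1r.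
Qed.

Lemma gbinomS_diag a k : k.+1%:R * gbinom (a + 1) k.+1 = (a + 1) * gbinom a k.
Proof.
rewrite /gbinom big_ord_recl /= factS natrM subr0.
have -> : \prod_(i < k) (a + 1 - (bump 0 i)%:R) = \prod_(i < k) (a - i%:R).
  by apply: eq_bigr => i _; rewrite /bump /= add1n -natr1; ring.
have h1 : (k`!)%:R != 0 :> R by rewrite pnatr_eq0 -lt0n fact_gt0.
have h2 : k.+1%:R != 0 :> R by rewrite pnatr_eq0.
by field; rewrite h1 /= nat1r.
Qed.

Lemma gbinom_absorb a k : (a + 1) * gbinom a k = (a + 1 - k%:R) * gbinom (a + 1) k.
Proof. by rewrite -gbinomS_diag gbinomS. Qed.

Lemma gbinom_pascal a k : gbinom (a + 1) k.+1 = gbinom a k.+1 + gbinom a k.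
Proof.
have h : k.+1%:R != 0 :> R by rewrite pnatr_eq0.
apply: (mulfI h); rewrite gbinomS_diag mulrDr gbinomS -natr1; ring.
Qed.

(** The points (i+1)/(n+1), i < n = [size (p - q)], would be too many roots of a nonzero difference.
    Identities can thus be checked where x - 1 and x + 1 are invertible, with derivatives of
    monomials in them written as logarithmic derivatives. *)
Lemma eq_poly_Ioo11 p q :
  (forall x, -1 < x < 1 -> p.[x] = q.[x]) -> p = q.
Proof.
move=> pq; apply/eqP; rewrite -subr_eq0; apply/eqP; apply/eqP.
apply: contraT => d0.
pose rs := [seq (i.+1%:R / ((size (p - q)).+1%:R) : R) | i <- iota 0 (size (p - q))].
have n0 : 0 < ((size (p - q)).+1%:R : R) by rewrite ltr0n.
have rs_root : all (root (p - q)) rs.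
  apply/allP => x /mapP; case=> i; rewrite mem_iota add0n /= => ip ->.
  rewrite /root hornerD hornerN pq ?subrr//.
  rewrite (lt_trans _ (_ : 0 < _)) ?ltrN10 ?divr_gt0 ?ltr0n//=.
  by rewrite ltr_pdivrMr// mul1r ltr_nat ltnS.
have rs_uniq : uniq rs.
  rewrite map_inj_uniq ?iota_uniq// => i j /mulIf ij.
  apply/eqP; rewrite -eqSS -(eqr_nat R); apply/eqP/ij.
  by rewrite invr_eq0 gt_eqF.
have := max_poly_roots d0 rs_root rs_uniq.
by rewrite size_map size_iota ltnn.
Qed.

Definition jacobi_coef a b k s := gbinom (k%:R + a) (k - s) * gbinom (k%:R + b) s.

(** Ratio of consecutive coefficients with denominators cleared: for arbitrary real parameters the
    factor [s.+1%:R + a] may vanish. *)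
Lemma jacobi_coefS a b k s : (s < k)%N ->
  s.+1%:R * (s.+1%:R + a) * jacobi_coef a b k s.+1 =
  (k%:R - s%:R) * (k%:R - s%:R + b) * jacobi_coef a b k s.
Proof.
move=> sk; rewrite /jacobi_coef.
have e : (k - s = (k - s.+1).+1)%N by lia.
have H1 := gbinomS (k%:R + a) (k - s.+1).
rewrite -e natrB// in H1; last exact: ltnW.
rewrite natrB// in H1.
have H2 := gbinomS (k%:R + b) s.
move: H1 H2; set A := gbinom _ (k - s); set B := gbinom _ (k - _).
set C := gbinom _ s.+1; set D := gbinom _ s => H1 H2.
have -> : s.+1%:R * (s.+1%:R + a) * (B * C) = (s.+1%:R + a) * B * (s.+1%:R * C) by ring.
rewrite H2.
have -> : (k%:R - s%:R) * (k%:R - s%:R + b) * (A * D) =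
   (k%:R - s%:R + b) * D * ((k%:R - s%:R) * A) by ring.
by rewrite H1; ring.
Qed.

Let U : {poly R} := 2^-1 *: ('X - 1).
Let V : {poly R} := 2^-1 *: ('X + 1).
Let u x : R := 2^-1 * (x - 1).
Let v x : R := 2^-1 * (x + 1).

Let UE x : U.[x] = u x. Proof. by rewrite /U !hornerE. Qed.
Let VE x : V.[x] = v x. Proof. by rewrite /V !hornerE. Qed.

Lemma horner_jacobi a b k x :
  (jacobi a b k).[x] =
  \sum_(s < k.+1) jacobi_coef a b k s * (u x ^+ s * v x ^+ (k - s)).
Proof.
rewrite /jacobi horner_sum; apply: eq_bigr => s _.
by rewrite hornerZ hornerM !horner_exp UE VE.
Qed.

Let u_neq0 x : -1 < x < 1 -> u x != 0.
Proof.
move=> /andP[_ x1].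
by rewrite /u mulf_neq0 ?invr_eq0 ?pnatr_eq0// subr_eq0 lt_eqF.
Qed.

Let v_neq0 x : -1 < x < 1 -> v x != 0.
Proof.
move=> /andP[x1 _].
by rewrite /v mulf_neq0 ?invr_eq0 ?pnatr_eq0// gt_eqF// -ltrBlDr sub0r.
Qed.

Let dW (W : {poly R}) (c x : R) s : W^`() = c%:P -> W.[x] != 0 ->
  (W ^+ s)^`().[x] = c * s%:R / W.[x] * W.[x] ^+ s.
Proof.
move=> dW W0; rewrite deriv_exp dW hornerMn !hornerE -mulr_natr.
case: s => [|s]; first by rewrite !mulr0 !mul0r.
by rewrite exprS; field.
Qed.

Let ddW (W : {poly R}) (c x : R) s : W^`() = c%:P -> W.[x] != 0 ->
  (W ^+ s)^`()^`().[x] =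
  c ^+ 2 * (s%:R * (s%:R - 1)) / W.[x] ^+ 2 * W.[x] ^+ s.
Proof.
move=> dW' W0; rewrite deriv_exp dW' derivMn hornerMn mul_polyC linearZ/= hornerZ.
case: s => [|s]; first by rewrite !mulr0n !(mul0r, mulr0).
rewrite (dW _ dW' W0) /= -[s.+1%:R - 1]/(_ - _) -mulr_natr.
by rewrite [W.[x] ^+ s.+1]exprS -natr1; field.
Qed.

Let dU : U^`() = (2^-1)%:P.
Proof. by rewrite /U derivZ !poly.derivE ?subr0 ?addr0 -mul_polyC mulr1. Qed.

Let dV : V^`() = (2^-1)%:P.
Proof. by rewrite /V derivZ !poly.derivE ?subr0 ?addr0 -mul_polyC mulr1. Qed.

Let xm1_neq0 x : -1 < x < 1 -> x - 1 != 0.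
Proof. by move=> /andP[_ x1]; rewrite subr_eq0 lt_eqF. Qed.

Let xp1_neq0 x : -1 < x < 1 -> x + 1 != 0.
Proof. by move=> /andP[x1 _]; rewrite gt_eqF// -ltrBlDr sub0r. Qed.

Lemma horner_deriv_jacobi a b k x : -1 < x < 1 ->
  (jacobi a b k)^`().[x] =
  \sum_(s < k.+1) jacobi_coef a b k s * (u x ^+ s * v x ^+ (k - s))
     * (2^-1 * (s%:R / u x + (k%:R - s%:R) / v x)).
Proof.
move=> x11; rewrite /jacobi raddf_sum horner_sum; apply: eq_bigr => s _ /=.
rewrite -natrB; last by rewrite -ltnS.
rewrite derivZ hornerZ derivM hornerD !hornerM -/U -/V.
rewrite (dW _ dU) ?UE ?u_neq0// (dW _ dV) ?VE ?v_neq0// !horner_exp UE VE.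
by rewrite /jacobi_coef; field; rewrite u_neq0 ?v_neq0.
Qed.

Lemma horner_deriv2_jacobi a b k x : -1 < x < 1 ->
  (jacobi a b k)^`()^`().[x] =
  \sum_(s < k.+1) jacobi_coef a b k s * (u x ^+ s * v x ^+ (k - s))
     * (4^-1 * (s%:R * (s%:R - 1) / u x ^+ 2
        + 2 * s%:R * (k%:R - s%:R) / (u x * v x)
        + (k%:R - s%:R) * (k%:R - s%:R - 1) / v x ^+ 2)).
Proof.
move=> x11; rewrite /jacobi !raddf_sum horner_sum; apply: eq_bigr => s _ /=.
rewrite -natrB; last by rewrite -ltnS.
rewrite !derivZ hornerZ derivM derivD !derivM !hornerD !hornerM -/U -/V.
rewrite (ddW _ dU) ?UE ?u_neq0// (ddW _ dV) ?VE ?v_neq0//.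
rewrite (dW _ dU) ?UE ?u_neq0// (dW _ dV) ?VE ?v_neq0// !horner_exp UE VE.
by rewrite /jacobi_coef; field; rewrite u_neq0 ?v_neq0.
Qed.

(** The s-th summand contributes [G s + H s], where [G] carries the factor s (s + a) and [H] the
    factor (k - s)(k - s + b). The coefficient recurrence and M (s+1) (1 - v/u) = - M s (1 - u/v)
    give [G s.+1] = - [H s], so the sum telescopes; [G 0] and [H k] vanish. *)
Lemma jacobi_ode a b k :
  (1 - 'X ^+ 2) * (jacobi a b k)^`()^`()
  + ((b - a)%:P - (a + b + 2) *: 'X) * (jacobi a b k)^`()
  + (k%:R * (k%:R + a + b + 1)) *: jacobi a b k = 0.
Proof.
apply: eq_poly_Ioo11 => x x11; rewrite !hornerE.
rewrite horner_deriv2_jacobi// horner_deriv_jacobi// horner_jacobi.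
have u0 := u_neq0 x11; have v0 := v_neq0 x11.
pose M (s : nat) := u x ^+ s * v x ^+ (k - s).
pose G (s : nat) := s%:R * (s%:R + a) * jacobi_coef a b k s * (M s * (1 - v x / u x)).
pose H (s : nat) := (k%:R - s%:R) * (k%:R - s%:R + b) * jacobi_coef a b k s
   * (M s * (1 - u x / v x)).
rewrite !mulr_sumr -!big_split /=.
rewrite (eq_bigr (fun s : 'I_k.+1 => G s + H s)); last first.
  move=> s _; rewrite /G /H /M.
  by rewrite /u /v; field; rewrite xm1_neq0 ?xp1_neq0.
rewrite big_split /= big_ord_recl [X in _ + X]big_ord_recr /=.
rewrite {1}/G !mul0r add0r /H subrr !mul0r addr0 -big_split big1//= => s _.
rewrite /G /bump /= add1n jacobi_coefS// -/(H s) /H -mulrDr.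
suff -> : M s.+1 * (1 - v x / u x) = - (M s * (1 - u x / v x)) by rewrite addNr mulr0.
have e : (k - s = (k - s.+1).+1)%N by have := ltn_ord s; lia.
by rewrite /M e !exprS; field; rewrite u0 v0.
Qed.

(** Differentiating the power of x + 1 in one summand and the power of x - 1 in the next one yields
    the same monomial; the two coefficients add up to a common multiple of the shifted ones. *)
Lemma deriv_jacobi a b k :
  (jacobi a b k.+1)^`() =
  (2^-1 * (k.+1%:R + a + b + 1)) *: jacobi (a + 1) (b + 1) k.
Proof.
apply: eq_poly_Ioo11 => x x11; rewrite hornerZ horner_deriv_jacobi// horner_jacobi.
have u0 := u_neq0 x11; have v0 := v_neq0 x11.
under eq_bigr do rewrite mulrDr mulrDr.
rewrite big_split /= big_ord_recl [X in _ + X]big_ord_recr /=.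
rewrite mul0r !mulr0 add0r subrr mul0r !mulr0 addr0 -big_split mulr_sumr /=.
apply: eq_bigr => s _; rewrite /bump /= add1n /jacobi_coef.
have sk := ltn_ord s.
have e : (k.+1 - s = (k - s).+1)%N by lia.
have e' : (k.+1 - s.+1 = k - s)%N by lia.
have H1 := gbinomS (k.+1%:R + a) (k - s).
have H2 := gbinomS (k.+1%:R + b) s.
have -> : k%:R + (a + 1) = k.+1%:R + a by rewrite -natr1; ring.
have -> : k%:R + (b + 1) = k.+1%:R + b by rewrite -natr1; ring.
rewrite e e'; move: H1 H2.
set A := gbinom _ (k - s).+1; set B := gbinom _ (k - s).
set C := gbinom _ s.+1; set D := gbinom _ s => H1 H2.
have E : k.+1%:R - s%:R = (k - s).+1%:R :> R by rewrite -e natrB// ltnW.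
rewrite E.
transitivity (2^-1 * u x ^+ s * v x ^+ (k - s) *
   (B * (s.+1%:R * C) + ((k - s).+1%:R * A) * D)).
  by rewrite !exprS; field; rewrite u0 v0.
rewrite H1 H2 natrB; last by rewrite -ltnS.
by rewrite -natr1; ring.
Qed.

(** Serves to express the factor P_m^(-alpha-2,beta) of the exceptional polynomial through [eta] and
    its derivative. *)
Lemma jacobi_shift a b k :
  ('X - 1) * (jacobi a b k)^`() + a *: jacobi a b k =
  (k%:R + a) *: jacobi (a - 1) (b + 1) k.
Proof.
apply: eq_poly_Ioo11 => x x11; rewrite !hornerE.
rewrite horner_deriv_jacobi// !horner_jacobi.
have u0 := u_neq0 x11; have v0 := v_neq0 x11.
rewrite !mulr_sumr -big_split /=.
pose M (s : nat) := u x ^+ s * v x ^+ (k - s).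
rewrite (eq_bigr (fun s : 'I_k.+1 => (s%:R + a) * jacobi_coef a b k s * M s
    + (k%:R - s%:R) * jacobi_coef a b k s * (M s * (u x / v x)))); last first.
  by move=> s _; rewrite /M /u /v; field; rewrite xm1_neq0 ?xp1_neq0.
rewrite big_split /= big_ord_recl [X in _ + X]big_ord_recr /=.
rewrite subrr !mul0r addr0 add0r -addrA -big_split /= [RHS]big_ord_recl /=.
have gk j : (k%:R + a) * gbinom (k%:R + (a - 1)) j
    = (k%:R + a - j%:R) * gbinom (k%:R + a) j.
  by have := gbinom_absorb (k%:R + (a - 1)) j; rewrite -addrA subrK.
congr (_ + _).
  rewrite /jacobi_coef subn0 -/(M 0%N) /gbinom.
  rewrite !big_ord0 -/(gbinom (k%:R + a) k) -/(gbinom (k%:R + (a - 1)) k).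
  have -> : a * (gbinom (k%:R + a) k * (1 / (0`!)%:R)) * M 0%N =
    ((k%:R + a - k%:R) * gbinom (k%:R + a) k) * (1 / (0`!)%:R) * M 0%N by ring.
  by rewrite -gk /M subn0; ring.
apply: eq_bigr => s _; rewrite /bump /= add1n /jacobi_coef.
have sk := ltn_ord s.
have e : (k - s = (k - s.+1).+1)%N by lia.
rewrite -/(M s.+1) [(k%:R + a) * (_ * M _)]mulrA [(k%:R + a) * (_ * _)]mulrA gk.
have -> : M s * (u x / v x) = M s.+1 by rewrite /M e !exprS; field.
have H1 := gbinomS (k%:R + a) (k - s.+1).
have H2 := gbinom_pascal (k%:R + b) s.
have -> : k%:R + (b + 1) = k%:R + b + 1 by ring.
have E : (k - s.+1).+1%:R = k%:R - s%:R :> R by rewrite -e natrB// ltnW.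
have E2 : (k - s.+1)%:R = k%:R - s.+1%:R :> R by rewrite natrB.
rewrite H2 E2; move: H1; rewrite E E2 -e.
set A := gbinom _ (k - s); set B := gbinom _ (k - s.+1) => H1.
set C := gbinom _ s.+1; set D := gbinom _ s; set N := M s.+1.
transitivity ((s.+1%:R + a) * (B * C) * N + ((k%:R - s%:R) * A) * D * N); first by ring.
by rewrite H1; ring.
Qed.

Lemma horner_jacobi1 a b k : (jacobi a b k).[1] = gbinom (k%:R + a) k.
Proof.
rewrite horner_jacobi big_ord_recl /= big1 => [|s _]; last first.
  by rewrite /u subrr mulr0 /bump /= add1n exprS !mul0r mulr0.
rewrite /v /jacobi_coef subn0 /gbinom big_ord0 expr0 addr0.
have -> : 2^-1 * (1 + 1) = 1 :> R by field.
by rewrite expr1n /= fact0; field; rewrite pnatr_eq0 -lt0n fact_gt0.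
Qed.

Lemma horner_jacobiN1 a b k : (jacobi a b k).[-1] = (-1) ^+ k * gbinom (k%:R + b) k.
Proof.
rewrite horner_jacobi big_ord_recr /= big1 => [|s _]; last first.
  have -> : (k - s = (k - s.+1).+1)%N by have := ltn_ord s; lia.
  by rewrite /v addNr mulr0 exprS !(mul0r, mulr0).
rewrite /u /jacobi_coef subnn /gbinom big_ord0 expr0 add0r fact0.
have -> : 2^-1 * (- 1 - 1) = -1 :> R by field.
by rewrite divr1 mul1r mulr1 mulrC.
Qed.

Lemma size_jacobi_le a b k : (size (jacobi a b k) <= k.+1)%N.
Proof.
apply/(leq_trans (size_sum _ _ _))/bigmax_leqP => s _.
apply: leq_trans (size_scale_leq _ _) _; apply: leq_trans (size_polyMleq _ _) _.
have h (p : {poly R}) j : (size p <= 2)%N -> (size (p ^+ j) <= j.+1)%N.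
  move=> p2; apply: leq_trans (size_poly_exp_leq _ _) _.
  by rewrite ltnS -[X in (_ <= X)%N]mul1n leq_mul2r; case: (size p) p2 => [|[|[]]]// _; rewrite ?orbT.
have hU : (size U <= 2)%N by rewrite (leq_trans (size_scale_leq _ _))// size_XsubC.
have hV : (size V <= 2)%N.
  rewrite (leq_trans (size_scale_leq _ _))//.
  by rewrite -[1]opprK -polyCN size_XsubC.
have := h _ s hU; have := h _ (k - s)%N hV; have := ltn_ord s.
by rewrite /U /V; set a1 := size _; set a2 := size _; lia.
Qed.

End JacobiPolynomials.

(** * Exceptional polynomials: eigenvalue equation, divisibility and span *)

Section ExceptionalJacobi.
Context {R : realType}.
Variables (alpha beta : R) (m : nat).
Implicit Types (p q r y : {poly R}) (k n : nat) (x : R).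

Let e := eta alpha beta m.
Let Q k := jacobi (alpha + 1) (beta - 1) k.

(** The exceptional polynomial up to a constant, as a first-order operator of Darboux type, with
    coefficients made from [e], applied to the classical polynomial [Q k]. The eigenvalue equation
    and the divisibility property are derived from this form. *)
Let Y k := ('X - 1) * (e * (Q k)^`() - e^`() * Q k) + (alpha + 1) *: (e * Q k).

Lemma xjacobiE k : xjacobi alpha beta m (m + k) =
  ((-1) ^+ m / (alpha + 1 + k%:R)) *: Y k.
Proof.
rewrite /xjacobi addKn; congr (_ *: _).
have -> : (2^-1 * (alpha + beta + k%:R + 1)) *: (('X - 1) *
    jacobi (- alpha - 1) (beta - 1) m * jacobi_pred (alpha + 2) beta k) =
    ('X - 1) * e * (Q k)^`().
  rewrite -/(eta alpha beta m) -/e; case: k => [|k] /=.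
    rewrite mulr0 scaler0 /Q /jacobi big_ord1 !expr0 mulr1.
    by rewrite derivZ -[1]/(1%:P) derivC scaler0 mulr0.
  rewrite /Q deriv_jacobi; have -> : alpha + 1 + 1 = alpha + 2 by ring.
  rewrite subrK scalerAr; congr (_ * (_ *: _)); ring.
have H := jacobi_shift (- alpha - 1) (beta - 1) m.
rewrite subrK in H.
have e2 : - alpha - 1 - 1 = - alpha - 2 :> R by ring.
rewrite e2 -/(eta alpha beta m) -/e in H.
have -> : alpha - m%:R + 1 = - (m%:R + (- alpha - 1)) by ring.
rewrite scaleNr -/(Q k) scalerAl -H /Y -!mul_polyC.
rewrite !polyCD !polyCN polyC1; ring.
Qed.

Let coef_topM p q i j : (size p <= i.+1)%N -> (size q <= j.+1)%N ->
  (p * q)`_(i + j) = p`_i * q`_j.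
Proof.
move=> pi qj; rewrite coefM.
have ij : (i < (i + j).+1)%N by rewrite ltnS leq_addr.
rewrite (bigD1 (Ordinal ij))//= addKn big1 ?addr0// => s si.
have [si'|si'] := ltnP s i.
  by rewrite [q`_ _]nth_default ?mulr0// (leq_trans qj)//; lia.
rewrite [p`_ _]nth_default ?mul0r// (leq_trans pi)//.
by rewrite ltn_neqAle si' andbT eq_sym.
Qed.

(** Once the degree is known to be m + k, every factor of this coefficient is nonzero; the
    constraints on alpha, beta and the degree of [e] are obtained in this way. *)
Lemma coef_xjacobi k : (xjacobi alpha beta m (m + k))`_(m + k) =
  (-1) ^+ m / (alpha + 1 + k%:R) * ((k%:R - m%:R + alpha + 1) * e`_m * (Q k)`_k).
Proof.
rewrite xjacobiE coefZ; congr (_ * _).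
have se : (size e <= m.+1)%N := size_jacobi_le _ _ _.
have sQ : (size (Q k) <= k.+1)%N := size_jacobi_le _ _ _.
have sd p i : (size p <= i.+1)%N -> (size p^`() <= i)%N.
  by move=> pi; apply: leq_trans (size_poly _ _) _; case: (size p) pi.
have sXd p i : (size p <= i.+1)%N -> (size (('X : {poly R}) * p^`())%R <= i.+1)%N.
  move=> pi; apply: leq_trans (size_polyMleq _ _) _; rewrite size_polyX /=.
  exact: sd.
have cXd p i : ('X * p^`())`_i = p`_i * i%:R.
  by rewrite coefXM; case: i => [|i]; rewrite ?mulr0//= coef_deriv mulr_natr.
have -> : Y k = e * ('X * (Q k)^`()) - ('X * e^`()) * Q k - e * (Q k)^`()
   + e^`() * Q k + (alpha + 1) *: (e * Q k).
  by rewrite /Y -!mul_polyC; ring.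
rewrite !(coefD, coefN, coefZ) !coef_topM ?sXd// ?(leqW (sd _ _ _))//.
have -> : (Q k)^`()`_k = 0 by rewrite nth_default// sd.
have -> : e^`()`_m = 0 by rewrite nth_default// sd.
by rewrite !cXd; ring.
Qed.

Let ode_e := jacobi_ode (- alpha - 1) (beta - 1) m.
Let ode_Q k := jacobi_ode (alpha + 1) (beta - 1) k.

(** Modulo [e] only [Q k] times derivatives of [e] survive, in the combination (1 - x^2) e'' +
    (alpha + beta - (beta - alpha) x) e'. By the Jacobi equation of [e] it equals - m (m + beta -
    alpha - 1) e, whence the last term of the quotient. *)
Lemma eta_dvd_xjacobi k (y := xjacobi alpha beta m (m + k)) :
  eta alpha beta m %| ('X + 1) * y^`() + beta *: y.
Proof.
suff : eta alpha beta m %| ('X + 1) * (Y k)^`() + beta *: Y k.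
  move=> /(dvdp_mull ((-1) ^+ m / (alpha + 1 + k%:R))%:P).
  rewrite /y xjacobiE derivZ mul_polyC.
  by rewrite scalerDr scalerAr !scalerA [beta * _]mulrC.
apply/dvdpP.
exists (- (1 - 'X ^+ 2) * (Q k)^`()^`() + ('X + 1) * ((alpha + 2) *: (Q k)^`())
  + ('X - 1) * (beta *: (Q k)^`()) + (beta * (alpha + 1)) *: Q k
  - (m%:R * (m%:R + beta - alpha - 1)) *: Q k).
rewrite -/e; apply/eqP; rewrite -subr_eq0; apply/eqP.
rewrite -[RHS](mulr0 (Q k)) -ode_e -/(eta alpha beta m) -/e /Y.
rewrite -!mul_polyC !poly.derivE -?mul_polyC !(polyCD, polyCN, polyCM, polyC1).
ring.
Qed.

(** Since [Y k] contains first derivatives, third derivatives of [e] and [Q k] occur; after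
    multiplication by [e] the residual is a combination of the two Jacobi equations and of their
    derivatives. *)
Lemma xjacobi_eigen k x (y := xjacobi alpha beta m (m + k)) :
  e.[x] != 0 ->
  (1 - x ^+ 2) * (y^`()^`()).[x]
  + (beta - alpha - (beta + alpha + 2) * x
      - 2 * (1 - x ^+ 2) * ((e^`()).[x] / e.[x])) * (y^`()).[x]
  + ((alpha - beta - m%:R + 1) * m%:R
      - 2 * beta * (1 - x) * ((e^`()).[x] / e.[x])) * y.[x]
  = - (k%:R * (1 + alpha + beta + k%:R)) * y.[x].
Proof.
move=> ex0; rewrite /y xjacobiE !derivZ !hornerZ.
set C := _ / _.
suff H : (1 - x ^+ 2) * ((Y k)^`()^`()).[x]
  + (beta - alpha - (beta + alpha + 2) * x
      - 2 * (1 - x ^+ 2) * ((e^`()).[x] / e.[x])) * ((Y k)^`()).[x]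
  + ((alpha - beta - m%:R + 1) * m%:R
      - 2 * beta * (1 - x) * ((e^`()).[x] / e.[x])) * (Y k).[x]
  = - (k%:R * (1 + alpha + beta + k%:R)) * (Y k).[x].
  by rewrite [RHS]mulrCA -H; ring.
have O1 := congr1 (horner^~ x) ode_e.
have O1' := congr1 (fun p => p^`().[x]) ode_e.
have O2 := congr1 (horner^~ x) (ode_Q k).
have O2' := congr1 (fun p => p^`().[x]) (ode_Q k).
have dY : (Y k)^`() = ('X - 1) * (e * (Q k)^`()^`() - e^`()^`() * Q k)
    + (e * (Q k)^`() - e^`() * Q k) + (alpha + 1) *: (e^`() * Q k + e * (Q k)^`()).
  by rewrite /Y !poly.derivE -!mul_polyC; ring.
have ddY : (Y k)^`()^`() = ('X - 1) * (e * (Q k)^`()^`()^`() + e^`() * (Q k)^`()^`()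
      - e^`()^`() * (Q k)^`() - e^`()^`()^`() * Q k)
    + 2%:R *: (e * (Q k)^`()^`() - e^`()^`() * Q k)
    + (alpha + 1) *: (e^`()^`() * Q k + 2%:R *: (e^`() * (Q k)^`())
        + e * (Q k)^`()^`()).
  by rewrite dY !poly.derivE -!mul_polyC; ring.
move: O1 O1' O2 O2'; rewrite ddY dY /Y -/(eta alpha beta m) -/e -/(Q k).
rewrite !poly.derivE.
have h1 : (1 : {poly R}).[x] = 1 by exact: hornerC.
have hE := (hornerD, hornerN, hornerM, hornerZ, hornerX, hornerXn, hornerC, hornerMn, h1).
rewrite !hE.
move: (e.[x]) ex0 (e^`().[x]) (e^`()^`().[x]) (e^`()^`()^`().[x]).
set q0 := (Q k).[x]; set q1 := (Q k)^`().[x]; set q2 := (Q k)^`()^`().[x].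
set q3 := (Q k)^`()^`()^`().[x].
move=> e0 ex0 e1 e2 e3 O1 O1' O2 O2'.
apply/eqP; rewrite -subr_eq0; apply/eqP; apply: (mulfI ex0); rewrite mulr0.
(* The cofactors of the Jacobi equations of [e] and [Q k] (evaluated at [x]) and
   of their derivatives. *)
have L (a b c d : R) : a = 0 -> b = 0 -> c = 0 -> d = 0 ->
  (- e0 * ((x - 1) * q1 + (alpha + 1) * q0) + 2 * (x - 1) * e1 * q0) * a
  + (- (x - 1) * q0 * e0) * b
  + e0 * ((alpha + 1) * e0 - (x - 1) * e1) * c
  + (x - 1) * e0 ^+ 2 * d = 0.
  by move=> -> -> -> ->; rewrite !mulr0 !addr0.
have {}L := L _ _ _ _ O1 O1' O2 O2'.
by rewrite -[RHS]L; field.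
Qed.

Hypothesis beta_gt : -1 < beta.
Hypothesis sgn_eq : Num.sg (alpha + 1 - m%:R) = Num.sg beta.
Hypothesis deg_xjacobi : forall n : nat, (m <= n)%N ->
  size (xjacobi alpha beta m n) = n.+1.

Let lead_neq0 k : (k%:R - m%:R + alpha + 1) * e`_m * (Q k)`_k != 0.
Proof.
have := deg_xjacobi (leq_addr k m) => sz.
have : lead_coef (xjacobi alpha beta m (m + k)) != 0.
  by rewrite lead_coef_eq0 -size_poly_eq0 sz.
by rewrite /lead_coef sz /= coef_xjacobi mulf_eq0 negb_or => /andP[].
Qed.

Let alpha_neq k : k%:R - m%:R + alpha + 1 != 0.
Proof. by have := lead_neq0 k; rewrite !mulf_eq0 !negb_or -andbA => /and3P[]. Qed.

Lemma size_eta : size (eta alpha beta m) = m.+1.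
Proof.
have := lead_neq0 0%N; rewrite !mulf_eq0 !negb_or -andbA => /and3P[_ em _].
apply/eqP; rewrite eqn_leq size_jacobi_le /=.
by rewrite ltnNge; apply: contra em => h; rewrite nth_default.
Qed.

(** If beta = 0, the sign condition gives alpha + 1 = m, and the coefficient of degree m of P_{m,m}
    would vanish. *)
Lemma beta_neq0 : beta != 0.
Proof.
apply/eqP => b0; move/eqP: sgn_eq; rewrite b0 sgr0 sgr_eq0 => /eqP h.
by have := alpha_neq 0; rewrite -h => /eqP; apply; ring.
Qed.

Let beta_nat_neq0 k : beta + k%:R != 0.
Proof.
case: k => [|k]; first by rewrite addr0 beta_neq0.
rewrite gt_eqF// -natr1 addrA addrAC ltr_wpDr// addrC -ltrBlDl sub0r//.
Qed.

(** The value at 1 is a generalized binomial whose numerator factors are, up to sign, alpha + 1 - m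
    + j with j < m; each of them divides a leading coefficient. *)
Lemma eta1_neq0 : (eta alpha beta m).[1] != 0.
Proof.
rewrite horner_jacobi1 /gbinom mulf_neq0//.
apply/prodf_neq0 => j _; rewrite -oppr_eq0.
suff -> : - (m%:R + (- alpha - 1) - j%:R) = j%:R - m%:R + alpha + 1 by exact: alpha_neq.
ring.
Qed.

Lemma etaN1_neq0 : (eta alpha beta m).[-1] != 0.
Proof.
rewrite horner_jacobiN1 mulf_neq0 ?signr_eq0// /gbinom mulf_neq0//.
apply/prodf_neq0 => j _.
suff -> : m%:R + (beta - 1) - j%:R = beta + (m - j.+1)%:R by exact: beta_nat_neq0.
by rewrite natrB// -natr1; ring.
Qed.

Let size_Xp1 : size ('X + 1 : {poly R})%R = 2.
Proof. by rewrite -[1]opprK -polyCN size_XsubC. Qed.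

(** The polynomial (x + 1) r' + beta r has size at most m, so divisibility by [eta], of size m + 1,
    forces it to vanish. Its coefficient of degree d = deg r is (d + beta) times the leading
    coefficient of r. *)
Let eta_dvd_small r : (size r <= m)%N ->
  eta alpha beta m %| ('X + 1) * r^`() + beta *: r -> r = 0.
Proof.
move=> rm; have [->//|r0] := eqVneq r 0.
have [z0 _|z0 /(dvdp_leq z0)] := eqVneq (('X + 1) * r^`() + beta *: r) 0; last first.
  rewrite size_eta leqNgt => /negP; case; rewrite ltnS.
  apply: leq_trans (size_polyD _ _) _; rewrite geq_max.
  rewrite (leq_trans (size_scale_leq _ _))// andbT.
  apply: leq_trans (size_polyMleq _ _) _; rewrite size_Xp1 /=.
  exact: leq_trans (lt_size_deriv r0) rm.
have sr : (size r = (size r).-1.+1)%N by rewrite prednK// lt0n size_poly_eq0.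
have := congr1 (fun p => p`_(size r).-1) z0.
rewrite coef0 coefD mulrDl mul1r coefD coefXM coefZ.
have -> : (r^`())`_(size r).-1 = 0 by rewrite nth_default// -ltnS -sr lt_size_deriv.
rewrite addr0.
have -> : (if (size r).-1 == 0%N then 0 else (r^`())`_(size r).-2) =
   (size r).-1%:R * r`_(size r).-1.
  by case: (size r).-1 => [|j]; rewrite ?mul0r//= coef_deriv mulr_natl.
rewrite -mulrDl addrC => /eqP; rewrite mulf_eq0 (negPf (beta_nat_neq0 _)) /=.
by rewrite -[_`_ _]/(lead_coef r) lead_coef_eq0 => /eqP.
Qed.

Lemma xjacobi_span N p : (size p <= N)%N ->
  eta alpha beta m %| ('X + 1) * p^`() + beta *: p ->
  exists c : nat -> R, p = \sum_(k < N) c k *: xjacobi alpha beta m (m + k).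
Proof.
elim: N p => [p|N IH p pN dp].
  by rewrite leqn0 size_poly_eq0 => /eqP-> _; exists (fun=> 0); rewrite big_ord0.
have [pN'|Np] := leqP (size p) N.
  have [c cE] := IH p pN' dp.
  exists (fun k => if (k < N)%N then c k else 0).
  rewrite big_ord_recr /= ltnn scale0r addr0 {1}cE.
  by apply: eq_bigr => k _; rewrite ltn_ord.
have {Np pN} sp : size p = N.+1 by apply/eqP; rewrite eqn_leq pN.
have [Nm|mN] := ltnP N m.
  have : p = 0 by apply: eta_dvd_small => //; rewrite sp.
  by move=> pp; move: sp; rewrite pp size_poly0.
set k := (N - m)%N; have kN : (m + k = N)%N by rewrite subnKC.
set y := xjacobi alpha beta m (m + k).
have sy : size y = N.+1 by rewrite /y kN deg_xjacobi.
(* The member of degree N cancels the leading term of [p], and the difference keeps the divisibility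
   property. *)
pose c0 := p`_N / y`_N.
have yN0 : y`_N != 0.
  have := lead_coef_eq0 y; rewrite /lead_coef sy /= => ->.
  by rewrite -size_poly_eq0 sy.
have dy := eta_dvd_xjacobi k; rewrite -/y in dy.
have [||c cE] := IH (p - c0 *: y).
- apply/leq_sizeP => j; rewrite leq_eqVlt => /predU1P[<-|Nj].
    by rewrite coefB coefZ /c0 divfK// subrr.
  by rewrite coefB coefZ !nth_default ?mulr0 ?subrr// ?sp ?sy.
- have -> : ('X + 1) * (p - c0 *: y)^`() + beta *: (p - c0 *: y) =
     ('X + 1) * p^`() + beta *: p - c0 *: (('X + 1) * y^`() + beta *: y).
    by rewrite derivB derivZ -!mul_polyC; ring.
  by apply: dvdp_sub => //; rewrite -mul_polyC dvdp_mull.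
exists (fun j => (if (j < N)%N then c j else 0) + (if j == k then c0 else 0)).
have -> : p = (p - c0 *: y) + c0 *: y by rewrite subrK.
under eq_bigr do rewrite scalerDl.
rewrite big_split /=; congr (_ + _).
  rewrite big_ord_recr /= ltnn scale0r addr0 cE.
  by apply: eq_bigr => j _; rewrite ltn_ord.
have kN1 : (k < N.+1)%N by rewrite ltnS leq_subr.
rewrite (bigD1 (Ordinal kN1))//= eqxx big1 ?addr0// => j jk.
by rewrite ifN ?scale0r//; apply: contra jk => /eqP jk; apply/eqP/val_inj.
Qed.

(** The product rule leaves a factor [eta] in the derivative of eta^2 q. *)
Lemma eta2_in_span q :
  exists N, exists c : nat -> R,
    eta alpha beta m ^+ 2 * q = \sum_(k < N) c k *: xjacobi alpha beta m (m + k).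
Proof.
eexists; apply: xjacobi_span (leqnn _) _.
rewrite poly.derivE deriv_exp; apply/dvdpP.
exists (('X + 1) * (e^`() * q *+ 2 + e * q^`()) + beta *: (e * q)).
by rewrite /= expr1 -!mul_polyC -/e; ring.
Qed.

End ExceptionalJacobi.

(** * Absolute continuity *)

Section AbsoluteContinuity.
Context {R : realType}.
Implicit Types (a b c d x y : R) (f g : R -> R) (s t : seq (R * R)).

Definition pairs_in c d s := all (fun p => [&& c <= p.1, p.1 <= p.2 & p.2 <= d]) s.

Definition nonoverlapping s :=
  pairwise (fun p q : R * R => (p.2 <= q.1) || (q.2 <= p.1)) s.

Definition rAC c d f := forall eps : R, 0 < eps -> exists2 delta : R, 0 < delta &
  forall s, pairs_in c d s -> nonoverlapping s ->
    \sum_(p <- s) (p.2 - p.1) < delta -> \sum_(p <- s) `|f p.2 - f p.1| < eps.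

(** Consecutive pairs of the partition [a :: l]; they turn partitions, on which variation is
    defined, into families of intervals as used in [rAC]. *)
Let P a (l : seq R) := zip (a :: l) l.

Let P_in a (s : seq R) : path <%O a s -> pairs_in a (last a s) (P a s).
Proof.
elim: s a => [//|x s IH] a /= /andP[ax xs].
have xl : x <= last x s.
  by apply: itv_partition_le; split; [exact: xs|exact: eqxx].
rewrite lexx (ltW ax) xl /=; apply: sub_all (IH _ xs) => p /and3P[h1 h2 h3].
by rewrite (le_trans (ltW ax) h1) h2 h3.
Qed.

Let P_nonoverlapping a (s : seq R) : path <%O a s -> nonoverlapping (P a s).
Proof.
elim: s a => [//|x s IH] a /= /andP[ax xs]; rewrite (IH _ xs) andbT.
by apply: sub_all (P_in xs) => p /and3P[h1 _ _] /=; rewrite h1.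
Qed.

Let P_length a (s : seq R) : \sum_(p <- P a s) (p.2 - p.1) = last a s - a.
Proof.
elim: s a => [|x s IH] a /=; first by rewrite big_nil subrr.
by rewrite big_cons IH /=; ring.
Qed.

Let P_variation a b (s : seq R) f : itv_partition a b s ->
  variation a b f s = \sum_(p <- P a s) `|f p.2 - f p.1|.
Proof.
move=> /variation_zip ->; elim: s a => [a|x s IH a]; first by rewrite /P !big_nil.
by rewrite /P /= !big_cons /= -IH.
Qed.

(** Subdividing the intervals of a family does not change its total length, so the modulus for
    increments also controls variations. *)
Lemma rAC_TV c d f : rAC c d f -> forall eps : R, 0 < eps ->
  exists2 delta : R, 0 < delta &
  forall s, pairs_in c d s -> nonoverlapping s ->
    \sum_(p <- s) (p.2 - p.1) < delta ->
    (\sum_(p <- s) total_variation p.1 p.2 f <= eps%:E)%E.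
Proof.
move=> acf eps /acf[delta d0 H]; exists delta => // s.
(* [s] holds the intervals still measured by variation, [t] those already subdivided and measured by
   increments. The induction moves an arbitrary partition of the head of [s] into [t]. *)
suff K t : pairs_in c d (t ++ s) -> nonoverlapping (t ++ s) ->
    \sum_(p <- t ++ s) (p.2 - p.1) < delta ->
    (\sum_(p <- s) total_variation p.1 p.2 f +
      (\sum_(p <- t) `|f p.2 - f p.1|)%:E <= eps%:E)%E.
  by move=> s1 s2 s3; have := K [::] s1 s2 s3; rewrite big_nil adde0.
elim: s t => [|[a b] s IH] t.
  by rewrite cats0 big_nil add0e => t1 t2 t3; rewrite lee_fin ltW// H.
rewrite /pairs_in /nonoverlapping all_cat pairwise_cat big_cat big_cons /=.
move=> /and3P[tcd /and3P[ca ab bd] scd].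
rewrite allrel_consr => /and3P[/andP[t_ab t_s] nt /andP[ab_s ns]] len.
have X0 : (0 <= \sum_(p <- s) total_variation p.1 p.2 f)%E.
  rewrite big_seq; apply: sume_ge0 => p ps; apply: total_variation_ge0.
  by have /allP/(_ _ ps)/and3P[] := scd.
have tlen : 0 <= \sum_(p <- t) (p.2 - p.1).
  rewrite big_seq; apply: sumr_ge0 => p pt.
  by have /allP/(_ _ pt)/and3P[_] := tcd; rewrite subr_ge0.
have t0 : 0 <= \sum_(p <- t) `|f p.2 - f p.1| by exact: sumr_ge0.
(* Finiteness of the remaining variations lets them cross the inequality, so that the variation of
   the head is bounded as a supremum over partitions. *)
have XE : (\sum_(p <- s) total_variation p.1 p.2 f \is a fin_num)%E.
  rewrite ge0_fin_numE//; apply: (@le_lt_trans _ _ eps%:E); last exact: ltry.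
  apply: le_trans (IH t _ _ _).
  - by rewrite leeDl.
  - by rewrite /pairs_in all_cat tcd.
  - by rewrite /nonoverlapping pairwise_cat t_s nt.
  - by apply: le_lt_trans len; rewrite big_cat lerD2l lerDr /= subr_ge0.
rewrite big_cons -addeA; set X := (X in (_ + X)%E).
have XE' : X \is a fin_num by rewrite /X fin_numD XE.
rewrite -leeBrDr//; apply: ge_ereal_sup => _ /= [_ [l lab <-] <-].
have [al /eqP lb] := lab.
rewrite leeBrDr// /X (P_variation _ lab) addeCA -EFinD -big_cat /=.
have Pin := P_in al; rewrite lb in Pin.
apply: IH.
- rewrite /pairs_in !all_cat tcd scd andbT andbT.
  by apply: sub_all Pin => p /and3P[p1 p2 p3]; rewrite (le_trans ca) ?p2 ?(le_trans p3).
- have := P_nonoverlapping al; rewrite /nonoverlapping !pairwise_cat nt ns => ->.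
  rewrite /= !andbT.
  rewrite allrel_catl t_s andbT; apply/andP; split; apply/allrelP => p q pP qs.
    have /allP/(_ _ pP)/and3P[p1 p2 p3] := Pin.
    have /allP/(_ _ qs)/= := ab_s => /orP[h|h].
      by rewrite (le_trans p3 h).
    by rewrite (le_trans h p1) orbT.
  have /allP/(_ _ pP)/and3P[p1 p2 p3] := Pin.
  have /allP/(_ _ qs)/= := t_ab; rewrite ?andbT => /orP[h|h].
    by rewrite (le_trans h p1) orbT.
  by rewrite (le_trans p3 h).
- by rewrite !big_cat /= P_length lb -addrA addrCA.
Qed.

Lemma rAC_unif c d f : rAC c d f -> forall eps : R, 0 < eps ->
  exists2 delta : R, 0 < delta & forall x y, c <= x -> x <= y -> y <= d ->
    y - x < delta -> `|f y - f x| < eps.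
Proof.
move=> acf eps /acf[delta d0 H]; exists delta => // x y cx xy yd xyd.
have := H [:: (x, y)]; rewrite /pairs_in /nonoverlapping /= !big_seq1 /=.
by apply=> //; rewrite cx xy yd.
Qed.

(** Intervals shorter than the delta attached to eps = 1 have variation at most 1, and finitely many
    steps of length delta/2 cover [c, d]. *)
Lemma rAC_TV_fin c d f : c <= d -> rAC c d f ->
  total_variation c d f \is a fin_num.
Proof.
move=> cd /rAC_TV/(_ _ ltr01)[delta d0 H].
have d20 : 0 < delta / 2 by rewrite divr_gt0.
suff K n x : c <= x -> x <= d -> x - c <= n%:R * (delta / 2) ->
    total_variation c x f \is a fin_num.
  apply: (K (Num.truncn ((d - c) / (delta / 2))).+1) => //.
  by rewrite -ler_pdivrMr// ltW// truncnS_gt.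
elim: n x => [|n IH] x cx xd.
  rewrite mul0r subr_le0 => xc.
  by rewrite (_ : x = c) ?total_variationxx//; apply/eqP; rewrite eq_le xc.
move=> xn; pose y := Num.max c (x - delta / 2).
have cy : c <= y by rewrite le_max lexx.
have yx : y <= x by rewrite ge_max cx/= gerBl ltW.
rewrite (total_variationD f cy yx) fin_numD IH//=; last 2 first.
  exact: le_trans xd.
  rewrite /y maxEle; case: ifPn => _; last by rewrite subrr mulr_ge0// ltW.
  by move: xn; rewrite -natr1 mulrDl mul1r; lra.
rewrite ge0_fin_numE ?total_variation_ge0//.
apply: (@le_lt_trans _ _ 1%:E); last exact: ltry.
have := H [:: (y, x)]; rewrite !big_seq1; apply.
- by rewrite /pairs_in /= cy yx xd.
- by [].
- have : x - delta / 2 <= y by rewrite le_max lexx orbT.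
  by rewrite /=; lra.
Qed.

(** f = V - (V - f), where V is the variation from c; V is absolutely continuous by [rAC_TV]. *)
Lemma rAC_jordan c d f : c <= d -> rAC c d f -> exists g1 g2 : R -> R,
  [/\ {in `[c, d] &, {homo g1 : x y / x <= y}},
      {in `[c, d] &, {homo g2 : x y / x <= y}},
      rAC c d g1, rAC c d g2 & {in `[c, d], forall x, f x = g1 x - g2 x}].
Proof.
move=> cd acf.
pose V x := fine (total_variation c x f).
have fV x : c <= x -> x <= d -> total_variation c x f \is a fin_num.
  move=> cx xd; have := rAC_TV_fin cd acf.
  rewrite (total_variationD f cx xd) fin_numD => /andP[-> //].
have VB x y : c <= x -> x <= y -> y <= d ->
    ((V y - V x)%:E = total_variation x y f)%E.
  move=> cx xy yd; have xd := le_trans xy yd; have cy := le_trans cx xy.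
  have := fV _ cy yd; rewrite /V (total_variationD f cx xy) fin_numD => /andP[h1 h2].
  by rewrite fineD// addrAC subrr add0r fineK.
have fV' x y : c <= x -> x <= y -> y <= d -> `|f y - f x| <= V y - V x.
  by move=> cx xy yd; rewrite -lee_fin VB// total_variation_ge.
have ndV x y : c <= x -> x <= y -> y <= d -> V x <= V y.
  by move=> cx xy yd; rewrite -subr_ge0 (le_trans _ (fV' _ _ cx xy yd)).
have acV : rAC c d V.
  move=> eps e0; have e20 : 0 < eps / 2 by rewrite divr_gt0.
  have [delta d0 H] := rAC_TV acf e20; exists delta => // s s1 s2 s3.
  apply: (@le_lt_trans _ _ (eps / 2)); last by lra.
  rewrite -lee_fin (le_trans _ (H s s1 s2 s3))// -sumEFin big_seq [leRHS]big_seq.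
  apply: lee_sum => p ps; have /allP/(_ _ ps)/and3P[p1 p2 p3] := s1.
  by rewrite -VB// lee_fin ger0_norm// subr_ge0 ndV.
have inE x : x \in `[c, d] -> c <= x /\ x <= d by rewrite in_itv => /andP.
exists V, (fun x => V x - f x); split => //.
- by move=> x y /inE[cx _] /inE[_ yd] xy; exact: ndV.
- move=> x y /inE[cx _] /inE[_ yd] xy.
  have := fV' _ _ cx xy yd; have := ler_norm (f y - f x); lra.
- move=> eps e0; have e20 : 0 < eps / 2 by rewrite divr_gt0.
  have [d1 d10 H1] := acV _ e20; have [d2 d20 H2] := acf _ e20.
  exists (Num.min d1 d2); first by rewrite lt_min d10.
  move=> s s1 s2; rewrite lt_min => /andP[s3 s4].
  apply: (@le_lt_trans _ _ (\sum_(p <- s) `|V p.2 - V p.1| + \sum_(p <- s) `|f p.2 - f p.1|)).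
    rewrite -big_split /=; apply: ler_sum => p _.
    rewrite (le_trans _ (ler_normB _ _))//.
    by rewrite le_eqVlt; apply/orP; left; apply/eqP; congr `|_|; ring.
  by have := H1 s s1 s2 s3; have := H2 s s1 s2 s4; lra.
- by move=> x _; rewrite opprB addrC subrK.
Qed.

End AbsoluteContinuity.

(** * Densities of nondecreasing absolutely continuous functions *)

Section MonotoneDensity.
Context {R : realType}.
Notation mu := (@lebesgue_measure R).
Variables (c d : R) (g : R -> R).
Hypothesis cd : c < d.
Hypothesis nd_g : {in `[c, d] &, {homo g : x y / x <= y}}.
Hypothesis ac_g : rAC c d g.

(** Clamping to [c, d] extends [g] by constants to the whole line, where its Stieltjes measure [nu]
    can be formed. *)
Let cl (x : R) := Num.max c (Num.min x d).
Let G (x : R) := g (cl x).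

Let clP x : c <= cl x /\ cl x <= d.
Proof. by rewrite /cl le_max lexx ge_max (ltW cd) ge_min lexx orbT. Qed.

Let cl_id x : c <= x -> x <= d -> cl x = x.
Proof. by move=> cx xd; rewrite /cl (min_idPl xd); apply/max_idPr. Qed.

Let cl_nd x y : x <= y -> cl x <= cl y.
Proof.
move=> xy; rewrite /cl ge_max !le_max lexx /=; apply/orP; right.
by rewrite le_min !ge_min xy lexx orbT.
Qed.

Let cl_lip x y : x <= y -> cl y - cl x <= y - x.
Proof.
move=> xy; rewrite /cl; have := cd; case: (lerP x d) => ?; case: (lerP y d) => ?;
  do ?[rewrite maxEle; case: ifPn; rewrite -?ltNge => ?]; lra.
Qed.

Let G_nd : nondecreasing_fun G.
Proof.
move=> x y xy; apply: nd_g; rewrite ?in_itv/= ?clP.1 ?clP.2//.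
  by case: (clP x) => -> ->. by case: (clP y) => -> ->.
exact: cl_nd.
Qed.

Let G_unif (eps : R) : 0 < eps -> exists2 delta : R, 0 < delta &
  forall x y, x <= y -> y - x < delta -> G y - G x < eps.
Proof.
move=> /(rAC_unif ac_g)[delta d0 H]; exists delta => // x y xy xyd.
apply: le_lt_trans (ler_norm _) _; apply: H; rewrite ?cl_nd//.
- by case: (clP x).
- by case: (clP y).
- exact: le_lt_trans (cl_lip xy) xyd.
Qed.

Let G_continuous : continuous G.
Proof.
move=> x; apply/cvgrPdist_lt => eps /G_unif[delta d0 H].
apply: (filterS _ (nbhsx_ballx x delta d0)) => y /= xyd.
have [xy|/ltW xy] := leP x y.
  rewrite distrC ger0_norm ?subr_ge0 ?G_nd//; apply: H => //.
  by rewrite -[ltLHS]ger0_norm ?subr_ge0// distrC.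
rewrite ger0_norm ?subr_ge0 ?G_nd//; apply: H => //.
by rewrite -[ltLHS]ger0_norm ?subr_ge0.
Qed.

Let G_rc : right_continuous G.
Proof. exact/right_continuousW/G_continuous. Qed.

Let Gc : cumulative R R := HB.pack G (isCumulative.Build R _ R G G_nd G_rc).
Let nu := lebesgue_stieltjes_measure Gc.

Let nu_oc a b : a <= b -> nu `]a, b]%classic = (G b - G a)%:E.
Proof.
move=> ab; rewrite /nu /lebesgue_stieltjes_measure /measure_extension.
by rewrite measurable_mu_extE/= ?wlength_itv_bnd//; exact: is_ocitv.
Qed.

Let nu_oo a b : a <= b -> (nu `]a, b[%classic <= (G b - G a)%:E)%E.
Proof.
move=> ab; rewrite -nu_oc//; apply: le_measure; rewrite ?inE//.
by apply: subset_itvl; rewrite bnd_simp.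
Qed.

(** An open set is a countable disjoint union of open intervals, each of [nu]-measure at most the
    increment of [G] over it. Clamped to [c, d], finitely many of them form a family to which the
    modulus of [g] applies; the bound passes to the limit. Confinement to (c - 1, d + 1) makes all
    endpoints finite. *)
Let nu_bounded_open (eps delta : R) (U : set R) :
  (forall s, pairs_in c d s -> nonoverlapping s ->
    \sum_(p <- s) (p.2 - p.1) < delta -> \sum_(p <- s) `|g p.2 - g p.1| < eps) ->
  open U -> U `<=` `]c - 1, d + 1[%classic -> (mu U < delta%:E)%E ->
  (nu U <= eps%:E)%E.
Proof.
move=> H oU Ub muU.
pose I := open_disjoint_itv oU.
have IU i : I i `<=` U by rewrite (open_disjoint_itv_bigcup oU); exact: bigcup_sup.
have mI i : measurable (I i) by apply: open_measurable; exact: open_disjoint_itv_open.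
pose a i := inf (I i); pose b i := sup (I i).
have lbI i : lbound (I i) (c - 1).
  by move=> x /IU /Ub /=; rewrite in_itv/= => /andP[/ltW].
have ubI i : ubound (I i) (d + 1).
  by move=> x /IU /Ub /=; rewrite in_itv/= => /andP[_ /ltW].
have IE i : I i = `]a i, b i[%classic.
  rewrite /a /b -interval_bounded_interior//.
  - by apply/esym/interior_id; exact: open_disjoint_itv_open.
  - exact: open_disjoint_itv_is_interval.
  - by exists (c - 1).
  - by exists (d + 1).
pose ne i := `[< I i !=set0 >].
have ab i : ne i -> a i < b i.
  move=> /asboolP[x]; rewrite IE /= in_itv/= => /andP[]; exact: lt_trans.
(* Empty components of the decomposition are replaced by the degenerate interval [d, d]. *)
pose pr i := if ne i then (cl (a i), cl (b i)) else (d, d).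
have nuI i : (nu (I i) <= (`|g (pr i).2 - g (pr i).1|)%:E)%E.
  rewrite /pr; case: ifPn => [/ab abi|/asboolPn nei]; last first.
    have -> : I i = set0 by apply/seteqP; split => // z Iz; case: nei; exists z.
    by rewrite /nu (measure0 (lebesgue_stieltjes_measure Gc)) lee_fin.
  by rewrite IE (le_trans (nu_oo (ltW abi)))// lee_fin ler_norm.
have muI i : (((pr i).2 - (pr i).1)%:E <= mu (I i))%E.
  rewrite /pr; case: ifPn => [/ab abi|_]; last by rewrite subrr.
  by rewrite IE lebesgue_measure_itv/= lte_fin abi -EFinB lee_fin cl_lip// ltW.
have pr_in n : pairs_in c d [seq pr i | i <- iota 0 n].
  apply/allP => p /mapP; case=> i _ ->; rewrite /pr; case: ifPn => [/ab abi|_] /=.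
    by rewrite (clP _).1 (clP _).2 andbT cl_nd// ltW.
  by rewrite lexx (ltW cd).
have trI : trivIset [set: nat] I by exact: open_disjoint_itv_trivIset.
have pr_no n : nonoverlapping [seq pr i | i <- iota 0 n].
  rewrite /nonoverlapping pairwise_map.
  apply/(pairwiseP 0%N) => i j; rewrite size_iota => ni nj ij.
  rewrite !nth_iota// !add0n /= /pr.
  case: ifPn => [nei|_]; last by case: ifPn => _; rewrite /= ?lexx// (clP _).2 orbT.
  case: ifPn => [nej|_] /=; last by rewrite (clP _).2.
  suff : (b i <= a j) || (b j <= a i).
    by move=> /orP[] /cl_nd ->; rewrite ?orbT.
  rewrite -implyNb -ltNge; apply/implyP => aj; rewrite leNgt; apply/negP => ai.
  have abi := ab _ nei; have abj := ab _ nej.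
  pose x := (Num.max (a i) (a j) + Num.min (b i) (b j)) / 2.
  have xlt : Num.max (a i) (a j) < Num.min (b i) (b j).
    by rewrite lt_min !gt_max abi aj ai abj.
  have [x1 x2] : Num.max (a i) (a j) < x /\ x < Num.min (b i) (b j).
    by rewrite /x; split; lra.
  move: x1 x2; rewrite gt_max lt_min => /andP[x1 x2] /andP[x3 x4].
  have : (I i `&` I j) !=set0.
    by exists x; rewrite !IE /= !in_itv/= x1 x2 x3 x4.
  by move=> /trI => /(_ Logic.I Logic.I) eij; rewrite eij ltnn in ij.
have UE : U = \bigcup_i I i := open_disjoint_itv_bigcup oU.
rewrite [X in nu X]UE [leLHS](measure_bigcup (lebesgue_stieltjes_measure Gc))//=; last first.
  by move=> i _; exact: mI.
apply: lime_le; first by apply: is_cvg_nneseries => *; exact: measure_ge0.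
apply: nearW => n; rewrite big_mkord.
apply: (@le_trans _ _ (\sum_(i < n) (`|g (pr i).2 - g (pr i).1|)%:E)%E).
  rewrite (eq_bigl xpredT) => [|i]; last by rewrite in_setT.
  by apply: lee_sum => i _; exact: nuI.
rewrite sumEFin lee_fin ltW//.
rewrite -(big_mkord xpredT (fun i => `|g (pr i).2 - g (pr i).1|)).
have := H _ (pr_in n) (pr_no n); rewrite !big_map /index_iota subn0; apply.
rewrite -lte_fin; apply: le_lt_trans muU.
have -> : mu U = (\sum_(i <oo) mu (I i))%E.
  rewrite [X in mu X]UE [LHS]measure_bigcup//=; last by move=> i _; exact: mI.
  by apply: eq_eseriesl => i; rewrite in_setT.
apply: le_trans (nneseries_lim_ge n _) => //.
by rewrite -sumEFin /index_iota subn0; apply: lee_sum => i _; exact: muI.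
Qed.

Let D := `]c, d]%classic : set R.

Let nuD_fin : (nu D < +oo)%E.
Proof. by rewrite /D nu_oc ?ltry// ltW. Qed.

Let mD : measurable (D : set (measurableTypeR R)).
Proof. exact: measurable_itv. Qed.

Let nuD : {finite_measure set (measurableTypeR R) -> \bar R} := mfrestr mD nuD_fin.

(** By outer regularity a Lebesgue-null set lies in an open set of Lebesgue measure below delta, on
    which [nu] is at most eps. *)
Let nuD_dom : nuD `<< mu.
Proof.
apply/null_content_dominatesP => A mA muA0.
have mAD : measurable (A `&` D : set (measurableTypeR R)) by exact: measurableI.
have muAD : mu (A `&` D) = 0%E.
  by apply: subset_measure0 muA0 => //; exact: subIsetl.
apply/eqP; rewrite eq_le measure_ge0 andbT /= /mfrestr /mrestr.
apply/lee_addgt0Pr => eps e0; rewrite add0e.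
have [delta d0 H] := ac_g e0.
have [|U [oU ADU UAD]] := lebesgue_regularity_outer mAD _ d0.
  by rewrite [ltLHS]muAD ltry.
pose V := U `&` `]c - 1, d + 1[%classic.
have oV : open V by apply: openI => //; exact: interval_open.
have mU : measurable (U : set (measurableTypeR R)) by exact: open_measurable.
apply: (@le_trans _ _ (nu V)).
  apply: le_measure; rewrite ?inE//; first exact: open_measurable.
  move=> x xAD; split; first exact: ADU.
  by move: xAD.2; rewrite /D /= !in_itv/=; lra.
apply: (nu_bounded_open H) => //; first by move=> x [].
apply: le_lt_trans UAD.
apply: (@le_trans _ _ (mu (U `\` (A `&` D)) + mu (A `&` D))%E); last first.
  by rewrite muAD adde0.
apply: le_trans (measureU2 _ _ _) => //; last exact: measurableD.
apply: le_measure; rewrite ?inE//.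
- exact: open_measurable.
- by apply: measurableU => //; exact: measurableD.
- move=> x [Ux _]; have [xAD|xAD] := pselect ((A `&` D) x); first by right.
  by left.
Qed.

(** The density is the Radon-Nikodym derivative of the Stieltjes measure restricted to (c, d]. *)
Lemma nondecreasing_rAC_density : exists h : R -> R,
  mu.-integrable [set: R] (EFin \o h) /\
  forall x, c <= x -> x <= d -> g x - g c = \int[mu]_(t in `[c, x]) h t.
Proof.
pose f := Radon_Nikodym_SigmaFinite.f nuD mu.
have fE t : f t = (fine (f t))%:E.
  by rewrite fineK// Radon_Nikodym_SigmaFinite.f_fin_num.
have fint := Radon_Nikodym_SigmaFinite.f_integrable nuD_dom.
have ih : mu.-integrable [set: R] (EFin \o (fine \o f)).
  by apply: eq_integrable fint => // x _ /=; rewrite [LHS]fE.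
exists (fine \o f); split => //.
move=> x cx xd.
have mI : measurable (`]c, x]%classic : set (measurableTypeR R)) by [].
have := Radon_Nikodym_SigmaFinite.f_integral nuD_dom mI.
rewrite /= /mfrestr /mrestr.
have -> : `]c, x]%classic `&` D = `]c, x]%classic.
  apply/setIidl => t; rewrite /D /= !in_itv/=; lra.
rewrite [X in X = _ -> _]nu_oc// /G !cl_id// ?ltW//.
move=> /(congr1 fine) /= ->.
rewrite -Rintegral_itv_obnd_cbnd.
  by rewrite /Rintegral; congr fine; apply: eq_integral => t _; rewrite fE.
by apply: integrableS ih.
Qed.

End MonotoneDensity.

(** * Fundamental theorem of calculus for absolutely continuous functions *)

Section FundamentalTheorem.
Context {R : realType}.
Notation mu := (@lebesgue_measure R).
Implicit Types (a b c d x y : R) (f g h : R -> R).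

Lemma near_cstD_derive1 (F f : R -> R) c l x :
  derivable F x 1 -> derive1 F x = l -> (\forall t \near x, c + F t = f t) ->
  derivable f x 1 /\ derive1 f x = l.
Proof.
move=> dF F' near_eq.
have h1 : is_derive x (1:R) F l by rewrite -F' derive1E; exact: DeriveDef.
have [dcF E] := is_deriveD (is_derive_cst c x (1:R)) h1.
split; first exact: near_eq_derivable near_eq dcF.
by rewrite derive1E -(near_eq_derive _ near_eq); apply: (etrans E); exact: add0r.
Qed.

Lemma rAC_density c d f : c < d -> rAC c d f -> exists h : R -> R,
  mu.-integrable [set: R] (EFin \o h) /\
  forall x, c <= x -> x <= d -> f x - f c = \int[mu]_(t in `[c, x]) h t.
Proof.
move=> cd /(rAC_jordan (ltW cd))[g1 [g2 [nd1 nd2 ac1 ac2 fE]]].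
have [h1 [i1 h1E]] := nondecreasing_rAC_density cd nd1 ac1.
have [h2 [i2 h2E]] := nondecreasing_rAC_density cd nd2 ac2.
exists (fun t => h1 t - h2 t); split.
  by have := integrableB measurableT i1 i2; apply: eq_integrable.
move=> x cx xd; rewrite RintegralB//; last 2 first.
  by apply: integrableS i1.
  by apply: integrableS i2.
rewrite -h1E// -h2E// !fE ?in_itv/= ?lexx ?cx ?xd ?(ltW cd)//; ring.
Qed.

(** The Jordan decomposition reduces the integral representation to the monotone case;
    differentiating the primitive of the density almost everywhere then identifies the
    derivative. *)
Lemma rAC_derivable c d f : c < d -> rAC c d f -> exists h : R -> R,
  [/\ mu.-integrable [set: R] (EFin \o h),
      forall x y, c <= x -> x <= y -> y <= d ->
        f y - f x = \int[mu]_(t in `[x, y]) h t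
    & {ae mu, forall x, c < x < d -> derivable f x 1 /\ f^`()%classic x = h x}].
Proof.
move=> cd acf; have [h [ih hE]] := rAC_density cd acf.
exists h; split => //.
  move=> x y cx xy yd.
  have -> : f y - f x = (f y - f c) - (f x - f c) by ring.
  rewrite hE ?(le_trans cx)// hE// ?(le_trans xy)//.
  rewrite Rintegral_itvB ?bnd_simp//; last by apply: integrableS ih.
  rewrite Rintegral_itv_obnd_cbnd//.
  by apply: integrableS ih.
have lh : locally_integrable [set: R] h.
  by apply: open_integrable_locally => //; exact: openT.
have iy y : mu.-integrable [set` Interval (BLeft c) (BRight y)] (EFin \o h).
  exact: integrableS ih.
have := FTC1 iy lh; apply: filterS; first exact: (ae_filter_ringOfSetsType mu).
move=> x H /andP[cx xd].
have [] := H; first by rewrite lte_fin.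
set F := fun x => _ => dF F'.
have near_eq : \forall t \near x, f c + F t = f t.
  have : \forall t \near x, t \in `]c, d[.
    by apply: near_in_itvoo; rewrite in_itv/= cx.
  by apply: filterS => t; rewrite in_itv/= => /andP[ct td]; rewrite /F -hE ?ltW// addrCA subrr addr0.
exact: near_cstD_derive1 dF F' near_eq.
Qed.

(** In this form [r] is compared with the derivative only where the latter exists: existence almost
    everywhere, and integrability, are supplied by absolute continuity. *)
Lemma rAC_integral c d f r : c <= d -> rAC c d f ->
  measurable_fun `[c, d] r ->
  {ae mu, forall x, c < x < d -> derivable f x 1 -> f^`()%classic x = r x} ->
  mu.-integrable `[c, d] (EFin \o r) /\ f d - f c = \int[mu]_(t in `[c, d]) r t.
Proof.
rewrite le_eqVlt => /predU1P[<- _ mr _|cd acf mr fr].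
  rewrite set_itv1 Rintegral_set1 subrr; split => //.
  rewrite set_itv1 in mr; apply/integrableP; split; first exact/measurable_EFinP.
  by rewrite integral_set1.
have [h [ih hE dh]] := rAC_derivable cd acf.
have ihcd : mu.-integrable `[c, d] (EFin \o h) by exact: integrableS ih.
have mh : measurable_fun `[c, d] (EFin \o h) by case/integrableP: ihcd.
have hr : ae_eq mu `[c, d]%classic (EFin \o h) (EFin \o r).
  have F := ae_filter_ringOfSetsType mu.
  have : {ae mu, forall x, x != c /\ x != d}.
    exists [set c; d]; split; first by apply: measurableU; exact: measurable_set1.
      by apply/countable_lebesgue_measure0/finite_set_countable.
    move=> x /= /not_andP[] /negP/negPn/eqP ->; by [left|right].
  apply: filterS2 (filterI fr dh) => x [H1 H2] [xc xd] /=.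
  rewrite in_itv/= => /andP[cx xd']; congr EFin.
  have cxd : c < x < d by rewrite !lt_neqAle cx xd' eq_sym xc xd.
  by have [dx <-] := H2 cxd; apply: H1.
have ir : mu.-integrable `[c, d] (EFin \o r).
  have mr' : measurable_fun `[c, d] (EFin \o r) by exact/measurable_EFinP.
  have /integrableP[_] := ihcd; rewrite (@ae_eq_integral _ _ _ mu _ (abse \o (EFin \o r)))//.
  - by move=> hfin; apply/integrableP.
  - exact: measurableT_comp.
  - exact: measurableT_comp.
  - exact: (ae_eq_comp abse hr).
split => //; rewrite (hE c d)// ?ltW// /Rintegral; congr fine.
by apply: ae_eq_integral => //; exact/measurable_EFinP.
Qed.

Lemma rAC_bounded c d f : c <= d -> rAC c d f ->
  exists M : R, 0 <= M /\ forall x, c <= x -> x <= d -> `|f x| <= M.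
Proof.
move=> cd acf; have tvf := rAC_TV_fin cd acf.
exists (`|f c| + fine (total_variation c d f)); split.
  by rewrite addr_ge0// fine_ge0// total_variation_ge0.
move=> x cx xd; have -> : f x = f c + (f x - f c) by ring.
rewrite (le_trans (ler_normD _ _))// lerD2l -lee_fin fineK//.
rewrite (le_trans (total_variation_ge _ cx))//.
by rewrite (total_variationD f cx xd) leeDl// total_variation_ge0.
Qed.

(** The increment of the product is g(y) (f(y) - f(x)) + f(x) (g(y) - g(x)), with both outer factors
    bounded. *)
Lemma rAC_mul c d f g : c <= d -> rAC c d f -> rAC c d g -> rAC c d (f \* g).
Proof.
move=> cd acf acg eps e0.
have [M [M0 Mf]] := rAC_bounded cd acf.
have [N [N0 Ng]] := rAC_bounded cd acg.
have hM (K : R) : 0 <= K -> 0 < eps / 2 / (K + 1).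
  by move=> K0; rewrite !divr_gt0// ltr_wpDl.
have [d1 d10 H1] := acf _ (hM _ N0); have [d2 d20 H2] := acg _ (hM _ M0).
exists (Num.min d1 d2); first by rewrite lt_min d10.
move=> s s1 s2; rewrite lt_min => /andP[s3 s4].
have {}H1 := H1 _ s1 s2 s3; have {}H2 := H2 _ s1 s2 s4.
apply: (@le_lt_trans _ _ (N * \sum_(p <- s) `|f p.2 - f p.1|
    + M * \sum_(p <- s) `|g p.2 - g p.1|)).
  rewrite !mulr_sumr -big_split /= big_seq [leRHS]big_seq.
  apply: ler_sum => p ps; have /allP/(_ _ ps)/and3P[p1 p2 p3] := s1.
  have -> : f p.2 * g p.2 - f p.1 * g p.1 =
    g p.2 * (f p.2 - f p.1) + f p.1 * (g p.2 - g p.1) by ring.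
  rewrite (le_trans (ler_normD _ _))// !normrM lerD// ler_wpM2r//.
    by rewrite Ng// (le_trans p1).
  by rewrite Mf// (le_trans p2).
have half (K A : R) : 0 <= K -> 0 <= A -> A < eps / 2 / (K + 1) -> K * A < eps / 2.
  move=> K0 A0; rewrite ltr_pdivlMr ?ltr_wpDl//; nra.
have := half _ _ N0 _ H1; have := half _ _ M0 _ H2.
rewrite !sumr_ge0// => /(_ isT) h1 /(_ isT) h2; lra.
Qed.

Lemma rAC_sub c d f g : rAC c d f -> rAC c d g -> rAC c d (f \- g).
Proof.
move=> acf acg eps e0; have e20 : 0 < eps / 2 by rewrite divr_gt0.
have [d1 d10 H1] := acf _ e20; have [d2 d20 H2] := acg _ e20.
exists (Num.min d1 d2); first by rewrite lt_min d10.
move=> s s1 s2; rewrite lt_min => /andP[s3 s4].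
apply: (@le_lt_trans _ _
    (\sum_(p <- s) `|f p.2 - f p.1| + \sum_(p <- s) `|g p.2 - g p.1|)).
  rewrite -big_split /=; apply: ler_sum => p _.
  rewrite (le_trans _ (ler_normB _ _))//.
  by rewrite le_eqVlt; apply/orP; left; apply/eqP; congr `|_|; ring.
by have := H1 s s1 s2 s3; have := H2 s s1 s2 s4; lra.
Qed.

Lemma lipschitz_rAC c d f (M : R) : 0 <= M ->
  (forall x y, c <= x -> x <= y -> y <= d -> `|f y - f x| <= M * (y - x)) ->
  rAC c d f.
Proof.
move=> M0 H eps e0; exists (eps / (M + 1)); first by rewrite divr_gt0// ltr_wpDl.
move=> s s1 s2; rewrite ltr_pdivlMr ?ltr_wpDl// => s3.
apply: (@le_lt_trans _ _ (M * \sum_(p <- s) (p.2 - p.1))).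
  rewrite mulr_sumr big_seq [leRHS]big_seq; apply: ler_sum => p ps.
  by have /allP/(_ _ ps)/and3P[p1 p2 p3] := s1; exact: H.
apply: le_lt_trans s3; rewrite mulrC ler_wpM2l ?lerDl//.
rewrite big_seq; apply: sumr_ge0 => p ps.
by have /allP/(_ _ ps)/and3P[_ p2 _] := s1; rewrite subr_ge0.
Qed.

Lemma C1_rAC c d f f' : c <= d ->
  (forall x, c <= x <= d -> is_derive x (1:R) f (f' x)) ->
  (forall x, c <= x <= d -> {for x, continuous f'}) -> rAC c d f.
Proof.
move=> cd df cf'.
have cn : {within `[c, d], continuous (fun x => `|f' x|)}.
  apply: continuous_in_subspaceT => x; rewrite inE/= in_itv/= => xcd.
  by apply: cvg_norm; exact: cf'.
have [z zcd zM] := EVT_max cd cn.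
apply: (@lipschitz_rAC _ _ _ `|f' z|) => // x y cx xy yd.
have [] := @MVT_segment _ f f' x y xy.
- move=> t; rewrite in_itv/= => /andP[xt ty]; apply: df.
  by rewrite (le_trans cx (ltW xt)) (le_trans (ltW ty)).
- apply: continuous_in_subspaceT => t; rewrite inE/= in_itv/= => /andP[xt ty].
  apply/differentiable_continuous/derivable1_diffP.
  by have [] := df t; rewrite ?(le_trans cx xt) ?(le_trans ty).
move=> t; rewrite in_itv/= => /andP[xt ty] ->.
rewrite normrM [`|y - x|]ger0_norm ?subr_ge0// ler_wpM2r ?subr_ge0//.
by apply: zM; rewrite in_itv/= (le_trans cx xt) (le_trans ty).
Qed.

(** Absolute continuity of the Lebesgue integral, applied to the union of the given intervals. *)
Lemma rAC_primitive a b h c d : mu.-integrable `]a, b[ (EFin \o h) ->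
  a <= c -> d < b -> rAC c d (fun x => \int[mu]_(t in `]a, x]) h t).
Proof.
move=> ih ac db eps e0.
have ih' : mu.-integrable setT (EFin \o (h \_ `]a, b[)).
  by rewrite -restrict_EFin -integrable_mkcond.
have [delta [d0 H]] := integral_normr_continuous ih' e0.
exists delta => // s s1 s2 s3.
pose A (s : seq (R * R)) := \big[setU/set0]_(p <- s) `]p.1, p.2]%classic.
have mA u : measurable (A u) by apply: bigsetU_measurable.
suff K u : pairs_in c d u -> nonoverlapping u ->
    [/\ mu (A u) = (\sum_(p <- u) (p.2 - p.1))%:E, A u `<=` `]a, b[ &
       \sum_(p <- u) `|\int[mu]_(t in `]a, p.2]) h t - \int[mu]_(t in `]a, p.1]) h t|
        <= \int[mu]_(x in A u) `|(h \_ `]a, b[) x|].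
  have [muA _ le] := K s s1 s2; apply: le_lt_trans le _.
  apply: H; first exact: mA.
  apply: (@le_lt_trans _ _ (\sum_(p <- s) (p.2 - p.1))%:E); first by rewrite -muA.
  by rewrite lte_fin.
elim: u => [_ _|[x y] u IH].
  by rewrite /A !big_nil measure0 Rintegral_set0; split.
rewrite /pairs_in /nonoverlapping /= => /andP[/and3P[cx xy yd] ucd] /andP[nxy nu].
have [muA Aab leA] := IH ucd nu.
have sxy : `]x, y]%classic `<=` `]a, b[%classic.
  move=> t /=; rewrite !in_itv/= => /andP[xt ty].
  by rewrite (le_lt_trans _ xt) ?(le_trans ac)//= (le_lt_trans ty)// (le_lt_trans yd).
have dis : [disjoint `]x, y]%classic & A u].
  apply/disj_setPS => t []; rewrite /A /= in_itv/= => /andP[xt ty].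
  rewrite -bigcup_seq => -[p /= pu]; rewrite in_itv/= => /andP[pt tp].
  have /allP/(_ _ pu)/= /orP[h1|h1] := nxy.
    by have := le_lt_trans h1 pt; rewrite ltNge ty.
  by have := le_lt_trans h1 xt; rewrite ltNge tp.
have iabs B : measurable B -> mu.-integrable B (EFin \o (fun x => `|(h \_ `]a, b[) x|)).
  move=> mB; have := integrable_abse ih'.
  by move=> /(integrableS measurableT mB (@subsetT _ _)).
split.
- rewrite /A !big_cons -/(A u).
  have -> : mu (`]x, y]%classic `|` A u) = (mu `]x, y]%classic + mu (A u))%E.
    by apply: measureU; [exact: measurable_itv|exact: mA|exact/disj_set2P].
  by rewrite muA lebesgue_measure_itv/= lte_fin; move: xy; rewrite le_eqVlt => /predU1P[->|->];
    rewrite ?ltxx ?subrr ?add0e ?add0r// -EFinB -EFinD.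
- by rewrite /A big_cons subUset.
rewrite /A !big_cons -/(A u) Rintegral_setU; last 4 first.
- exact: measurable_itv.
- exact: mA.
- by apply: iabs; apply: measurableU; [exact: measurable_itv|exact: mA].
- exact/disj_set2P/disj_set2P.
rewrite lerD//=.
rewrite Rintegral_itvB ?bnd_simp//; last 2 first.
  apply: integrableS ih => // t /=; rewrite !in_itv/= => /andP[-> ty] /=.
  by rewrite (le_lt_trans ty)// (le_lt_trans yd).
  exact: le_trans cx.
apply: le_trans (le_normr_Rintegral _ _) _ => //; first exact: integrableS ih.
rewrite le_eqVlt; apply/orP; left; apply/eqP; apply: eq_Rintegral => t txy.
by rewrite patchE mem_set//; apply: sxy; move: txy; rewrite inE.
Qed.

End FundamentalTheorem.

(** * Local absolute continuity on (-1,1) *)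

Section LocalAbsoluteContinuity.
Context {R : realType}.
Notation mu := (@lebesgue_measure R).
Implicit Types (c d x y : R) (f g : R -> R).

Definition rAC_loc f := forall c d, -1 < c -> c <= d -> d < 1 -> rAC c d f.

Lemma rAC_loc_continuous f x : rAC_loc f -> -1 < x < 1 -> {for x, continuous f}.
Proof.
move=> acf /andP[x1 x2].
pose c := (x - 1) / 2; pose d := (x + 1) / 2.
have c1 : -1 < c by rewrite /c; lra.
have d1 : d < 1 by rewrite /d; lra.
have cd : c <= d by rewrite /c /d; lra.
apply/cvgrPdist_lt => eps e0.
have [delta d0 H] := rAC_unif (acf _ _ c1 cd d1) e0.
have : \forall y \near x, y \in `]c, d[.
  by apply: near_in_itvoo; rewrite in_itv/= /c /d; lra.
apply: filterS2 (nbhsx_ballx x delta d0) => y.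
rewrite /ball /= in_itv/= => xyd /andP[cy yd].
have [xy|/ltW xy] := leP x y.
  rewrite distrC; apply: H; rewrite ?(ltW yd)//; first by rewrite /c; lra.
  by rewrite -[ltLHS]ger0_norm ?subr_ge0// distrC.
apply: H; rewrite ?(ltW cy)//; first by rewrite /d; lra.
by rewrite -[ltLHS]ger0_norm ?subr_ge0.
Qed.

(** Exhaustion by the intervals [-1 + 1/(n+2), 1 - 1/(n+2)]: a countable union of null sets is
    null. *)
Lemma rAC_loc_derivable f : rAC_loc f ->
  {ae mu, forall x, -1 < x < 1 -> derivable f x 1}.
Proof.
move=> acf; pose c n : R := -1 + n.+2%:R^-1; pose d n : R := 1 - n.+2%:R^-1.
have n2 n : 0 < n.+2%:R^-1 :> R by rewrite invr_gt0.
have n2' n : n.+2%:R^-1 <= 2^-1 :> R by rewrite lef_pV2 ?posrE// ler_nat.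
have cd n : c n <= d n by rewrite /c /d; have := n2' n; move: (_^-1) => e; lra.
have H n : {ae mu, forall x, c n < x < d n -> derivable f x 1}.
  have F := ae_filter_ringOfSetsType mu.
  have c1 : -1 < c n by rewrite /c; have := n2 n; move: (_^-1) => e; lra.
  have d1 : d n < 1 by rewrite /d; have := n2 n; move: (_^-1) => e; lra.
  have := cd n; rewrite le_eqVlt => /predU1P[e|cdn].
    by apply: aeW => x; rewrite e => /andP[/lt_trans h /h]; rewrite ltxx.
  have [h [_ _]] := rAC_derivable cdn (acf _ _ c1 (cd n) d1).
  by apply: filterS => x K /K[].
have F := ae_filter_ringOfSetsType mu.
apply: (filterS _ (ae_foralln H)) => x K /andP[x1 x2].
pose r := Num.min (1 + x) (1 - x).
have r0 : 0 < r by rewrite lt_min; apply/andP; split; lra.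
pose n := Num.truncn (r^-1).
have nr : n.+2%:R^-1 < r.
  rewrite invf_plt ?posrE// (lt_trans (truncnS_gt _))// ltr_nat//.
have [r1 r2] : r <= 1 + x /\ r <= 1 - x by rewrite /r !ge_min !lexx orbT.
by apply: (K n); rewrite /c /d; move: nr; move: (n.+2%:R^-1) => e nr; apply/andP; split; lra.
Qed.

Lemma C1_rAC_loc f f' :
  (forall x, -1 < x < 1 -> is_derive x (1:R) f (f' x)) ->
  (forall x, -1 < x < 1 -> {for x, continuous f'}) -> rAC_loc f.
Proof.
move=> df cf c d c1 cd d1; apply: (@C1_rAC _ _ _ _ f') => // x /andP[cx xd].
  by apply: df; rewrite (lt_le_trans c1)//= (le_lt_trans xd).
by apply: cf; rewrite (lt_le_trans c1)//= (le_lt_trans xd).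
Qed.

End LocalAbsoluteContinuity.

(** * Borel measurability of the derivative of a continuous function *)

Section MeasurableDerivative.
Context {R : realType}.
Variable f : R -> R.
Hypothesis cf : forall x, -1 < x < 1 -> {for x, continuous f}.

Let D : set R := `]-1, 1[%classic.
Let g := f \_ D.
Let Q (h x : R) := h^-1 * (g (h + x) - g x).

Let gE x : D x -> g x = f x.
Proof. by move=> Dx; rewrite /g patchE mem_set. Qed.

Let nearD x : D x -> \forall y \near x, D y.
Proof. by move=> Dx; apply: near_in_itvoo. Qed.

Let mg : measurable_fun setT g.
Proof.
apply/(measurable_restrictT _ _).1; first exact: measurable_itv.
apply: open_continuous_measurable_fun; first exact: interval_open.
by move=> x; rewrite inE /D /= in_itv/= => /cf.
Qed.

Let mQ h : measurable_fun setT (Q h).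
Proof.
apply: measurable_funM => //; apply: measurable_funB => //.
by apply: measurableT_comp => //; apply: measurable_funD.
Qed.

Let cQ x h : D x -> D (h + x) -> h != 0 -> {for h, continuous (Q ^~ x)}.
Proof.
move=> Dx Dhx h0; apply: cvgM; first exact: cvgV.
apply: cvgB; last exact: cvg_cst.
have cg : {for h + x, continuous g}.
  have : f @ (h + x) --> f (h + x) by apply: cf; move: Dhx; rewrite /D /= in_itv.
  rewrite -(gE Dhx); apply: cvg_trans.
  by apply: near_eq_cvg; apply: filterS (nearD Dhx) => y Dy; rewrite gE.
apply: (@continuous_comp _ _ _ (fun h => h + x) g) => //.
by apply: cvgD; [exact: cvg_id|exact: cvg_cst].
Qed.

(** Cauchy criterion for the difference quotients at x, tested on the i-th pair of rational
    increments: oscillation at most 1/(k+1) for nonzero increments below 1/(n+1). An index coding no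
    pair imposes nothing. Restriction to countably many conditions makes [E] a Borel set. *)
Let S (k n i : nat) : set R := [set x |
  if unpickle i is Some (p, q) then
    ((0 < `|ratr p : R| < n.+1%:R^-1) && (0 < `|ratr q : R| < n.+1%:R^-1))
     ==> (`|Q (ratr p) x - Q (ratr q) x| <= k.+1%:R^-1)
  else true].

Let mS k n i : measurable (S k n i).
Proof.
rewrite /S; case: (unpickle i) => [[p q]|]; last first.
  by rewrite (_ : [set _ | _] = setT)//; apply/seteqP; split.
case: (_ && _) => /=; last first.
  by rewrite (_ : [set _ | _] = setT)//; apply/seteqP; split.
have : measurable_fun setT (fun x => `|Q (ratr p) x - Q (ratr q) x|).
  by apply: measurableT_comp => //; exact: measurable_funB.
move=> /(_ measurableT `]-oo, k.+1%:R^-1]%classic (measurable_itv _)).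
by rewrite setTI; congr (measurable _); apply/seteqP; split => x /=; rewrite in_itv.
Qed.

Let E := \bigcap_k \bigcup_n \bigcap_i S k n i.

Let mE : measurable E.
Proof.
by apply: bigcapT_measurable => k; apply: bigcupT_measurable => n; exact: bigcapT_measurable.
Qed.

Let nearQ x : D x ->
  {near 0^', (fun h => h^-1 *: (f (h + x) - f x)) =1 Q ^~ x}.
Proof.
move=> Dx; apply: nbhs_dnbhs.
have c0 : {for 0, continuous (fun h : R => h + x)}.
  by apply: cvgD; [exact: cvg_id|exact: cvg_cst].
have : \forall h \near (0:R), D (h + x) by apply: c0; rewrite add0r; exact: nearD.
by apply: filterS => h Dh; rewrite /Q !gE.
Qed.

Let dQ x : D x -> derivable f x 1 <-> cvg (Q h x @[h --> 0^']).
Proof.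
move=> Dx; rewrite /derivable.
have -> : (fun h : R => h^-1 *: ((f \o shift x) (h *: 1) - f x)) =
    (fun h => h^-1 *: (f (h + x) - f x)).
  by apply/funext => h /=; rewrite [h *: 1]mulr1.
split => [|] /cvg_ex[l cl]; apply/cvg_ex; exists l.
  by apply: cvg_trans cl; apply: near_eq_cvg; apply: filterS (nearQ Dx) => h ->.
by apply: cvg_trans cl; apply: near_eq_cvg; apply: filterS (nearQ Dx) => h ->.
Qed.

(** Continuity of [f] lets rational increments approximate arbitrary ones, so the rational Cauchy
    criterion is equivalent to convergence. *)
Let EP x : D x -> E x <-> cvg (Q h x @[h --> 0^']).
Proof.
move=> Dx; split=> [Ex|/cvg_ex[l cl] k _]; last first.
  have k0 : 0 < k.+1%:R^-1 / 2 :> R by rewrite divr_gt0.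
  move/cvgrPdist_lt : cl => /(_ _ k0) /nbhs_ballP[r /= r0 H].
  exists (Num.truncn (r^-1)) => // i _; rewrite /S /=; case: (unpickle i) => [[p q]|//].
  apply/implyP => /andP[/andP[p0 p1] /andP[q0 q1]].
  have nr : (Num.truncn r^-1).+1%:R^-1 < r.
    by rewrite invf_plt ?posrE// truncnS_gt.
  have Hp := H (ratr p) _; have Hq := H (ratr q) _.
  rewrite /ball /= !sub0r !normrN -!normr_gt0 in Hp Hq.
  have {}Hp := Hp (lt_trans p1 nr) p0; have {}Hq := Hq (lt_trans q1 nr) q0.
  have -> : Q (ratr p) x - Q (ratr q) x = (l - Q (ratr q) x) - (l - Q (ratr p) x) by ring.
  by rewrite (le_trans (ler_normB _ _))//; move: (k.+1%:R^-1) Hp Hq => e' *; lra.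
apply: cauchy_cvg; apply/cauchy_ballP => e e0.
pose k := Num.truncn ((e / 3)^-1).
have ke : k.+1%:R^-1 < e / 3 by rewrite invf_plt ?posrE ?divr_gt0// truncnS_gt.
have [n _ En] := Ex k Logic.I.
have : \forall h \near 0^', h != 0 /\ (`|h| < n.+1%:R^-1 /\ D (h + x)).
  near=> h; split; first by near: h; exact: nbhs_dnbhs_neq.
  split.
    near: h; apply: nbhs_dnbhs.
    have := nbhsx_ballx (0:R) n.+1%:R^-1; rewrite invr_gt0 ltr0n => /(_ isT).
    by apply: filterS => h; rewrite /ball /= sub0r normrN.
  near: h; apply: nbhs_dnbhs.
  have c0 : {for 0, continuous (fun h : R => h + x)}.
    by apply: cvgD; [exact: cvg_id|exact: cvg_cst].
  by apply: c0; rewrite add0r; exact: nearD.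
move=> near0.
have approx h : h != 0 -> `|h| < n.+1%:R^-1 -> D (h + x) -> exists q : rat,
    0 < `|ratr q : R| < n.+1%:R^-1 /\ `|Q h x - Q (ratr q) x| < e / 3.
  move=> h0 hn Dhx.
  have e30 : 0 < e / 3 by rewrite divr_gt0.
  have /cvgrPdist_lt/(_ _ e30) c1 := cQ Dx Dhx h0.
  have c2 : \forall t \near h, 0 < `|t| /\ `|t| < n.+1%:R^-1.
    have cn : (fun t : R => `|t|) @ h --> `|h| by apply: cvg_norm; exact: cvg_id.
    apply: filterI; last exact: cvgr_lt cn _ hn.
    by apply: cvgr_gt cn _ _; rewrite normr_gt0.
  have : \forall t \near h, `|Q h x - Q t x| < e / 3 /\ (0 < `|t| /\ `|t| < n.+1%:R^-1).
    by apply: filterI; [exact: c1|exact: c2].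
  move=> /nbhs_ballP[r /= r0 Hr].
  have [q] : exists q : rat, ratr q \in `]h - r, h + r[ by apply: rat_in_itvoo; lra.
  rewrite in_itv/= => qr; exists q.
  have [] := Hr (ratr q); first by rewrite /ball /= ltr_distlC.
  by move=> h1 [-> ->].
pose A := [set y | exists h, [/\ h != 0, `|h| < n.+1%:R^-1, D (h + x) & y = Q h x]].
have FA : \forall h \near 0^', A (Q h x).
  by apply: filterS near0 => h [? [? ?]]; exists h.
exists (A, A); first by split.
move=> [_ _] [/= [h [h0 hn Dh ->]] [h' [h0' hn' Dh' ->]]].
have [q [q1 q2]] := approx _ h0 hn Dh; have [p [p1 p2]] := approx _ h0' hn' Dh'.
have [j jE] : exists j, unpickle j = Some (q, p) by eexists; exact: pickleK.
have := En j Logic.I; rewrite /S /mkset jE q1 p1 => /implyP/(_ isT) qp.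
  rewrite /ball /=.
  have -> : Q h x - Q h' x = (Q h x - Q (ratr q) x) + (Q (ratr q) x - Q (ratr p) x)
      - (Q h' x - Q (ratr p) x) by ring.
  rewrite (le_lt_trans (ler_normB _ _))//.
  have := ler_normD (Q h x - Q (ratr q) x) (Q (ratr q) x - Q (ratr p) x).
  by have := le_lt_trans qp ke; lra.
Unshelve. all: by end_near. Qed.

(** On [E] the derivative is the limit of the quotients with increment 1/(n+1); off [E] it is the
    default value [point] of a missing limit, hence constant. Applied to u', this makes the
    second-order term of the differential expression measurable. *)
Lemma measurable_derive1 : measurable_fun (`]-1, 1[%classic : set R) (derive1 f).
Proof.
have [c0 c0P] : exists c0, forall x, D x -> ~ E x -> derive1 f x = c0.
  exists (point : R) => x Dx nEx; rewrite derive1E /derive.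
  have ncv := contra_not (EP Dx).2 nEx.
  rewrite [LHS]dvgP; first by [].
  by move=> /(dQ Dx)/ncv.
pose s n x := \1_E x * Q n.+1%:R^-1 x + (1 - \1_E x) * c0.
apply: (@measurable_fun_cvg _ _ _ D s) => [n|x Dx].
  apply: (@measurable_funS _ _ _ _ setT) => //.
  have mi : measurable_fun setT (\1_E : R -> R) by exact: measurable_indic.
  apply: measurable_funD; apply: measurable_funM => //.
  exact: measurable_funB.
rewrite /s indicE; case: (boolP (x \in E)) => [|/negP]; rewrite inE => Ex; last first.
  by rewrite c0P// subr0 mul1r; under eq_cvg do rewrite mul0r add0r; exact: cvg_cst.
under eq_cvg do rewrite subrr mul1r mul0r addr0.
have /cvg_ex[l cl] := (EP Dx).1 Ex.
have -> : derive1 f x = l.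
  apply: cvg_lim => //; apply: cvg_trans cl.
  by apply: near_eq_cvg; apply: filterS (nearQ Dx) => h ->.
apply/cvgrPdist_lt => e e0.
move/cvgrPdist_lt : cl => /(_ _ e0) /nbhs_ballP[r /= r0 H].
near=> n; apply: H; last by rewrite invr_eq0 pnatr_eq0.
rewrite /ball /= sub0r normrN ger0_norm//.
by near: n; exact: (near_infty_natSinv_lt (PosNum r0)).
Unshelve. all: by end_near. Qed.

End MeasurableDerivative.

(** * Weighted square-integrable functions *)

Section WeightedL2.
Context {R : realType}.
Notation mu := (@lebesgue_measure R).
Variables (D : set R) (W : R -> R).

Definition wL2 (u : R -> R) :=
  measurable_fun D u /\ mu.-integrable D (fun x => (u x ^+ 2 * W x)%:E).

Definition wdot (u v : R -> R) : R := \int[mu]_(x in D) (u x * v x * W x).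

Definition wsqn (u : R -> R) : R := wdot u u.

Hypothesis mD : measurable D.
Hypothesis mW : measurable_fun D W.
Hypothesis W_gt0 : forall x, D x -> 0 < W x.
Implicit Types (u v g : R -> R).

Let W_ge0 x : D x -> 0 <= W x. Proof. by move=> /W_gt0/ltW. Qed.

(* The library equips [R] with two convertible but not unifiable copies of the
   Borel sigma-algebra; the Lebesgue measure lives on the second one. *)
Let mD' : measurable (D : set (measurableTypeR R)) := mD.

Let intD u v : mu.-integrable D (EFin \o u) -> mu.-integrable D (EFin \o v) ->
  mu.-integrable D (EFin \o (fun x => u x + v x)).
Proof. by move=> iu iv; have := integrableD mD' iu iv; apply: eq_integrable. Qed.

Let intZ (k : R) u : mu.-integrable D (EFin \o u) ->
  mu.-integrable D (EFin \o (fun x => k * u x)).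
Proof. by move=> iu; have := integrableZl mD' k iu; apply: eq_integrable. Qed.

Let integrable_le u v : measurable_fun D u ->
  (forall x, D x -> `|u x| <= v x) ->
  mu.-integrable D (EFin \o v) -> mu.-integrable D (EFin \o u).
Proof.
move=> mu' uv; apply: le_integrable => //; first exact/measurable_EFinP.
by move=> x Dx /=; rewrite lee_fin (le_trans (uv _ Dx))// ler_norm.
Qed.

Lemma wL2_integrable u v : wL2 u -> wL2 v ->
  mu.-integrable D (EFin \o (fun x => u x * v x * W x)).
Proof.
move=> [mu' iu] [mv iv].
apply: (@integrable_le _ (fun x => u x ^+ 2 * W x + v x ^+ 2 * W x)).
- by apply: measurable_funM => //; exact: measurable_funM.
- move=> x Dx; rewrite -mulrDl normrM (gtr0_norm (W_gt0 Dx)) ler_pM2r ?W_gt0//.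
  rewrite normrM -(real_normK (num_real (u x))) -(real_normK (num_real (v x))).
  by have := sqr_ge0 (`|u x| - `|v x|); have := mulr_ge0 (normr_ge0 (u x)) (normr_ge0 (v x)); nra.
- exact: intD.
Qed.

Lemma wL2_le u v : measurable_fun D u -> wL2 v ->
  (forall x, D x -> `|u x| <= `|v x|) -> wL2 u.
Proof.
move=> mu' [mv iv] uv; split => //.
apply: (@integrable_le _ (fun x => v x ^+ 2 * W x)) iv.
  by apply: measurable_funM => //; exact: measurable_funX.
move=> x Dx; rewrite normrM (gtr0_norm (W_gt0 Dx)) ler_pM2r ?W_gt0//.
by rewrite ger0_norm ?sqr_ge0// -ler_sqrt ?sqr_ge0// !sqrtr_sqr uv.
Qed.

Lemma wL2D u v : wL2 u -> wL2 v -> wL2 (u \+ v).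
Proof.
move=> [mu' iu] [mv iv]; split; first exact: measurable_funD.
apply: (@integrable_le _ (fun x => 2 * (u x ^+ 2 * W x) + 2 * (v x ^+ 2 * W x))).
- by apply: measurable_funM => //; apply: measurable_funX; exact: measurable_funD.
- move=> x Dx; rewrite normrM (gtr0_norm (W_gt0 Dx)) !mulrA -mulrDl ler_pM2r ?W_gt0//.
  by rewrite ger0_norm ?sqr_ge0//=; have := sqr_ge0 (u x - v x); nra.
- by apply: intD; exact: intZ.
Qed.

Lemma wL2Z (a : R) u : wL2 u -> wL2 (fun x => a * u x).
Proof.
move=> [mu' iu]; split; first by apply: measurable_funM => //; exact: measurable_cst.
have := intZ (a ^+ 2) iu; apply: eq_integrable => // x _.
by rewrite /=; congr EFin; ring.
Qed.

Lemma wL2B u v : wL2 u -> wL2 v -> wL2 (u \- v).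
Proof.
move=> lu lv; have := wL2D lu (wL2Z (-1) lv).
by congr wL2; apply/funext => x /=; rewrite mulN1r.
Qed.

Lemma wL2_bounded_mul (M : R) g u : measurable_fun D g ->
  (forall x, D x -> `|g x| <= M) -> wL2 u -> wL2 (fun x => g x * u x).
Proof.
move=> mg gM lu; apply: (wL2_le _ (wL2Z M lu)); first by apply: measurable_funM => //; case: lu.
by move=> x Dx; rewrite !normrM ler_wpM2r// (le_trans (gM _ Dx))// ler_norm.
Qed.

Lemma eq_wL2 u v : {in D, u =1 v} -> wL2 u -> wL2 v.
Proof.
move=> uv [mu' iu]; split; first exact: eq_measurable_fun mu'.
by apply: eq_integrable iu => // x Dx; rewrite uv.
Qed.

Lemma eq_wdot u1 v1 u2 v2 : {in D, u1 =1 u2} -> {in D, v1 =1 v2} ->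
  wdot u1 v1 = wdot u2 v2.
Proof. by move=> uu vv; apply: eq_Rintegral => x Dx; rewrite uu ?vv. Qed.

Lemma wdotC u v : wdot u v = wdot v u.
Proof. by apply: eq_Rintegral => x Dx; rewrite [u x * _]mulrC. Qed.

Lemma wdotDl u1 u2 v : wL2 u1 -> wL2 u2 -> wL2 v ->
  wdot (u1 \+ u2) v = wdot u1 v + wdot u2 v.
Proof.
move=> l1 l2 lv; rewrite /wdot -RintegralD//; last 2 first.
- exact: wL2_integrable.
- exact: wL2_integrable.
by apply: eq_Rintegral => x Dx /=; ring.
Qed.

Lemma wdotZl (a : R) u v : wL2 u -> wL2 v ->
  wdot (fun x => a * u x) v = a * wdot u v.
Proof.
move=> lu lv; rewrite /wdot -RintegralZl//; last exact: wL2_integrable.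
by apply: eq_Rintegral => x Dx /=; ring.
Qed.

Lemma wdotBl u1 u2 v : wL2 u1 -> wL2 u2 -> wL2 v ->
  wdot (u1 \- u2) v = wdot u1 v - wdot u2 v.
Proof.
move=> l1 l2 lv; rewrite /wdot -RintegralB//; last 2 first.
- exact: wL2_integrable.
- exact: wL2_integrable.
by apply: eq_Rintegral => x Dx /=; ring.
Qed.

Lemma wsqn_ge0 u : 0 <= wsqn u.
Proof. by apply: Rintegral_ge0 => x Dx; rewrite mulr_ge0 ?W_ge0// -expr2 sqr_ge0. Qed.

Lemma wsqnZ (a : R) u : wL2 u -> wsqn (fun x => a * u x) = a ^+ 2 * wsqn u.
Proof.
move=> lu; rewrite /wsqn wdotZl//; last exact: wL2Z.
by rewrite wdotC wdotZl//; ring.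
Qed.

Lemma wsqnD u v : wL2 u -> wL2 v ->
  wsqn (u \+ v) = wsqn u + 2 * wdot u v + wsqn v.
Proof.
move=> lu lv; have luv := wL2D lu lv.
rewrite /wsqn wdotDl// ![wdot _ (u \+ v)]wdotC !wdotDl// [wdot v u]wdotC; ring.
Qed.

Lemma wsqnB u v : wL2 u -> wL2 v ->
  wsqn (u \- v) = wsqn u - 2 * wdot u v + wsqn v.
Proof.
move=> lu lv; have -> : u \- v = u \+ (fun x => -1 * v x).
  by apply/funext => x /=; rewrite mulN1r.
rewrite wsqnD//; last exact: wL2Z.
by rewrite wdotC wdotZl// wdotC wsqnZ//; ring.
Qed.

Lemma wsqnBC u v : wsqn (u \- v) = wsqn (v \- u).
Proof. by apply: eq_Rintegral => x _ /=; ring. Qed.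

(** Stands in for Minkowski's inequality at the level of squared norms; its factor 2 is the origin
    of the numerical constants in the completeness and resolvent estimates. *)
Lemma wsqnD_le u v : wL2 u -> wL2 v -> wsqn (u \+ v) <= 2 * (wsqn u + wsqn v).
Proof.
move=> lu lv; have := wsqn_ge0 (u \- v).
by rewrite wsqnD// wsqnB//; lra.
Qed.

(** Stands in for the Cauchy-Schwarz inequality; it expresses that |u + v|^2 and |u - v|^2 are
    nonnegative. *)
Lemma wdot_le u v : wL2 u -> wL2 v -> 2 * `|wdot u v| <= wsqn u + wsqn v.
Proof.
move=> lu lv; have := wsqn_ge0 (u \- v); have := wsqn_ge0 (u \+ v).
rewrite wsqnD// wsqnB// => h1 h2.
have : `|2 * wdot u v| <= wsqn u + wsqn v by rewrite ler_norml; lra.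
by rewrite normrM [`|2|]ger0_norm.
Qed.

Lemma wsqn_le u v : wL2 u -> wL2 v -> (forall x, D x -> `|u x| <= `|v x|) ->
  wsqn u <= wsqn v.
Proof.
move=> lu lv uv; apply: le_Rintegral => //; [exact: wL2_integrable..|] => x Dx.
rewrite ler_pM2r ?W_gt0// -!expr2 -ler_sqrt ?sqr_ge0// !sqrtr_sqr.
exact: uv.
Qed.

Lemma wsqn_eq0 u : wL2 u -> wsqn u = 0 -> {ae mu, forall x, D x -> u x = 0}.
Proof.
move=> lu u0; have iu := wL2_integrable lu lu.
have /integrableP[mu' _] := iu.
have : (\int[mu]_(x in D) `|(u x * u x * W x)%:E| = 0)%E.
  rewrite -[RHS]/(0%:E) -u0 /wsqn /wdot /Rintegral fineK; last exact: integrable_fin_num.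
  apply: eq_integral => x; rewrite inE => Dx /=.
  by rewrite ger0_norm// mulr_ge0 ?W_ge0// -expr2 sqr_ge0.
move=> /(ae_eq_integral_abs mu mD' mu').
have F := ae_filter_ringOfSetsType mu; apply: filterS => x h Dx.
have [/eqP] := h Dx; rewrite mulf_eq0 [W x == 0]gt_eqF ?W_gt0// orbF.
by rewrite mulf_eq0 orbb => /eqP.
Qed.

Lemma ae_eq_wsqn u v : wL2 u -> wL2 v -> {ae mu, forall x, D x -> u x = v x} ->
  wsqn (u \- v) = 0.
Proof.
move=> lu lv uv; have luv := wL2B lu lv.
rewrite /wsqn /wdot /Rintegral (@ae_eq_integral _ _ _ mu D (cst 0%E))//=.
- by rewrite integral0.
- by have /integrableP[] := wL2_integrable luv luv.
- have F := ae_filter_ringOfSetsType mu; apply: filterS uv => x h Dx.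
  by rewrite h// subrr !mul0r.
Qed.

End WeightedL2.

(** * Completeness of the weighted space *)

Section WeightedL2Complete.
Context {R : realType}.
Notation mu := (@lebesgue_measure R).
Variables (D : set R) (W : R -> R).
Hypothesis mD : measurable D.
Hypothesis mW : measurable_fun D W.
Hypothesis W_gt0 : forall x, D x -> 0 < W x.

Let mD' : measurable (D : set (measurableTypeR R)) := mD.

Lemma ae_wsqn (u v : R -> R) : wL2 D W u -> wL2 D W v ->
  {ae mu, forall x, D x -> u x = v x} -> wsqn D W u = wsqn D W v.
Proof.
move=> lu lv uv; rewrite /wsqn /wdot /Rintegral; congr fine.
apply: ae_eq_integral => //.
- by have /integrableP[] := wL2_integrable mD mW W_gt0 lu lu.
- by have /integrableP[] := wL2_integrable mD mW W_gt0 lv lv.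
- have F := ae_filter_ringOfSetsType mu; apply: filterS uv => x h Dx.
  by rewrite h.
Qed.

Lemma wL2_EFin (u : R -> R) : wL2 D W u ->
  (wsqn D W u)%:E = (\int[mu]_(x in D) (u x * u x * W x)%:E)%E.
Proof.
move=> lu; rewrite /wsqn /wdot /Rintegral fineK//.
by apply: integrable_fin_num => //; exact: wL2_integrable.
Qed.

Lemma wL2_lty (u : R -> R) : measurable_fun D u ->
  (\int[mu]_(x in D) (u x * u x * W x)%:E < +oo)%E -> wL2 D W u.
Proof.
move=> mu' ufin; split => //; apply/integrableP; split.
  by apply/measurable_EFinP; apply: measurable_funM => //; exact: measurable_funX.
apply: le_lt_trans ufin; rewrite le_eqVlt; apply/orP; left; apply/eqP.
apply: eq_integral => x; rewrite inE => Dx /=.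
by rewrite ger0_norm ?expr2// mulr_ge0 ?sqr_ge0// ltW// W_gt0.
Qed.

Variables (u_ : nat -> R -> R) (C : R).
Hypothesis lu : forall n, wL2 D W (u_ n).
Hypothesis uC : forall n, wsqn D W (u_ n.+1 \- u_ n) <= C * (4^-1) ^+ n.

Let C_ge0 : 0 <= C.
Proof. by have := uC 0; rewrite expr0 mulr1; apply: le_trans; exact: wsqn_ge0. Qed.

(** The constant 4 solves K = 2 (1 + K/4), the recursion produced by splitting off the first
    increment with [wsqnD_le]. *)
Let cauchy n j : wsqn D W (u_ (j + n)%N \- u_ n) <= 4 * C * (4^-1) ^+ n.
Proof.
elim: j n => [|j IH] n.
  have -> : u_ (0 + n)%N \- u_ n = (fun=> 0) by apply/funext => x /=; rewrite subrr.
  rewrite /wsqn /wdot (_ : (fun _ => _) = cst 0); last by apply/funext => x; rewrite !mul0r.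
  by rewrite Rintegral_cst// mul0r !mulr_ge0// exprn_ge0.
have -> : u_ (j.+1 + n)%N \- u_ n = (u_ n.+1 \- u_ n) \+ (u_ (j + n.+1)%N \- u_ n.+1).
  by apply/funext => x /=; rewrite addSnnS; ring.
apply: le_trans (wsqnD_le mD mW W_gt0 _ _) _; [exact: wL2B..|].
by have := IH n.+1; have := uC n; rewrite exprS; lra.
Qed.

Let d k x := u_ k.+1 x - u_ k x.
(** The weight 2^k balances two needs: the integrals, at most C 2^k 4^-k, remain summable, while |d|
    <= 2^-k + 2^k d^2 makes the increments absolutely summable wherever [H] is finite. *)
Let h k x := ((2 ^+ k * (d k x * d k x * W x))%:E : \bar R).
Let H x := (\sum_(k <oo) h k x)%E.

Let h_ge0 k x : D x -> (0 <= h k x)%E.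
Proof.
move=> Dx; rewrite lee_fin; apply: mulr_ge0; first exact: exprn_ge0.
by apply: mulr_ge0; [rewrite -expr2 sqr_ge0|exact/ltW/W_gt0].
Qed.

Let md k : measurable_fun D (d k).
Proof. by apply: measurable_funB; [case: (lu k.+1)|case: (lu k)]. Qed.

Let mh k : measurable_fun D (h k).
Proof.
apply/measurable_EFinP; apply: measurable_funM => //.
by apply: measurable_funM => //; exact: measurable_funM.
Qed.

Let mH : measurable_fun D H.
Proof. by apply: ge0_emeasurable_sum => [k x Dx _|k _]; [exact: h_ge0|exact: mh]. Qed.

Let HE : (\int[mu]_(x in D) H x < +oo)%E.
Proof.
rewrite integral_nneseries//.
have bound k : (\int[mu]_(x in D) h k x <= (geometric C 2^-1 k)%:E)%E.
  have ld : wL2 D W (u_ k.+1 \- u_ k) by exact: wL2B.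
  have -> : (\int[mu]_(x in D) h k x = (2 ^+ k * wsqn D W (u_ k.+1 \- u_ k))%:E)%E.
    rewrite EFinM wL2_EFin// -ge0_integralZl//.
    - by have /integrableP[] := wL2_integrable mD mW W_gt0 ld ld.
    - move=> x Dx; rewrite lee_fin; apply: mulr_ge0; last exact/ltW/W_gt0.
      by rewrite -expr2 sqr_ge0.
  rewrite lee_fin /=; apply: le_trans (ler_wpM2l _ (uC k)) _; first exact: exprn_ge0.
  rewrite mulrCA -exprMn (_ : 2 * 4^-1 = 2^-1 :> R)//; by field.
apply: (@le_lt_trans _ _ (\sum_(k <oo) (geometric C 2^-1 k)%:E)%E).
  apply: lee_nneseries => [k _|k _]; last exact: bound.
  by move=> _; apply: integral_ge0 => x Dx; exact: h_ge0.
have cg := @cvg_geometric_series R C 2^-1.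
have h2 : `|2^-1| < 1 :> R by rewrite ger0_norm// invf_lt1// ltr1n.
have /cvg_lim := cg h2.
rewrite (_ : limn _ = (limn (series (geometric C 2^-1)))%:E) ?ltry//.
rewrite -EFin_lim; last by apply/cvg_ex; eexists; exact: cg h2.
by congr (limn _); apply/funext => n; rewrite /= sumEFin.
Qed.

Let E : set R := [set x | (H x < +oo)%E].

Let mDE : measurable (D `&` E).
Proof. by apply: emeasurable_fun_infty_o => //; exact: mH. Qed.

Let aeE : {ae mu, forall x, D x -> E x}.
Proof.
have iH : mu.-integrable D H.
  apply/integrableP; split; first exact: mH.
  apply: le_lt_trans HE; rewrite le_eqVlt; apply/orP; left; apply/eqP.
  apply: eq_integral => x; rewrite inE => Dx; rewrite gee0_abs//.
  by apply: nneseries_ge0 => k _ _; exact: h_ge0.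
have := integrable_ae mD' iH; have F := ae_filter_ringOfSetsType mu.
by apply: filterS => x Hx /Hx; rewrite /E /= ltey_eq => ->.
Qed.

Let cvE x : D x -> E x -> cvgn (u_ ^~ x).
Proof.
move=> Dx Ex.
suff : cvgn (series (d ^~ x)).
  move=> cs; have -> : u_ ^~ x = (fun n => u_ 0%N x + series (d ^~ x) n).
    by apply/funext => n; rewrite {1}(eq_sum_telescope (u_ ^~ x) n).
  by apply: is_cvgD => //; exact: is_cvg_cst.
apply: normed_cvg; change (cvgn (series (fun k => `|d k x|))).
apply: nondecreasing_is_cvgn.
  by apply/nondecreasing_seqP => n; rewrite !seriesEnat/= big_nat_recr//= lerDl.
exists (2 + fine (H x) / W x) => _ [n _ <-].
have W0 := W_gt0 Dx.
have Hn : \sum_(0 <= k < n) 2 ^+ k * (d k x * d k x * W x) <= fine (H x).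
  rewrite -lee_fin fineK; last first.
    by rewrite ge0_fin_numE//; apply: nneseries_ge0 => k _ _; exact: h_ge0.
  rewrite -sumEFin; by apply: nneseries_lim_ge => *; exact: h_ge0.
have half : \sum_(0 <= k < n) (2^-1) ^+ k <= 2 :> R.
  elim: n {Hn} => [|n IH]; first by rewrite big_geq.
  rewrite big_nat_recl//= expr0.
  under eq_bigr do rewrite exprS.
  by rewrite -mulr_sumr; lra.
rewrite /series /=.
apply: (@le_trans _ _ (\sum_(0 <= k < n) ((2^-1) ^+ k + 2 ^+ k * (d k x * d k x)))).
  apply: ler_sum => k _.
  have k0 : 0 < 2 ^+ k :> R by exact: exprn_gt0.
  rewrite exprVn -(ler_pM2l k0) mulrDr mulfV ?gt_eqF//.
  rewrite -[`|d k x|]mulr1 -{1}[2 ^+ k]ger0_norm ?ltW// mulr1 -normrM.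
  have -> : 2 ^+ k * (2 ^+ k * (d k x * d k x)) = `|2 ^+ k * d k x| ^+ 2.
    by rewrite real_normK ?num_real//; ring.
  move: (normr_ge0 (2 ^+ k * d k x)); move: `|_| => t t0; nra.
rewrite big_split /= lerD//.
rewrite ler_pdivlMr// mulr_suml (le_trans _ Hn)//.
by apply: ler_sum => k _; rewrite !mulrA.
Qed.

Lemma wL2_complete : exists u : R -> R,
  [/\ wL2 D W u, forall n, wsqn D W (u \- u_ n) <= 4 * C * (4^-1) ^+ n
    & {ae mu, forall x, D x -> u_ n x @[n --> \oo] --> u x}].
Proof.
(* Multiplication by the indicator of the convergence set makes the sequence converge everywhere on
   [D], so that its limit is measurable. *)
pose v n x := \1_(D `&` E) x * u_ n x.
pose u x := limn (v ^~ x).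
have cv x : D x -> v n x @[n --> \oo] --> u x.
  move=> Dx; rewrite /u /v indicE; case: (boolP (x \in D `&` E)) => xE.
    under eq_cvg do rewrite mul1r.
    have -> : (fun n => true%:R * u_ n x) = u_ ^~ x by apply/funext => n; rewrite mul1r.
    by apply: cvE => //; move: xE; rewrite inE => -[].
  under eq_cvg do rewrite mul0r.
  have -> : (fun n => false%:R * u_ n x) = (fun=> 0) by apply/funext => n; rewrite mul0r.
  by rewrite lim_cst//; exact: cvg_cst.
have mv n : measurable_fun D (v n).
  apply: measurable_funM; last by case: (lu n).
  by apply: measurable_funTS; exact: measurable_indic.
have mu' : measurable_fun D u by exact: measurable_fun_cvg mv cv.
have vE n x : D x -> E x -> v n x = u_ n x.
  by move=> Dx Ex; rewrite /v indicE mem_set// mul1r.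
have vle n x : `|v n x| <= `|u_ n x|.
  by rewrite /v indicE; case: (_ \in _); rewrite ?mul1r// mul0r normr0.
have lv n : wL2 D W (v n) by apply: (wL2_le mD mW W_gt0 (mv n) (lu n)).
have le_n n : (\int[mu]_(x in D) ((u x - v n x) * (u x - v n x) * W x)%:E
    <= (4 * C * (4^-1) ^+ n)%:E)%E.
  pose f j x := (((v (j + n)%N x - v n x) * (v (j + n)%N x - v n x) * W x)%:E : \bar R).
  have lvv j : wL2 D W (v (j + n)%N \- v n) by exact: wL2B.
  have mf j : measurable_fun D (f j).
    by have /integrableP[] := wL2_integrable mD mW W_gt0 (lvv j) (lvv j).
  have f0 j x : D x -> (0 <= f j x)%E.
    move=> Dx; rewrite lee_fin; apply: mulr_ge0; last exact/ltW/W_gt0.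
    by rewrite -expr2 sqr_ge0.
  have fB j : (\int[mu]_(x in D) f j x <= (4 * C * (4^-1) ^+ n)%:E)%E.
    rewrite -(wL2_EFin (lvv j)) lee_fin (le_trans _ (cauchy n j))//.
    apply: wsqn_le => //; first exact: wL2B.
    move=> x Dx /=; rewrite /v -mulrBr normrM indicE.
    by case: (_ \in _); rewrite ?normr1 ?mul1r// normr0 mul0r.
  have -> : (\int[mu]_(x in D) ((u x - v n x) * (u x - v n x) * W x)%:E =
      \int[mu]_(x in D) limn_einf (f ^~ x))%E.
    apply: eq_integral => x; rewrite inE => Dx.
    have cx : f j x @[j --> \oo] --> ((u x - v n x) * (u x - v n x) * W x)%:E.
      apply/cvg_EFin; first exact: nearW.
      have cvn : v (j + n)%N x @[j --> \oo] --> u x.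
        by have := cv x Dx; rewrite -(cvg_shiftn n).
      apply: cvgM; last exact: cvg_cst.
      by apply: cvgM; (apply: cvgB; [exact: cvn|exact: cvg_cst]).
    by have [-> _] := cvg_limn_einf_sup cx.
  (* Fatou's lemma in j with n fixed carries the Cauchy estimate over to the limit. *)
  apply: le_trans (fatou mu mD' mf f0) _; rewrite limn_einf_lim; apply: lime_le.
    exact: is_cvg_einfs.
  apply: nearW => j; apply: le_trans (fB j); apply: ereal_inf_lbound.
  by exists j => //=.
have luv n : wL2 D W (u \- v n).
  apply: wL2_lty; first exact: measurable_funB.
  by apply: le_lt_trans (le_n n) _; exact: ltry.
have lu' : wL2 D W u.
  have := wL2D mD mW W_gt0 (luv 0%N) (lv 0%N).
  by congr wL2; apply/funext => x /=; rewrite subrK.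
exists u; split => // [n|].
  have -> : wsqn D W (u \- u_ n) = wsqn D W (u \- v n).
    apply: ae_wsqn => //; first exact: wL2B.
    have F := ae_filter_ringOfSetsType mu; apply: filterS aeE => x Ex Dx /=.
    by rewrite vE//; exact: Ex.
  by rewrite -lee_fin wL2_EFin//; exact: le_n.
have F := ae_filter_ringOfSetsType mu; apply: filterS aeE => x Ex Dx.
have := cv x Dx; rewrite (_ : v ^~ x = u_ ^~ x)//.
by apply/funext => n; rewrite vE//; exact: Ex.
Qed.

End WeightedL2Complete.

Import HBNNSimple.

(** * Density of polynomials for a finite weight *)

Section PolynomialDensity.
Context {R : realType}.
Notation mu := (@lebesgue_measure R).
Variable W : R -> R.
Let D := Ioo11 R.
Hypothesis mW : measurable_fun D W.
Hypothesis W_gt0 : forall x, D x -> 0 < W x.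
Hypothesis W_int : mu.-integrable D (EFin \o W).
Implicit Types (f g : R -> R) (p q : {poly R}).

Let mD : measurable D. Proof. exact: measurable_itv. Qed.
Let mD' : measurable (D : set (measurableTypeR R)). Proof. exact: measurable_itv. Qed.

Lemma wL2_bounded (M : R) f : measurable_fun D f ->
  (forall x, D x -> `|f x| <= M) -> wL2 D W f.
Proof.
move=> mf fM; have l1 : wL2 D W (fun=> 1).
  split; first exact: measurable_cst.
  by apply: eq_integrable W_int => // x _; rewrite /= expr1n mul1r.
have := wL2_bounded_mul mD mW W_gt0 mf fM l1.
by congr wL2; apply/funext => x; rewrite mulr1.
Qed.

Lemma horner_bounded p : exists M : R, forall x, D x -> `|p.[x]| <= M.
Proof.
exists (\sum_(i < size p) `|p`_i|) => x; rewrite /D /Ioo11 /= in_itv/= => /andP[x1 x2].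
rewrite horner_coef (le_trans (ler_norm_sum _ _ _))//; apply: ler_sum => i _.
rewrite normrM ler_piMr// normrX exprn_ile1// ler_norml; lra.
Qed.

Lemma wL2_horner p : wL2 D W (horner p).
Proof.
have [M pM] := horner_bounded p; apply: (wL2_bounded _ pM).
apply: measurable_funTS; apply: continuous_measurable_fun; exact: continuous_horner.
Qed.

(** Approximability by polynomials. The class is enlarged from indicators of half-lines to
    indicators of Borel sets, then to nonnegative functions by means of simple ones. *)
Let pa f := forall eps : R, 0 < eps -> exists p, wsqn D W (f \- horner p) < eps.

Let pa_horner p : pa (horner p).
Proof.
move=> eps e0; exists p; rewrite /wsqn /wdot.
rewrite (_ : (fun _ => _) = cst 0); last by apply/funext => x /=; rewrite subrr !mul0r.
by rewrite Rintegral_cst// mul0r.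
Qed.

Let pa_lim f : wL2 D W f ->
  (forall eps : R, 0 < eps -> exists g, [/\ wL2 D W g, pa g & wsqn D W (f \- g) < eps]) ->
  pa f.
Proof.
move=> lf H eps e0; have e4 : 0 < eps / 4 by rewrite divr_gt0.
have [g [lg pg fg]] := H _ e4; have [p gp] := pg _ e4; exists p.
have -> : f \- horner p = (f \- g) \+ (g \- horner p).
  by apply/funext => x /=; ring.
have lp := wL2_horner p.
apply: le_lt_trans (wsqnD_le mD mW W_gt0 _ _) _; [exact: wL2B..|lra].
Qed.

Let pa_add f g : wL2 D W f -> wL2 D W g -> pa f -> pa g -> pa (f \+ g).
Proof.
move=> lf lg pf pg eps e0; have e4 : 0 < eps / 4 by rewrite divr_gt0.
have [p fp] := pf _ e4; have [q gq] := pg _ e4; exists (p + q).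
have -> : (f \+ g) \- horner (p + q) = (f \- horner p) \+ (g \- horner q).
  by apply/funext => x /=; rewrite hornerD; ring.
have lp := wL2_horner p; have lq := wL2_horner q.
apply: le_lt_trans (wsqnD_le mD mW W_gt0 _ _) _; [exact: wL2B..|lra].
Qed.

Let pa_scale (a : R) f : wL2 D W f -> pa f -> pa (fun x => a * f x).
Proof.
move=> lf pf eps e0; have a0 : 0 < a ^+ 2 + 1 by rewrite ltr_wpDl ?sqr_ge0.
have [p fp] := pf _ (divr_gt0 e0 a0); exists (a *: p).
have lp := wL2_horner p; have lfp := wL2B mD mW W_gt0 lf lp.
have -> : (fun x => a * f x) \- horner (a *: p) = (fun x => a * (f \- horner p) x).
  by apply/funext => x /=; rewrite hornerZ; ring.
rewrite wsqnZ//; move: fp; rewrite ltr_pdivlMr//.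
have := wsqn_ge0 W_gt0 (f \- horner p); have := sqr_ge0 a; nra.
Qed.

Let eq_pa f g : {in D, f =1 g} -> pa f -> pa g.
Proof.
move=> fg pf eps /pf[p fp]; exists p; apply: le_lt_trans fp.
rewrite le_eqVlt; apply/orP; left; apply/eqP; apply: eq_wdot => x Dx /=; by rewrite fg.
Qed.

Lemma dominated_wsqn (f_ : nat -> R -> R) f g :
  (forall n, measurable_fun D (f_ n)) -> measurable_fun D f -> wL2 D W g ->
  (forall n x, D x -> `|f x - f_ n x| <= `|g x|) ->
  {ae mu, forall x, D x -> f_ n x @[n --> \oo] --> f x} ->
  forall eps : R, 0 < eps -> exists n, wsqn D W (f \- f_ n) < eps.
Proof.
move=> mf_ mf lg fg cf eps e0.
pose h n x := (((f x - f_ n x) * (f x - f_ n x) * W x)%:E : \bar R).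
have mh n : measurable_fun D (h n).
  apply/measurable_EFinP; apply: measurable_funM => //.
  by apply: measurable_funM => //; exact: measurable_funB.
have lf n : wL2 D W (f \- f_ n).
  by apply: (wL2_le mD mW W_gt0 _ lg (fg n)); exact: measurable_funB.
have := @dominated_convergence _ _ _ mu D mD' h (cst 0%E)
  (fun x => (g x * g x * W x)%:E) mh.
move=> /(_ _ _ _ _)[||||_ _].
- exact: measurable_cst.
- have F := ae_filter_ringOfSetsType mu; apply: filterS cf => x cx Dx.
  rewrite /h /cst; apply/cvg_EFin; first exact: nearW.
  have c0 : f x - f_ n x @[n --> \oo] --> 0.
    by rewrite -(subrr (f x)); apply: cvgB; [exact: cvg_cst|exact: cx].
  rewrite -[X in _ --> X](mul0r (W x)); apply: cvgM; last exact: cvg_cst.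
  by rewrite -[X in _ --> X](mul0r 0); apply: cvgM.
- by have := wL2_integrable mD mW W_gt0 lg lg.
- apply: aeW => x n Dx; rewrite lee_fin ger0_norm; last first.
    by apply: mulr_ge0; [rewrite -expr2 sqr_ge0|exact/ltW/W_gt0].
  rewrite ler_pM2r ?W_gt0// -!expr2 -ler_sqrt ?sqr_ge0// !sqrtr_sqr.
  exact: fg.
rewrite integral0 => /fine_cvgP[_ /cvgrPdist_lt/(_ _ e0)][N _ HN].
exists N; have := HN N (leqnn N); rewrite /= sub0r normrN ger0_norm//.
by apply: fine_ge0; apply: integral_ge0 => x Dx; rewrite lee_fin;
  apply: mulr_ge0; [rewrite -expr2 sqr_ge0|exact/ltW/W_gt0].
Qed.

Lemma ler_bernoulli (t : R) n : 0 <= t -> t <= 1 -> 1 - n%:R * t <= (1 - t) ^+ n.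
Proof.
move=> t0 t1; elim: n => [|n IH]; first by rewrite mul0r subr0 expr0.
have h : 0 <= (1 - t) ^+ n by rewrite exprn_ge0// subr_ge0.
have n0 : 0 <= n%:R * t * t by rewrite !mulr_ge0.
have := ler_wpM2l (_ : 0 <= 1 - t) IH; rewrite subr_ge0 => /(_ t1).
rewrite exprS -natr1; nra.
Qed.

(** Upper counterpart of Bernoulli's inequality: (1 - t)^n is small as soon as n t is large. *)
Lemma expr_1B_le (t : R) n : 0 <= t -> t <= 1 -> (1 - t) ^+ n * (1 + n%:R * t) <= 1.
Proof.
move=> t0 t1; elim: n => [|n IH]; first by rewrite mul0r addr0 expr0 mulr1.
have h : 0 <= (1 - t) ^+ n by rewrite exprn_ge0// subr_ge0.
apply: le_trans IH; rewrite exprS -natr1 [_ * (1 - t) ^+ n]mulrC -mulrA ler_wpM2l//.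
have : 0 <= n%:R * t * t by rewrite !mulr_ge0.
nra.
Qed.

(* [(1 - q ^ n) ^ (2 ^ n)] tends to [1] where [0 <= q < 1/2] and to [0] where
   [1/2 < q <= 1]: polynomials thus approximate the indicators of half-lines. *)
Let step_cvg1 (q : R) : 0 <= q -> q < 2^-1 ->
  (1 - q ^+ n) ^+ (2 ^ n) @[n --> \oo] --> (1 : R).
Proof.
move=> q0 q2.
apply: (@squeeze_cvgr _ _ _ _ (fun n => 1 - (2 * q) ^+ n) (cst 1)).
- apply: nearW => n /=; have qn0 : 0 <= q ^+ n by exact: exprn_ge0.
  have qn1 : q ^+ n <= 1 by rewrite exprn_ile1//; lra.
  rewrite exprMn -natrX ler_bernoulli//= exprn_ile1// ?subr_ge0//; lra.
- rewrite -[X in _ --> X](subr0 1); apply: cvgB; first exact: cvg_cst.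
  by apply: cvg_expr; rewrite ger0_norm; lra.
- exact: cvg_cst.
Qed.

Let step_cvg0 (q : R) : 2^-1 < q -> q <= 1 ->
  (1 - q ^+ n) ^+ (2 ^ n) @[n --> \oo] --> (0 : R).
Proof.
move=> q2 q1; have q0 : 0 < q by lra.
apply: (@squeeze_cvgr _ _ _ _ (cst 0) (fun n => ((2 * q)^-1) ^+ n)).
- apply: nearW => n /=; have qn0 : 0 <= q ^+ n by rewrite exprn_ge0// ltW.
  have qn1 : q ^+ n <= 1 by rewrite exprn_ile1// ltW.
  rewrite exprn_ge0 ?subr_ge0//= exprVn -[leRHS]mul1r ler_pdivlMr; last first.
    by rewrite exprn_gt0// mulr_gt0.
  apply: le_trans (expr_1B_le (2 ^ n) qn0 qn1).
  rewrite ler_wpM2l ?exprn_ge0 ?subr_ge0// exprMn natrX lerDr//.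
- exact: cvg_cst.
- apply: cvg_expr; rewrite ger0_norm ?invr_ge0 ?mulr_ge0// ?ltW//.
  by rewrite invf_lt1 ?mulr_gt0//; lra.
Qed.

Let l_indic (A : set R) : measurable A -> wL2 D W (\1_A).
Proof.
move=> mA; apply: (@wL2_bounded 1); first by apply: measurable_funTS; exact: measurable_indic.
by move=> x _; rewrite indicE; case: (_ \in _); rewrite ?normr1 ?normr0.
Qed.

Let pa_halfline (a : R) : pa (\1_(`]-oo, a]%classic)).
Proof.
have [a1|a1] := leP a (-1).
  apply: (eq_pa _ (pa_horner 0)) => x; rewrite inE /D /Ioo11 /= in_itv/= => /andP[x1 _].
  rewrite horner0 indicE memNset//= in_itv/= leNgt (le_lt_trans a1)//.
have [a2|a2] := leP 1 a.
  apply: (eq_pa _ (pa_horner 1%:P)) => x; rewrite inE /D /Ioo11 /= in_itv/= => /andP[_ x1].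
  by rewrite hornerC indicE mem_set//= in_itv/= (le_trans (ltW x1)).
(* This affine map takes the value 1/2 at a, and its slope 1/4 keeps it between 0 and 1 on (-1,1),
   where |x - a| < 2. *)
pose q : {poly R} := (2^-1)%:P + 4^-1 *: ('X - a%:P).
have qE x : q.[x] = 2^-1 + (x - a) / 4 by rewrite /q !hornerE; ring.
pose f n : {poly R} := (1 - q ^+ n) ^+ (2 ^ n).
have fE n x : (f n).[x] = (1 - q.[x] ^+ n) ^+ (2 ^ n).
  by rewrite /f !hornerE.
apply: pa_lim; first by apply: l_indic; exact: measurable_itv.
move=> eps e0.
have [|||||n Hn] := @dominated_wsqn (fun n => horner (f n)) (\1_(`]-oo, a]%classic))
  (fun=> 1) _ _ _ _ _ eps e0.
- by move=> n; case: (wL2_horner (f n)).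
- by apply: measurable_funTS; apply: measurable_indic; exact: measurable_itv.
- by apply: (@wL2_bounded 1) => [|x _]; [exact: measurable_cst|rewrite normr1].
- move=> n x; rewrite /D /Ioo11 /= in_itv/= => /andP[x1 x2].
  have q01 : 0 <= q.[x] <= 1 by rewrite qE; lra.
  have /andP[q0 q1] := q01.
  have qn0 : 0 <= q.[x] ^+ n by exact: exprn_ge0.
  have qn1 : q.[x] ^+ n <= 1 by rewrite exprn_ile1.
  have f0 : 0 <= (f n).[x] by rewrite fE exprn_ge0// subr_ge0.
  have f1 : (f n).[x] <= 1 by rewrite fE exprn_ile1 ?subr_ge0//; lra.
  by rewrite normr1 indicE; case: (_ \in _); rewrite ?mulr1n ?mulr0n ler_norml; lra.
- have F := ae_filter_ringOfSetsType mu.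
  have : {ae mu, forall x, x != a}.
    exists [set a]; split; first exact: measurable_set1.
      exact: lebesgue_measure_set1.
    by move=> x /= /negP/negPn/eqP.
  apply: filterS => x xa; rewrite /D /Ioo11 /= in_itv/= => /andP[x1 x2].
  under eq_cvg do rewrite fE.
  rewrite indicE; have [xlt|xgt|xe] := ltgtP x a; last by rewrite xe eqxx in xa.
    rewrite mem_set/=; last by rewrite in_itv/= ltW.
    by apply: step_cvg1; rewrite qE; lra.
  rewrite memNset/=; last by rewrite in_itv/= leNgt xgt.
  by apply: step_cvg0; rewrite qE; lra.
by exists (horner (f n)); split => //; exact: wL2_horner.
Qed.

(** Dynkin's pi-lambda theorem over the half-open intervals, whose indicators are differences of
    those of half-lines. *)
Let pa_indic (A : set (measurableTypeR R)) : measurable A -> pa (\1_A).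
Proof.
move: A; apply: (@dynkin_induction _ (measurableTypeR R) (R.-ocitv.-measurable)
  (fun A => pa (\1_A))) => //.
- exact: ocitvI.
- apply: (eq_pa _ (pa_horner 1%:P)) => x _.
  by rewrite hornerC indicE in_setT.
- move=> _ [[a b] _ <-] /=; have [ab|ba] := leP a b; last first.
    rewrite set_itv_ge -?leNgt ?bnd_simp ?ltW//.
    by apply: (eq_pa _ (pa_horner 0)) => x _; rewrite horner0 indic0.
  have := pa_add _ _ (pa_halfline b) (pa_scale (-1) _ (pa_halfline a)).
  have ha c : wL2 D W (\1_(`]-oo, c]%classic)) by apply: l_indic; exact: measurable_itv.
  move=> /(_ (ha b) (wL2Z mD (-1) (ha a)) (ha a)); apply: eq_pa => x _ /=.
  rewrite !indicE; have [xa|xa] := leP x a.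
    rewrite (memNset (_ : ~ `]a, b]%classic x)); last by rewrite /= in_itv/= ltNge xa.
    rewrite !mem_set/= ?in_itv/= ?xa ?(le_trans xa)//; ring.
  rewrite (memNset (_ : ~ `]-oo, a]%classic x)); last by rewrite /= in_itv/= leNgt xa.
  have -> : (x \in `]-oo, b]%classic) = (x \in `]a, b]%classic).
    by apply/idP/idP; rewrite !inE/= !in_itv/= xa.
  by rewrite mulr0 addr0.
- move=> S mS pS; have := pa_add _ _ (pa_horner 1%:P) (pa_scale (-1) _ pS).
  have lS := l_indic mS.
  move=> /(_ (wL2_horner _) (wL2Z mD (-1) lS) lS); apply: eq_pa => x _ /=.
  by rewrite hornerC !indicE in_setC; case: (x \in S) => /=; ring.
move=> F mF tF pF.
have mU : measurable (\bigcup_k F k : set (measurableTypeR R)).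
  by apply: bigcup_measurable => k _; exact: mF.
apply: pa_lim; first exact: l_indic mU.
move=> eps e0; pose G n := \big[setU/set0]_(k < n) F k.
have mG n : measurable (G n : set (measurableTypeR R)).
  by apply: bigsetU_measurable => k _; exact: mF.
have pG n : pa (\1_(G n)).
  elim: n => [|n IH].
    by apply: (eq_pa _ (pa_horner 0)) => x _; rewrite /G big_ord0 horner0 indic0.
  apply: (eq_pa _ (pa_add (l_indic (mG n)) (l_indic (mF n)) IH (pF n))) => x _ /=.
  rewrite /G big_ord_recr /= -/(G n) !indicE in_setU.
  case: (boolP (x \in F n)) => xn; last by rewrite orbF addr0.
  rewrite memNset ?add0r ?orbT// /G -bigcup_mkord => -[k /= kn Fk].
  have : (F k `&` F n) !=set0 by exists x; split => //; move: xn; rewrite inE.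
  by move=> /tF => /(_ Logic.I Logic.I) kn'; rewrite kn' ltnn in kn.
have [|||||n Hn] := @dominated_wsqn (fun n => \1_(G n)) (\1_(\bigcup_k F k))
  (fun=> 1) _ _ _ _ _ eps e0.
- by move=> n; case: (l_indic (mG n)).
- by case: (l_indic mU).
- by apply: (@wL2_bounded 1) => [|x _]; [exact: measurable_cst|rewrite normr1].
- move=> n x _; rewrite normr1 !indicE.
  by case: (x \in _); case: (x \in _); rewrite ?subrr ?subr0 ?sub0r ?normrN ?normr1 ?normr0.
- apply: aeW => x _; rewrite indicE.
  case: (boolP (x \in _)) => [|/negP]; rewrite inE.
    move=> [k _ Fk]; apply: cvg_near_cst; exists k.+1 => // n /= kn.
    by rewrite indicE mem_set// /G -bigcup_mkord; exists k.
  move=> nF; apply: cvg_near_cst; apply: nearW => n; rewrite indicE memNset//.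
  by rewrite /G -bigcup_mkord => -[k _ Fk]; apply: nF; exists k.
by exists (\1_(G n)); split => //; exact: (l_indic (mG n)).
Qed.

Let pa_ge0 f : wL2 D W f -> (forall x, 0 <= f x) -> pa f.
Proof.
move=> lf f0; apply: pa_lim => // eps e0.
have mf : measurable_fun D (EFin \o f) by apply/measurable_EFinP; case: lf.
pose phi := nnsfun_approx mD mf.
have cphi x : D x -> phi n x @[n --> \oo] --> f x.
  move=> Dx; have f0' y : D y -> (0 <= (EFin \o f) y)%E by rewrite lee_fin.
  have := cvg_nnsfun_approx mD mf f0' Dx.
  by move=> /fine_cvgP[].
have phile n x : D x -> phi n x <= f x.
  move=> Dx; have cx := cphi x Dx; rewrite -(cvg_lim _ cx)//.
  apply: (@nondecreasing_cvgn_le _ (fun n => phi n x)); last by apply/cvg_ex; exists (f x).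
  by move=> i j ij; have /lefP := nd_nnsfun_approx mD mf ij; exact.
have mphi n : measurable_fun setT (phi n : R -> R) by exact: measurable_funP.
have lphi n : wL2 D W (phi n).
  apply: (wL2_le mD mW W_gt0 _ lf); first exact: measurable_funTS.
  by move=> x Dx; rewrite !ger0_norm ?phile.
have [|||||n Hn] := @dominated_wsqn (fun n => phi n : R -> R) f f _ _ _ _ _ eps e0 => //.
- by move=> n; exact: measurable_funTS.
- by case: lf.
- by move=> n x Dx; rewrite !ger0_norm ?subr_ge0 ?phile// lerBlDr lerDl.
- exact: aeW.
exists (phi n); split => //.
have mA y : measurable (phi n @^-1` [set y]).
  by rewrite -[X in measurable X]setTI; exact: mphi.
have [s sE] : exists s : seq R, forall x,
    phi n x = \sum_(y <- s) y * \1_(phi n @^-1` [set y]) x.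
  exists (finmap.enum_fset (fset_set (range (phi n)))) => x.
  by rewrite fimfunE fsbig_finite//; exact: fimfunP.
suff [_ pk] : wL2 D W (fun x => \sum_(y <- s) y * \1_(phi n @^-1` [set y]) x) /\
    pa (fun x => \sum_(y <- s) y * \1_(phi n @^-1` [set y]) x).
  by apply: (eq_pa _ pk) => x _; rewrite sE.
elim: s {sE} => [|y s [lI pI]].
  have e : {in D, horner 0 =1
      (fun x : R => \sum_(y <- [::]) y * \1_(phi n @^-1` [set y]) x)}.
    by move=> x _; rewrite big_nil horner0.
  by split; [apply: (eq_wL2 mD e); exact: wL2_horner|exact: (eq_pa e (pa_horner 0))].
have e : {in D, (fun x => y * \1_(phi n @^-1` [set y]) x) \+
    (fun x => \sum_(y <- s) y * \1_(phi n @^-1` [set y]) x)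
    =1 (fun x : R => \sum_(y <- y :: s) y * \1_(phi n @^-1` [set y]) x)}.
  by move=> x _; rewrite big_cons.
have ly := wL2Z mD y (l_indic (mA y)).
have mA' : measurable (phi n @^-1` [set y] : set (measurableTypeR R)) := mA y.
split; first by apply: (eq_wL2 mD e); exact: wL2D.
by apply: (eq_pa e); apply: pa_add => //; apply: pa_scale; [exact: l_indic|exact: pa_indic mA'].
Qed.

Theorem polynomials_dense f : wL2 D W f ->
  forall eps : R, 0 < eps -> exists p, wsqn D W (f \- horner p) < eps.
Proof.
move=> lf; have [mf _] := lf.
have lpos : wL2 D W (fun x => Num.max (f x) 0).
  apply: (wL2_le mD mW W_gt0 _ lf); first exact: measurable_maxr.
  by move=> x _; rewrite /Num.max; case: ifP => _; rewrite ?normr0.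
have lneg : wL2 D W (fun x => Num.max (- f x) 0).
  apply: (wL2_le mD mW W_gt0 _ lf).
    by apply: measurable_maxr => //; exact: measurableT_comp.
  by move=> x _; rewrite /Num.max; case: ifP => _; rewrite ?normr0// normrN.
have max0 (t : R) : 0 <= Num.max t 0 by rewrite le_max lexx orbT.
have ppos := pa_ge0 lpos (fun x => max0 _); have pneg := pa_ge0 lneg (fun x => max0 _).
have := pa_add lpos (wL2Z mD (-1) lneg) ppos (pa_scale (-1) lneg pneg).
apply: eq_pa => x _ /=; rewrite /Num.max; case: ltP => h1; case: ltP => h2; lra.
Qed.

End PolynomialDensity.

(** * Sturm-Liouville operators on (-1,1) *)

Section IntegralOnIoo11.
Context {R : realType}.
Notation mu := (@lebesgue_measure R).
Implicit Types (f g G u v : R -> R).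
Notation D := (Ioo11 R).
Lemma Ioo11E x : Ioo11 R x = (-1 < x < 1) :> Prop.
Proof. by rewrite /Ioo11 /= in_itv. Qed.

Let mD : measurable (D : set R). Proof. exact: measurable_itv. Qed.

Definition prim g x := \int[mu]_(t in `]-1, x]) g t.

Lemma integrable_Ioo11S g (i : interval R) : mu.-integrable D (EFin \o g) ->
  (BRight (-1) <= i.1)%O -> (i.2 <= BLeft 1)%O ->
  mu.-integrable [set` i] (EFin \o g).
Proof.
case: i => a b /= ig a1 b1; apply: integrableS ig => //.
exact: subset_itv.
Qed.

Lemma primB g x y : mu.-integrable D (EFin \o g) -> -1 < x -> x <= y -> y < 1 ->
  prim g y - prim g x = \int[mu]_(t in `[x, y]) g t.
Proof.
move=> ig x1 xy y1; rewrite /prim Rintegral_itvB ?bnd_simp//; last 2 first.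
- by apply: integrable_Ioo11S ig _ _; rewrite /= bnd_simp.
- exact: ltW.
rewrite Rintegral_itv_obnd_cbnd//.
by apply: integrable_Ioo11S ig _ _; rewrite /= bnd_simp// ltW.
Qed.

Let g0 g := g \_ D.

Let ig0 g : mu.-integrable D (EFin \o g) -> mu.-integrable setT (EFin \o (g0 g)).
Proof. by move=> ig; rewrite -restrict_EFin -integrable_mkcond. Qed.

Let prim_g0 g x : mu.-integrable D (EFin \o g) -> x < 1 ->
  prim g x = parameterized_integral mu (-1) x (g0 g).
Proof.
move=> ig x1; rewrite /prim /parameterized_integral -[RHS]Rintegral_itv_obnd_cbnd; last first.
  by apply: integrableS (ig0 ig).
apply: eq_Rintegral => t; rewrite inE/= in_itv/= => /andP[t1 tx].
by rewrite /g0 patchE mem_set// Ioo11E t1 (le_lt_trans tx).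
Qed.

Lemma prim_at_left1 g : mu.-integrable D (EFin \o g) ->
  prim g x @[x --> (1 : R)^'-] --> \int[mu]_(t in D) g t.
Proof.
move=> ig; have -> : \int[mu]_(t in D) g t = parameterized_integral mu (-1) 1 (g0 g).
  rewrite /parameterized_integral /g0 -Rintegral_itv_obnd_cbnd; last first.
    by apply: integrableS (ig0 ig).
  rewrite -Rintegral_itv_bndo_bndc; last by apply: integrableS (ig0 ig).
  by apply: eq_Rintegral => t tD; rewrite patchE tD.
have := @parameterized_integral_cvg_at_left R (-1) 1 (g0 g).
move=> /(_ ltac:(lra) (integrableS measurableT _ _ (ig0 ig))) H.
apply: cvg_trans (H _ _) => //; apply: near_eq_cvg; near=> x.
by rewrite prim_g0//; near: x; exact: nbhs_left_lt.
Unshelve. all: by end_near. Qed.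

Lemma prim_at_rightN1 g : mu.-integrable D (EFin \o g) ->
  prim g x @[x --> (-1 : R)^'+] --> 0.
Proof.
move=> ig; have := @parameterized_integral_cvg_left R (-1) 1 (g0 g).
move=> /(_ ltac:(lra) (integrableS measurableT _ _ (ig0 ig))) H.
apply: cvg_trans (cvg_at_right_filter (H _ _)) => //; apply: near_eq_cvg; near=> x.
by rewrite prim_g0//; near: x; apply: nbhs_right_lt; lra.
Unshelve. all: by end_near. Qed.

Lemma prim_rAC_loc g : mu.-integrable D (EFin \o g) -> rAC_loc (prim g).
Proof. by move=> ig c d c1 cd d1; exact: (rAC_primitive ig (ltW c1) d1). Qed.

Lemma prim_derive1 g : mu.-integrable D (EFin \o g) ->
  {ae mu, forall x, D x -> derivable (prim g) x 1 /\ derive1 (prim g) x = g x}.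
Proof.
move=> ig; have lg : locally_integrable [set: R] (g0 g).
  by apply: open_integrable_locally => //; [exact: openT|exact: ig0].
have iy y : mu.-integrable [set` Interval (BRight (-1)) (BRight y)] (EFin \o g0 g).
  exact: integrableS (ig0 ig).
have := FTC1 iy lg; apply: filterS; first exact: (ae_filter_ringOfSetsType mu).
move=> x H; rewrite Ioo11E => /andP[x1 x2].
have [] := H; first by rewrite lte_fin.
set F := fun x => _ => dF F'.
have near_eq : \forall t \near x, F t = prim g t.
  have : \forall t \near x, t \in `]-1, 1[ by apply: near_in_itvoo; rewrite in_itv/= x1.
  apply: filterS => t; rewrite in_itv/= => /andP[t1 t2]; rewrite /F /prim.
  apply: eq_Rintegral => s; rewrite inE/= in_itv/= => /andP[s1 st].
  by rewrite /g0 patchE mem_set// Ioo11E s1 (le_lt_trans st).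
split; first exact: near_eq_derivable near_eq dF.
rewrite derive1E -(near_eq_derive _ near_eq)// -derive1E F' /g0 patchE mem_set//.
by rewrite Ioo11E x1.
Qed.

(** The hypothesis on the derivative may presuppose derivability, which absolute continuity supplies
    almost everywhere. The point 0 is merely an interior base point. *)
Lemma rAC_loc_prim G g : rAC_loc G -> mu.-integrable D (EFin \o g) ->
  {ae mu, forall x, D x -> derivable G x 1 -> derive1 G x = g x} ->
  forall x, D x -> G x = (G 0 - prim g 0) + prim g x.
Proof.
move=> acG ig G' x; rewrite Ioo11E => /andP[x1 x2].
have K c d : -1 < c -> c <= d -> d < 1 -> G d - G c = prim g d - prim g c.
  move=> c1 cd d1; rewrite primB//.
  have [|||] := @rAC_integral _ c d G g cd; last by [].
  - exact: acG.
  - have : measurable_fun D g by case/integrableP: ig => /measurable_EFinP.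
    apply: measurable_funS => //; apply: subset_itv; rewrite bnd_simp//.
  - apply: filterS G'; first exact: (ae_filter_ringOfSetsType mu).
    move=> t H /andP[ct td]; apply: H; rewrite Ioo11E.
    by rewrite (lt_trans c1)//= (lt_trans td).
have [x0|x0] := leP 0 x.
  have := K 0 x ltac:(lra) x0 x2; lra.
have := K x 0 x1 (ltW x0) ltac:(lra); lra.
Qed.

Lemma eq_rAC c d f g : (forall x, c <= x <= d -> f x = g x) -> rAC c d f -> rAC c d g.
Proof.
move=> fg acf eps /acf[delta d0 H]; exists delta => // s s1 s2 s3.
rewrite (_ : \sum_(_ <- _) _ = \sum_(p <- s) `|f p.2 - f p.1|); first exact: H.
apply: eq_big_seq => p ps; have /allP/(_ _ ps)/and3P[h1 h2 h3] := s1.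
by rewrite !fg ?h1 ?h3 ?(le_trans h1 h2) ?(le_trans h2 h3).
Qed.

Lemma eq_rAC_loc f g : {in D, f =1 g} -> rAC_loc f -> rAC_loc g.
Proof.
move=> fg acf c d c1 cd d1; apply: (@eq_rAC _ _ f); last exact: acf.
by move=> x /andP[cx xd]; apply: fg; rewrite inE /D /Ioo11/= in_itv/= (lt_le_trans c1)//= (le_lt_trans xd).
Qed.

Lemma rAC_locM f g : rAC_loc f -> rAC_loc g -> rAC_loc (f \* g).
Proof. by move=> acf acg c d c1 cd d1; apply: rAC_mul => //; [exact: acf|exact: acg]. Qed.

Lemma rAC_locB f g : rAC_loc f -> rAC_loc g -> rAC_loc (f \- g).
Proof. by move=> acf acg c d c1 cd d1; apply: rAC_sub; [exact: acf|exact: acg]. Qed.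

Lemma continuous_Ioo11_measurable f : (forall x, D x -> {for x, continuous f}) ->
  measurable_fun D f.
Proof.
move=> cf; apply: open_continuous_measurable_fun; first exact: interval_open.
by move=> x; rewrite inE; exact: cf.
Qed.

Lemma near_Ioo11 x : D x -> \forall t \near x, D t.
Proof.
rewrite Ioo11E => Dx; have : \forall t \near x, t \in `]-1, 1[.
  by apply: near_in_itvoo; rewrite in_itv.
by apply: filterS => t; rewrite in_itv Ioo11E.
 Qed.

Lemma near_rightN1_Ioo11 : \forall x \near (-1 : R)^'+, D x.
Proof.
by near=> x; rewrite Ioo11E; apply/andP; split; near: x;
  [exact: nbhs_right_gt|apply: nbhs_right_lt; lra].
Unshelve. all: by end_near. Qed.

Lemma near_left1_Ioo11 : \forall x \near (1 : R)^'-, D x.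
Proof.
by near=> x; rewrite Ioo11E; apply/andP; split; near: x;
  [apply: nbhs_left_gt; lra|exact: nbhs_left_lt].
Unshelve. all: by end_near. Qed.

End IntegralOnIoo11.

Lemma ae_itv_exists {R : realType} (a b : R) (P : R -> Prop) : a < b ->
  {ae @lebesgue_measure R, forall x, a < x < b -> P x} -> exists2 x, a < x < b & P x.
Proof.
move=> ab [B [mB B0 PB]]; apply: contrapT => nP.
have sB : `]a, b[%classic `<=` B.
  move=> x; rewrite /= in_itv/= => abx; apply: PB => /= /(_ abx) Px; apply: nP; exists x => //.
have : (lebesgue_measure `]a, b[%classic <= lebesgue_measure B)%E.
  by apply: le_measure => //; rewrite inE; [exact: measurable_itv|exact: mB].
by rewrite B0 lebesgue_measure_itv/= lte_fin ab -EFinB lee_fin leNgt subr_gt0 ab.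
Qed.

(** * Sturm-Liouville expressions: domain and Green's identity *)

Section SturmLiouville.
Context {R : realType}.
Notation mu := (@lebesgue_measure R).
Notation D := (Ioo11 R).
Variables (W b q : R -> R).
Implicit Types (f g u v : R -> R) (e : {poly R}).

Definition SLp x := (1 - x ^+ 2) * W x.
Definition SL u x := (1 - x ^+ 2) * derive1 (derive1 u) x + b x * derive1 u x + q x * u x.

(** Both boundary conditions are imposed whatever the exponents. At a limit-point end they hold on
    the whole maximal domain, so this single domain covers all the cases in the definition of the
    operator. *)
Definition SLdom u := [/\ forall x, D x -> derivable u x 1, rAC_loc (derive1 u),
  wL2 D W u, wL2 D W (SL u) &
  (SLp x * derive1 u x @[x --> (-1 : R)^'+] --> 0) /\
  (SLp x * derive1 u x @[x --> (1 : R)^'-] --> 0)].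

(* Quasi-monotonicity of the leading coefficient at both ends replaces its
   explicit form [(1 - x)^(alpha+1) (1 + x)^(beta+1) / eta^2]. *)
Record SLregular : Prop := SLRegular {
  SL_W_gt0 : forall x, D x -> 0 < W x;
  SL_W_int : mu.-integrable D (EFin \o W);
  SL_cW : forall x, D x -> {for x, continuous W};
  SL_cb : forall x, D x -> {for x, continuous b};
  SL_cq : forall x, D x -> {for x, continuous q};
  SL_bounded : exists M : R, forall x, D x -> `|b x| <= M /\ `|q x| <= M;
  SL_dp : forall x, D x -> is_derive x (1:R) SLp (W x * b x);
  SL_pN1 : SLp x @[x --> (-1 : R)^'+] --> 0;
  SL_p1 : SLp x @[x --> (1 : R)^'-] --> 0;
  SL_mono : exists K : R, [/\ 0 <= K,
    forall s x, 0 <= s -> s <= x -> x < 1 -> SLp x <= K * SLp s &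
    forall s x, -1 < x -> x <= s -> s <= 0 -> SLp x <= K * SLp s] }.

Hypothesis Wbq : SLregular.

Let W_gt0 := SL_W_gt0 Wbq.
Let W_int := SL_W_int Wbq.
Let cW := SL_cW Wbq.
Let cb := SL_cb Wbq.
Let cq := SL_cq Wbq.
Let dp := SL_dp Wbq.
Let pN1 := SL_pN1 Wbq.
Let p1 := SL_p1 Wbq.

Let mD : measurable (D : set R). Proof. exact: measurable_itv. Qed.
Let mW : measurable_fun D W. Proof. exact: continuous_Ioo11_measurable. Qed.
Let mb : measurable_fun D b. Proof. exact: continuous_Ioo11_measurable. Qed.
Let mq : measurable_fun D q. Proof. exact: continuous_Ioo11_measurable. Qed.

Let mD' : measurable (D : set (measurableTypeR R)) := mD.

Let x2_gt0 x : D x -> 0 < 1 - x ^+ 2.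
Proof. by rewrite Ioo11E => /andP[x1 x2]; nra. Qed.

Lemma SLp_gt0 x : D x -> 0 < SLp x.
Proof. by move=> Dx; rewrite mulr_gt0 ?x2_gt0 ?W_gt0. Qed.

Lemma derivable_rAC_loc f : (forall x, D x -> derivable f x 1) ->
  (forall x, D x -> {for x, continuous (derive1 f)}) -> rAC_loc f.
Proof.
move=> df cf; apply: (@C1_rAC_loc _ _ (derive1 f)) => x x11; last first.
  by apply: cf; rewrite Ioo11E.
by rewrite derive1E; apply: DeriveDef => //; apply: df; rewrite Ioo11E.
Qed.

Lemma continuous_derive1_dom u : rAC_loc (derive1 u) ->
  forall x, D x -> {for x, continuous (derive1 u)}.
Proof. by move=> ac x; rewrite Ioo11E; exact: rAC_loc_continuous. Qed.

Lemma SLdom_rAC_loc u : SLdom u -> rAC_loc u.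
Proof.
by case=> du ac _ _ _; exact: derivable_rAC_loc du (continuous_derive1_dom ac).
Qed.

Lemma SLp_rAC_loc : rAC_loc SLp.
Proof.
apply: (@C1_rAC_loc _ _ (fun x => W x * b x)) => x; rewrite -Ioo11E => Dx; first exact: dp.
by apply: cvgM; [exact: cW|exact: cb].
Qed.

Lemma derive1_horner e : derive1 (horner e) = horner e^`().
Proof. by apply/funext => x; rewrite derivE. Qed.

Lemma horner_rAC_loc e : rAC_loc (horner e).
Proof.
apply: derivable_rAC_loc => x _; first exact: derivable_horner.
by rewrite derive1_horner; exact: continuous_horner.
Qed.

Lemma wL2_SLhorner e : wL2 D W (SL (horner e)).
Proof.
have -> : SL (horner e) = (fun x => horner ((1 - 'X^2) * e^`()^`()) x) \+
    ((fun x => b x * horner e^`() x) \+ (fun x => q x * horner e x)).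
  apply/funext => x; rewrite /SL !derive1_horner /= addrA hornerM.
  by rewrite hornerD hornerN hornerXn hornerC.
have lh := wL2_horner mW W_gt0 W_int.
have [M bqM] := SL_bounded Wbq.
by apply: wL2D => //; apply: wL2D => //; apply: (wL2_bounded_mul mD mW W_gt0 (M := M)) => // x /bqM[].
Qed.

Lemma SLdom_horner e : SLdom (horner e).
Proof.
split; rewrite ?derive1_horner.
- by move=> x _; exact: derivable_horner.
- exact: horner_rAC_loc.
- exact: wL2_horner.
- exact: wL2_SLhorner.
- split.
    have h : horner e^`() x @[x --> (-1 : R)^'+] --> e^`().[-1].
      by apply: cvg_at_right_filter; exact: continuous_horner.
    by have H := cvgM pN1 h; rewrite mul0r in H; apply: H.
  have h : horner e^`() x @[x --> (1 : R)^'-] --> e^`().[1].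
    by apply: cvg_at_left_filter; exact: continuous_horner.
  by have H := cvgM p1 h; rewrite mul0r in H; apply: H.
Qed.

Lemma SLB u v x : derivable u x 1 -> derivable v x 1 ->
  (\forall t \near x, derivable u t 1) -> (\forall t \near x, derivable v t 1) ->
  derivable (derive1 u) x 1 -> derivable (derive1 v) x 1 ->
  SL (u \- v) x = SL u x - SL v x.
Proof.
move=> du dv nu nv ddu ddv.
have e1 t : derivable u t 1 -> derivable v t 1 ->
    derive1 (u \- v) t = derive1 u t - derive1 v t.
  by move=> dut dvt; rewrite !derive1E (deriveB dut dvt).
have e2 : \forall t \near x, (derive1 u \- derive1 v) t = derive1 (u \- v) t.
  by apply: filterS2 nu nv => t ut vt; rewrite e1.
have h1 := e1 x du dv.
have h2 : derive1 (derive1 (u \- v)) x = derive1 (derive1 u) x - derive1 (derive1 v) x.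
  by rewrite [LHS]derive1E -(near_eq_derive _ e2) (deriveB ddu ddv) -!derive1E.
rewrite /SL h1 h2 /=.
move: (derive1 u x) (derive1 v x) (derive1 (derive1 u) x) (derive1 (derive1 v) x).
by move: (b x) (q x) (u x) (v x) (1 - x ^+ 2) => b0 q0 u0 v0 r u1 v1 u2 v2; ring.
Qed.

(** Linearity holds only almost everywhere, because second derivatives of functions in the domain
    need not exist at every point. *)
Lemma ae_SLB u v : SLdom u -> SLdom v ->
  {ae mu, forall x, D x -> SL (u \- v) x = SL u x - SL v x}.
Proof.
move=> [du acu _ _ _] [dv acv _ _ _]; have F := ae_filter_ringOfSetsType mu.
have au := rAC_loc_derivable acu; have av := rAC_loc_derivable acv.
apply: filterS2 au av => x dux dvx Dx; have := Dx; rewrite Ioo11E => x11.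
apply: SLB; [exact: du|exact: dv| | |exact: dux|exact: dvx].
  by apply: filterS (near_Ioo11 Dx); exact: du.
by apply: filterS (near_Ioo11 Dx); exact: dv.
Qed.

Lemma wL2_ae f g : wL2 D W f -> measurable_fun D g ->
  {ae mu, forall x, D x -> f x = g x} -> wL2 D W g.
Proof.
move=> lf mg fg; apply: wL2_lty => //.
have <- : (\int[mu]_(x in D) (f x * f x * W x)%:E = \int[mu]_(x in D) (g x * g x * W x)%:E)%E.
  apply: ae_eq_integral => //.
  - by have /integrableP[] := wL2_integrable mD mW W_gt0 lf lf.
  - by apply/measurable_EFinP; apply: measurable_funM => //; exact: measurable_funM.
  by apply: filterS fg; [exact: (ae_filter_ringOfSetsType mu)|move=> x H Dx; rewrite H].
by rewrite -wL2_EFin// ltry.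
Qed.

Lemma measurable_SL u : (forall x, D x -> derivable u x 1) -> rAC_loc (derive1 u) ->
  measurable_fun D (SL u).
Proof.
move=> du ac; have cdu := continuous_derive1_dom ac.
have cu x : D x -> {for x, continuous u}.
  by move=> Dx; apply: differentiable_continuous; rewrite -derivable1_diffP; exact: du.
have mx : measurable_fun D (fun x : R => 1 - x ^+ 2).
  apply: measurable_funB; first exact: measurable_cst.
  exact: measurable_funX.
apply: measurable_funD; last first.
  by apply: measurable_funM => //; exact: continuous_Ioo11_measurable.
apply: measurable_funD; apply: measurable_funM => //.
  by apply: measurable_derive1 => x; rewrite -Ioo11E; exact: cdu.
exact: continuous_Ioo11_measurable.
Qed.

Lemma SLdomB u v : SLdom u -> SLdom v -> SLdom (u \- v).
Proof.
move=> du dv; have ae := ae_SLB du dv.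
move: du dv => [du acu lu lSu [u1 u2]] [dv acv lv lSv [v1 v2]].
have e1 : {in D, derive1 u \- derive1 v =1 derive1 (u \- v)}.
  by move=> x; rewrite inE => Dx; rewrite /= !derive1E (deriveB (du x Dx) (dv x Dx)).
have duv x : D x -> derivable (u \- v) x 1 by move=> Dx; apply: derivableB; [exact: du|exact: dv].
have acuv : rAC_loc (derive1 (u \- v)) by apply: (eq_rAC_loc e1); exact: rAC_locB.
split; [exact: duv|exact: acuv|exact: (wL2B mD mW W_gt0 lu lv)| |].
  apply: (wL2_ae (wL2B mD mW W_gt0 lSu lSv)); first exact: measurable_SL.
  apply: filterS ae; first exact: (ae_filter_ringOfSetsType mu).
  by move=> x H Dx; rewrite H.
have e2 x : D x -> SLp x * derive1 u x - SLp x * derive1 v x = SLp x * derive1 (u \- v) x.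
  by move=> Dx; rewrite -e1 ?inE//=; ring.
split; rewrite -(subrr 0).
  apply: cvg_trans (cvgB u1 v1); apply: near_eq_cvg; near=> x; rewrite -e2//.
  by near: x; exact: near_rightN1_Ioo11.
apply: cvg_trans (cvgB u2 v2); apply: near_eq_cvg; near=> x; rewrite -e2//.
by near: x; exact: near_left1_Ioo11.
Unshelve. all: by end_near. Qed.

(** Mean value theorem between x0 and x, with |x - x0| <= 2; the bound p(x) <= K p(s) at the
    intermediate point s brings in the small quantity p u'. *)
Lemma SLp_mul_le (K : R) u x0 x (eps : R) : (forall t, D t -> derivable u t 1) ->
  D x0 -> D x -> 0 <= K ->
  (forall s, D s -> Num.min x0 x <= s -> s <= Num.max x0 x ->
     SLp x <= K * SLp s /\ `|SLp s * derive1 u s| <= eps) ->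
  `|SLp x * u x| <= SLp x * `|u x0| + 2 * (K * eps).
Proof.
move=> du Dx0 Dx K0 H.
have [s [Ds s1 s2 us]] : exists s, [/\ D s, Num.min x0 x <= s, s <= Num.max x0 x &
    u x - u x0 = derive1 u s * (x - x0)].
  wlog xx : x x0 Dx Dx0 {H} / x0 <= x => [wl|].
    have /orP[xx|xx0] := le_total x0 x; first exact: (wl x x0 Dx Dx0 xx).
    have [s [Ds s1 s2 E]] := wl x0 x Dx0 Dx xx0; exists s; split => //.
    + by rewrite minC. + by rewrite maxC.
    + by rewrite -opprB E -mulrN opprB.
  have sub t : x0 <= t -> t <= x -> D t.
    by move=> h1 h2; move: Dx Dx0; rewrite !Ioo11E; lra.
  have dt t : t \in `]x0, x[%R -> is_derive t (1:R) u (derive1 u t).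
    rewrite in_itv/= => /andP[h1 h2]; rewrite derive1E; apply: DeriveDef => //.
    by apply: du; apply: sub; exact: ltW.
  have ct : {within `[x0, x]%classic, continuous u}.
    apply: derivable_within_continuous => t; rewrite in_itv/= => /andP[h1 h2].
    by apply: du; exact: sub.
  have [s] := MVT_segment xx dt ct.
  rewrite in_itv/= => /andP[h1 h2] E; exists s; split; rewrite ?min_l ?max_r//.
  exact: sub.
have [pK pe] := H s Ds s1 s2.
have -> : u x = u x0 + derive1 u s * (x - x0) by rewrite -us; ring.
rewrite mulrDr (le_trans (ler_normD _ _))// normrM (gtr0_norm (SLp_gt0 Dx)) lerD2l.
rewrite normrM (gtr0_norm (SLp_gt0 Dx)) [`|_ * (x - x0)|]normrM.
have xx0 : `|x - x0| <= 2.
  by move: Dx Dx0; rewrite !Ioo11E => /andP[h1 h2] /andP[h3 h4]; rewrite ler_norml; lra.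
rewrite normrM (gtr0_norm (SLp_gt0 Ds)) in pe.
rewrite mulrA mulrC ler_pM//; first by rewrite mulr_ge0// ltW// SLp_gt0.
apply: (@le_trans _ _ (K * SLp s * `|derive1 u s|)); first by rewrite ler_wpM2r.
by rewrite -mulrA ler_wpM2l.
Qed.

(** The bracket p (u' e - u e') in Green's identity requires p u, and not only p u', to vanish at
    the ends. A base point is fixed where |p u'| has become small, and then p -> 0 disposes of the
    value of u there. *)
Lemma SLp_mul_cvg u : SLdom u ->
  (SLp x * u x @[x --> (-1 : R)^'+] --> 0) /\ (SLp x * u x @[x --> (1 : R)^'-] --> 0).
Proof.
move=> [du _ _ _ [u1 u2]]; have [K [K_ge0 p_right p_left]] := SL_mono Wbq.
(* Chosen so that 2 K times it is at most eps/2, also when K = 0. *)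
have e4 (eps : R) : 0 < eps -> 0 < eps / 4 / (K + 1).
  by move=> e0; rewrite !divr_gt0// ltr_wpDl.
have Ke (eps : R) : 0 < eps -> 2 * (K * (eps / 4 / (K + 1))) <= eps / 2.
  move=> e0; have -> : 2 * (K * (eps / 4 / (K + 1))) = eps / 2 * (K / (K + 1)).
    by field; rewrite gt_eqF// ltr_wpDl.
  by rewrite ler_piMr ?divr_ge0 ?ltW// ltr_pdivrMr ?ltr_wpDl// mul1r ltrDl.
split; apply/cvgr0Pnorm_le => eps e0.
- have /cvgr0Pnorm_le/(_ _ (e4 _ e0))[d /= d0 H] := u1.
  pose r := Num.min d 1 / 2.
  have r0 : 0 < r by rewrite divr_gt0// lt_min d0 ltr01.
  have rd : r < d.
    by rewrite /r ltr_pdivrMr// gt_min; apply/orP; left; lra.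
  have r1 : r <= 1 / 2 by rewrite /r ler_pM2r ?invr_gt0// ge_min lexx orbT.
  have Dr : D (-1 + r) by rewrite Ioo11E; lra.
  have pu : 0 < eps / 2 / (`|u (-1 + r)| + 1) by rewrite !divr_gt0// ltr_wpDl.
  have /cvgr0Pnorm_le/(_ _ pu) np := pN1.
  near=> x.
  have x1 : -1 < x by near: x; exact: nbhs_right_gt.
  have xr : x <= -1 + r by near: x; apply: nbhs_right_le; lra.
  have Dx : D x by rewrite Ioo11E; lra.
  apply: (le_trans (@SLp_mul_le K u (-1 + r) x (eps / 4 / (K + 1)) du Dr Dx K_ge0 _)).
    move=> s Ds; rewrite (min_r xr) (max_l xr) => xs sr; split.
      by apply: p_left => //; lra.
    apply: H => /=; last by move: Ds; rewrite Ioo11E => /andP[].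
    by rewrite ltr_norml; move: Ds; rewrite Ioo11E => /andP[]; lra.
  rewrite [leRHS](splitr eps) lerD ?Ke//.
  have : `|SLp x| <= eps / 2 / (`|u (-1 + r)| + 1) by near: x.
  rewrite (gtr0_norm (SLp_gt0 Dx)) ler_pdivlMr ?ltr_wpDl// => h.
  by apply: le_trans h; rewrite ler_wpM2l ?lerDl// ltW// SLp_gt0.
- have /cvgr0Pnorm_le/(_ _ (e4 _ e0))[d /= d0 H] := u2.
  pose r := Num.min d 1 / 2.
  have r0 : 0 < r by rewrite divr_gt0// lt_min d0 ltr01.
  have rd : r < d.
    by rewrite /r ltr_pdivrMr// gt_min; apply/orP; left; lra.
  have r1 : r <= 1 / 2 by rewrite /r ler_pM2r ?invr_gt0// ge_min lexx orbT.
  have Dr : D (1 - r) by rewrite Ioo11E; lra.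
  have pu : 0 < eps / 2 / (`|u (1 - r)| + 1) by rewrite !divr_gt0// ltr_wpDl.
  have /cvgr0Pnorm_le/(_ _ pu) np := p1.
  near=> x.
  have x1 : x < 1 by near: x; exact: nbhs_left_lt.
  have xr : 1 - r <= x by near: x; apply: nbhs_left_ge; lra.
  have Dx : D x by rewrite Ioo11E; lra.
  apply: (le_trans (@SLp_mul_le K u (1 - r) x (eps / 4 / (K + 1)) du Dr Dx K_ge0 _)).
    move=> s Ds; rewrite (min_l xr) (max_r xr) => xs sr; split.
      by apply: p_right => //; lra.
    apply: H => /=; last by move: Ds; rewrite Ioo11E => /andP[].
    by rewrite ltr_norml; move: Ds; rewrite Ioo11E => /andP[]; lra.
  rewrite [leRHS](splitr eps) lerD ?Ke//.
  have : `|SLp x| <= eps / 2 / (`|u (1 - r)| + 1) by near: x.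
  rewrite (gtr0_norm (SLp_gt0 Dx)) ler_pdivlMr ?ltr_wpDl// => h.
  by apply: le_trans h; rewrite ler_wpM2l ?lerDl// ltW// SLp_gt0.
Unshelve. all: by end_near. Qed.

(** The bracket G = p (u' e - u e') has almost-everywhere derivative (L u) e W - u (L e) W, and it
    vanishes at both ends because e and e' are bounded. *)
Lemma Green u e : SLdom u -> wdot D W (SL u) (horner e) = wdot D W u (SL (horner e)).
Proof.
move=> Su; have [du acu lu lSu [u1 u2]] := Su.
have [pu1 pu2] := SLp_mul_cvg Su; have acu0 := SLdom_rAC_loc Su.
have lh e' : wL2 D W (horner e') by exact: wL2_horner.
pose G := SLp \* ((derive1 u \* horner e) \- (u \* horner e^`())).
pose g x := SL u x * e.[x] * W x - u x * SL (horner e) x * W x.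
have i1 : mu.-integrable D (EFin \o (fun x => SL u x * e.[x] * W x)) by exact: wL2_integrable.
have i2 : mu.-integrable D (EFin \o (fun x => u x * SL (horner e) x * W x)).
  by apply: wL2_integrable => //; exact: wL2_SLhorner.
have ig : mu.-integrable D (EFin \o g).
  by have := integrableB mD' i1 i2; apply: eq_integrable.
have acG : rAC_loc G.
  apply: rAC_locM; first exact: SLp_rAC_loc.
  by apply: rAC_locB; apply: rAC_locM => //; exact: horner_rAC_loc.
have G' : {ae mu, forall x, D x -> derivable G x 1 -> derive1 G x = g x}.
  have := rAC_loc_derivable acu; apply: filterS; first exact: (ae_filter_ringOfSetsType mu).
  move=> x ddu Dx _; have x11 := Dx; rewrite Ioo11E in x11.
  have h1 : is_derive x (1:R) (derive1 u) (derive1 (derive1 u) x).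
    by rewrite [X in is_derive _ _ _ X]derive1E; apply: DeriveDef => //; exact: ddu.
  have h2 : is_derive x (1:R) u (derive1 u x).
    by rewrite derive1E; apply: DeriveDef => //; exact: du.
  have h3 e' : is_derive x (1:R) (horner e') (e'^`().[x]) by exact: is_derive_poly.
  have h4 := dp Dx.
  rewrite derive1E /G derive_val /g /SL !derive1_horner /SLp /GRing.scale /=; ring.
have GE := rAC_loc_prim acG ig G'.
have Gl : G x @[x --> (-1 : R)^'+] --> 0.
  have -> : G = (fun x => SLp x * derive1 u x * e.[x] - SLp x * u x * e^`().[x]).
    by apply/funext => x; rewrite /G /=; ring.
  have h e' : horner e' x @[x --> (-1 : R)^'+] --> e'.[-1].
    by apply: cvg_at_right_filter; exact: continuous_horner.
  have := cvgB (cvgM u1 (h e)) (cvgM pu1 (h e^`())).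
  by rewrite !mul0r subr0 => H; apply: H.
have Gr : G x @[x --> (1 : R)^'-] --> 0.
  have -> : G = (fun x => SLp x * derive1 u x * e.[x] - SLp x * u x * e^`().[x]).
    by apply/funext => x; rewrite /G /=; ring.
  have h e' : horner e' x @[x --> (1 : R)^'-] --> e'.[1].
    by apply: cvg_at_left_filter; exact: continuous_horner.
  have := cvgB (cvgM u2 (h e)) (cvgM pu2 (h e^`())).
  by rewrite !mul0r subr0 => H; apply: H.
have Gl' : G x @[x --> (-1 : R)^'+] --> G 0 - prim g 0 + 0.
  apply: cvg_trans (cvgD (cvg_cst (G 0 - prim g 0)) (prim_at_rightN1 ig)).
  apply: near_eq_cvg; near=> x; rewrite [RHS]GE//.
  by near: x; exact: near_rightN1_Ioo11.
have Gr' : G x @[x --> (1 : R)^'-] --> G 0 - prim g 0 + \int[mu]_(t in D) g t.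
  apply: cvg_trans (cvgD (cvg_cst (G 0 - prim g 0)) (prim_at_left1 ig)).
  apply: near_eq_cvg; near=> x; rewrite [RHS]GE//.
  by near: x; exact: near_left1_Ioo11.
have c0 := cvg_unique (@Rhausdorff R) Gl Gl'; have c1 := cvg_unique (@Rhausdorff R) Gr Gr'.
apply/eqP; rewrite -subr_eq0 /wdot -RintegralB//; apply/eqP.
by move: c1; rewrite -[G 0 - _]addr0 -c0 add0r => <-.
Unshelve. all: by end_near. Qed.

Notation p := SLp.
Notation L := SL.

Lemma prim_dist g1 g2 x : mu.-integrable D (EFin \o g1) -> mu.-integrable D (EFin \o g2) ->
  D x -> `|prim g1 x - prim g2 x| <= \int[mu]_(t in D) `|g1 t - g2 t|.
Proof.
move=> i1 i2; rewrite Ioo11E => /andP[x1 x2].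
have sub : `]-1, x]%classic `<=` D by apply: subset_itv; rewrite bnd_simp.
have iS f : mu.-integrable D (EFin \o f) -> mu.-integrable `]-1, x] (EFin \o f).
  by move=> ?; apply: (integrableS mD' _ sub).
have i12 : mu.-integrable D (EFin \o (fun t => g1 t - g2 t)).
  by have := integrableB mD' i1 i2; apply: eq_integrable.
have iabs : mu.-integrable D (EFin \o (fun t => `|g1 t - g2 t|)).
  by have := integrable_abse i12; apply: eq_integrable.
rewrite /prim -RintegralB//; [|exact: iS..].
apply: le_trans (le_normr_Rintegral _ (iS _ i12)) _ => //.
rewrite /Rintegral fine_le//.
- by apply: integrable_fin_num => //; exact: iS.
- exact: integrable_fin_num.
apply: ge0_subset_integral => //; first by case/integrableP: iabs.
Qed.

(** W has finite mass I; integrating 2 s |g| <= g^2 + s^2 against W with s = eps/(I+1) gives the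
    bound. *)
Lemma L1_small (eps : R) : 0 < eps -> exists2 delta : R, 0 < delta &
  forall g, wL2 D W g -> wsqn D W g <= delta -> \int[mu]_(x in D) (`|g x| * W x) <= eps.
Proof.
move=> e0; pose I := \int[mu]_(x in D) W x.
have I0 : 0 <= I by apply: Rintegral_ge0 => x Dx; exact/ltW/W_gt0.
pose s := eps / (I + 1); have s0 : 0 < s by rewrite divr_gt0// ltr_wpDl.
exists (s * eps); first exact: mulr_gt0.
move=> g lg gd.
have lag : wL2 D W (fun x => `|g x|).
  apply: (wL2_le mD mW W_gt0 _ lg); first by apply: measurableT_comp => //; case: lg.
  by move=> x _; rewrite normr_id.
have ls : wL2 D W (fun=> s) by apply: (wL2_bounded mW W_gt0 W_int (M := `|s|)).
have := wdot_le mD mW W_gt0 lag ls.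
have -> : wdot D W (fun x => `|g x|) (fun=> s) = s * \int[mu]_(x in D) (`|g x| * W x).
  rewrite /wdot -RintegralZl//.
    by apply: eq_Rintegral => x _; ring.
  have l1 : wL2 D W (fun=> 1) by apply: (wL2_bounded mW W_gt0 W_int (M := `|1|)).
  have := wL2_integrable mD mW W_gt0 lag l1; apply: eq_integrable => // x _.
  by rewrite /= mulr1.
have -> : wsqn D W (fun x => `|g x|) = wsqn D W g.
  by apply: eq_Rintegral => x _; rewrite -normrM ger0_norm// -expr2 sqr_ge0.
have -> : wsqn D W (fun=> s) = s ^+ 2 * I.
  by rewrite /wsqn /wdot -RintegralZl//.
set J := Rintegral _ _ _ => H.
have J0 : 0 <= J by apply: Rintegral_ge0 => x Dx; rewrite mulr_ge0// ltW// W_gt0.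
rewrite ger0_norm in H; last by rewrite mulr_ge0// ltW.
have sI : s * I <= eps.
  by rewrite /s -mulrA ler_piMr// ?ltW// mulrC ltr_pdivrMr ?ltr_wpDl// mul1r ltrDl.
have : s * (2 * J) <= s * (2 * eps).
  have : s * (s * I) <= s * eps by rewrite ler_pM2l.
  by rewrite expr2 in H; lra.
by rewrite ler_pM2l//; lra.
Qed.

Let lh e : wL2 D W (horner e). Proof. exact: wL2_horner. Qed.
Let lLh e : wL2 D W (L (horner e)). Proof. exact: wL2_SLhorner. Qed.
Let lq f : wL2 D W f -> wL2 D W (fun x => q x * f x).
Proof.
have [M bqM] := SL_bounded Wbq.
by apply: (wL2_bounded_mul mD mW W_gt0 (M := M)) => // x /bqM[].
Qed.

Let int_kW k : wL2 D W k -> mu.-integrable D (EFin \o (fun x => k x * W x)).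
Proof.
move=> lk; have l1 : wL2 D W (fun=> 1) by apply: (wL2_bounded mW W_gt0 W_int (M := `|1|)).
have := wL2_integrable mD mW W_gt0 lk l1; apply: eq_integrable => // x _.
by rewrite /= mulr1.
Qed.

Lemma SLp_continuous x : D x -> {for x, continuous p}.
Proof.
move=> /dp [dx _]; apply: differentiable_continuous; rewrite -derivable1_diffP.
exact: dx.
Qed.

Lemma rAC_loc_divp F : rAC_loc F -> rAC_loc (fun x => F x / p x).
Proof.
move=> acF; apply: (rAC_locM acF).
apply: (@C1_rAC_loc _ _ (fun x => - (p x) ^- 2 * (W x * b x))) => x; rewrite -Ioo11E => Dx.
  have pn : p x != 0 by rewrite gt_eqF// (SLp_gt0).
  have h := dp Dx; have := is_deriveV pn => /(_ _ _ h).
  by move=> H; apply: (is_derive_eq H).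
apply: cvgM; last by apply: cvgM; [exact: cW|exact: cb].
apply: cvgN; apply: cvgV.
  by rewrite expf_neq0// gt_eqF// (SLp_gt0).
by rewrite expr2; under eq_cvg do rewrite expr2; apply: cvgM; exact: SLp_continuous.
Qed.

(** (p u')' = (L u - q u) W, which is integrable since u and L u are square integrable, q is bounded
    and W has finite mass. Hence p u' has finite limits at both ends before any boundary condition
    is imposed. *)
Lemma SLp_deriv_prim u : (forall x, D x -> derivable u x 1) -> rAC_loc (derive1 u) ->
  wL2 D W u -> wL2 D W (L u) -> let g t := (L u t - q t * u t) * W t in
  mu.-integrable D (EFin \o g) /\
  forall x, D x -> p x * derive1 u x = (p 0 * derive1 u 0 - prim g 0) + prim g x.
Proof.
move=> du acu lu lLu g; pose G t := p t * derive1 u t.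
have ig : mu.-integrable D (EFin \o g).
  by apply: int_kW; apply: (wL2B mD mW W_gt0) => //; exact: lq.
have acG : rAC_loc G by apply: rAC_locM => //; exact: (SLp_rAC_loc).
split=> //; apply: (rAC_loc_prim acG ig).
have := rAC_loc_derivable acu; apply: filterS; first exact: (ae_filter_ringOfSetsType mu).
move=> t ddu Dt _; have t11 := Dt; rewrite Ioo11E in t11.
have h1 : is_derive t (1:R) (derive1 u) (derive1 (derive1 u) t).
  by rewrite [X in is_derive _ _ _ X]derive1E; apply: DeriveDef => //; exact: ddu.
have h2 := dp Dt.
have -> : G = p \* derive1 u by [].
by rewrite derive1E derive_val /g /SL /SLp /GRing.scale /=; ring.
Qed.

Lemma SLp_deriv_horner e x : D x ->
  p x * e^`().[x] = prim (fun t => (L (horner e) t - q t * e.[t]) * W t) x.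
Proof.
have [de ac le lLe [e1 _]] := SLdom_horner e.
have [ig GE] := SLp_deriv_prim de ac le lLe; set g := fun t => _ in ig GE.
pose C := p 0 * derive1 (horner e) 0 - prim g 0.
have Gl' : p t * derive1 (horner e) t @[t --> (-1 : R)^'+] --> C + 0.
  apply: cvg_trans (cvgD (cvg_cst C) (prim_at_rightN1 ig)).
  apply: near_eq_cvg; near=> t; rewrite [RHS]GE//.
  by near: t; exact: near_rightN1_Ioo11.
have c0 := cvg_unique (@Rhausdorff R) e1 Gl'.
by move=> /GE; rewrite -/C -[C]addr0 -c0 add0r => <-; rewrite derive1_horner.
Unshelve. all: by end_near. Qed.

(** * Closedness of the operator along sequences of polynomials *)

Section Closed.
Variables (P : nat -> {poly R}) (u h : R -> R).
Hypotheses (lu : wL2 D W u) (lh' : wL2 D W h).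
Hypothesis uP : wsqn D W (u \- horner (P n)) @[n --> \oo] --> 0.
Hypothesis hP : wsqn D W (h \- L (horner (P n))) @[n --> \oo] --> 0.
Hypothesis uae : {ae mu, forall x, D x -> (P n).[x] @[n --> \oo] --> u x}.

Let k x := h x - q x * u x.
Let F := prim (fun x => k x * W x).

Let lk : wL2 D W k. Proof. by apply: (wL2B mD mW W_gt0) => //; exact: lq. Qed.

Let ik : mu.-integrable D (EFin \o (fun x => k x * W x)). Proof. exact: int_kW. Qed.

(** Integration from -1 upgrades the two L^2 convergences to uniform convergence of p P_n' on the
    whole interval, through [L1_small]. *)
Let F_unif (eps : R) : 0 < eps -> exists N, forall n x, (N <= n)%N -> D x ->
  `|F x - p x * (P n)^`().[x]| <= eps.
Proof.
move=> e0; have [delta d0 H] := L1_small e0.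
have [M bqM] := SL_bounded Wbq.
pose dk n := (h \- L (horner (P n))) \- (fun x => q x * (u \- horner (P n)) x).
have ldk n : wL2 D W (dk n).
  by apply: (wL2B mD mW W_gt0); [|apply: lq]; apply: (wL2B mD mW W_gt0).
have dkle n : wsqn D W (dk n) <= 2 * (wsqn D W (h \- L (horner (P n))) +
    M ^+ 2 * wsqn D W (u \- horner (P n))).
  have l1 : wL2 D W (h \- L (horner (P n))) by apply: (wL2B mD mW W_gt0).
  have l2 : wL2 D W (u \- horner (P n)) by apply: (wL2B mD mW W_gt0).
  have l3 := lq l2.
  have -> : dk n = (h \- L (horner (P n))) \+ (fun x => -1 * (q x * (u \- horner (P n)) x)).
    by apply/funext => x; rewrite /dk /=; ring.
  apply: le_trans (wsqnD_le mD mW W_gt0 l1 (wL2Z mD (-1) l3)) _.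
  rewrite wsqnZ// sqrrN expr1n mul1r ler_pM2l// lerD2l -wsqnZ//.
  apply: wsqn_le => //; first exact: wL2Z.
  move=> x Dx; rewrite !normrM ler_wpM2r//; have [_ qM] := bqM x Dx.
  by rewrite (le_trans qM)// ler_norm.
have dk0 : wsqn D W (dk n) @[n --> \oo] --> 0.
  apply: (@squeeze_cvgr _ _ _ _ (fun=> 0) (fun n => 2 * (wsqn D W (h \- L (horner (P n))) +
    M ^+ 2 * wsqn D W (u \- horner (P n))))).
  - by apply: nearW => n; rewrite dkle (wsqn_ge0 W_gt0).
  - exact: cvg_cst.
  - rewrite -[X in _ --> X](_ : 2 * (0 + M ^+ 2 * 0) = 0); last by rewrite mulr0 addr0 mulr0.
    by apply: cvgMr; apply: cvgD => //; apply: cvgMr.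
have /cvgr0Pnorm_le/(_ _ d0)[N _ HN] := dk0.
exists N => n x Nn Dx; rewrite SLp_deriv_horner//.
have lkn : wL2 D W (fun t => L (horner (P n)) t - q t * (P n).[t]).
  by apply: (wL2B mD mW W_gt0) => //; exact: lq.
apply: le_trans (prim_dist ik (int_kW lkn) Dx) _.
have := HN n Nn; rewrite /= ger0_norm ?(wsqn_ge0 W_gt0)// => /(H _ (ldk n)).
apply: le_trans; rewrite le_eqVlt; apply/orP; left; apply/eqP.
apply: eq_Rintegral => t; rewrite inE => Dt.
rewrite -mulrBl normrM (gtr0_norm (W_gt0 Dt)); congr (`|_| * _).
by rewrite /dk /k /=; ring.
Qed.

(** A primitive taken from -1 need not vanish at 1; this one does, as a uniform limit of the
    functions p P_n', each of which tends to 0 there. *)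
Let F1 : F x @[x --> (1 : R)^'-] --> 0.
Proof.
apply/cvgr0Pnorm_le => eps e0; have e20 : 0 < eps / 2 by rewrite divr_gt0.
have [N HN] := F_unif e20.
have [_ _ _ _ [_ e1]] := SLdom_horner (P N).
have /cvgr0Pnorm_le/(_ _ e20) := e1; 
rewrite derive1_horner => np; near=> x.
have Dx : D x by near: x; exact: near_left1_Ioo11.
have := HN N x (leqnn _) Dx.
have : `|p x * (P N)^`().[x]| <= eps / 2 by near: x.
move: (p x * _) => a h1 h2; have := ler_normD (F x - a) a; rewrite subrK => /le_trans; apply.
by rewrite [leRHS](splitr eps) lerD.
Unshelve. all: by end_near. Qed.

Let FN1 : F x @[x --> (-1 : R)^'+] --> 0. Proof. exact: prim_at_rightN1. Qed.

Let acF : rAC_loc F. Proof. exact: prim_rAC_loc. Qed.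

Let v x := F x / p x.

Let acv : rAC_loc v. Proof. exact: rAC_loc_divp. Qed.

Let cv x : D x -> {for x, continuous v}.
Proof. by rewrite Ioo11E; exact: rAC_loc_continuous. Qed.

Let subD c x t : D c -> D x -> c <= t -> t <= x -> D t.
Proof. by rewrite !Ioo11E; lra. Qed.

Let int_v c x : D c -> D x -> mu.-integrable `[c, x] (EFin \o v).
Proof.
move=> Dc Dx; apply: continuous_compact_integrable; first exact: segment_compact.
apply: continuous_in_subspaceT => t; rewrite inE/= in_itv/= => /andP[ct tx].
exact: cv (subD Dc Dx ct tx).
Qed.

Let horner_prim e c x : D c -> D x -> c <= x ->
  e.[x] - e.[c] = \int[mu]_(t in `[c, x]) e^`().[t].
Proof.
move=> Dc Dx cx; have [|||_ //] := @rAC_integral _ c x (horner e) (horner e^`()) cx.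
- by move: Dc Dx; rewrite !Ioo11E => /andP[c1 _] /andP[_ x1]; exact: horner_rAC_loc.
- apply: measurable_funTS; apply: continuous_measurable_fun; exact: continuous_horner.
- by apply: aeW => t _ _; rewrite derive1_horner.
Qed.

Let P_cvg c x : D c -> D x -> c <= x ->
  (P n).[x] - (P n).[c] @[n --> \oo] --> \int[mu]_(t in `[c, x]) v t.
Proof.
move=> Dc Dx cx.
have cp : {within `[c, x]%classic, continuous p}.
  apply: continuous_in_subspaceT => t; rewrite inE/= in_itv/= => /andP[ct tx].
  exact: SLp_continuous (subD Dc Dx ct tx).
(* The minimum of [p] over [c, x] is positive, so uniform control of p (v - P_n') gives uniform
   control of v - P_n' on this compact interval. *)
have [t0 t0cx pmin] := EVT_min cx cp.
have Dt0 : D t0 by move: t0cx; rewrite in_itv/= => /andP[]; exact: subD.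
have pt0 := SLp_gt0 Dt0.
apply/cvgrPdist_le => eps e0.
have xc0 : 0 < x - c + 1 by rewrite ltr_wpDl// subr_ge0.
have e1 : 0 < eps * p t0 / (x - c + 1) by rewrite divr_gt0// mulr_gt0.
have [N HN] := F_unif e1; exists N => // n /= Nn.
have mcx : measurable (`[c, x]%classic : set (measurableTypeR R)) := measurable_itv _.
have ie : mu.-integrable `[c, x] (EFin \o horner (P n)^`()).
  apply: continuous_compact_integrable; first exact: segment_compact.
  apply: continuous_in_subspaceT => t _; exact: continuous_horner.
rewrite horner_prim// -RintegralB//; last exact: int_v.
have idiff : mu.-integrable `[c, x] (EFin \o (fun t => v t - (P n)^`().[t])).
  by have := integrableB mcx (int_v Dc Dx) ie; apply: eq_integrable.
apply: le_trans (le_normr_Rintegral _ idiff) _ => //.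
apply: (@le_trans _ _ (\int[mu]_(t in `[c, x]) (eps / (x - c + 1)))).
  apply: le_Rintegral => //.
  - by have := integrable_abse idiff; apply: eq_integrable.
  - apply: continuous_compact_integrable; first exact: segment_compact.
    by apply: continuous_in_subspaceT => t _; exact: cvg_cst.
  move=> t; rewrite /= in_itv/= => tcx; have Dt : D t by case/andP: tcx; exact: subD.
  have pt := SLp_gt0 Dt.
  have := HN n t Nn Dt.
  have -> : F t - p t * (P n)^`().[t] = (v t - (P n)^`().[t]) * p t.
    by rewrite /v; field; rewrite gt_eqF.
  rewrite normrM (gtr0_norm pt) => Fle.
  rewrite -(ler_pM2r pt0) (le_trans (_ : _ <= `|v t - (P n)^`().[t]| * p t))//.
    by rewrite ler_wpM2l// pmin// in_itv.
  by rewrite (le_trans Fle)// mulrAC.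
have mE : mu `[c, x]%classic = (x - c)%:E.
  rewrite lebesgue_measure_itv/= lte_fin; case: ltP => xc; first by rewrite -EFinB.
  by congr EFin; apply/esym/eqP; rewrite subr_eq0; apply/eqP/le_anti; rewrite cx xc.
rewrite Rintegral_cst// [X in fine X](_ : _ = (x - c)%:E); last exact: mE.
by rewrite /= mulrAC ler_pdivrMr// ler_wpM2l ?ltW// ltrDl.
Qed.

(** The regular representative of [u]. The limit exists at every point of (-1,1): it exists at one
    point, and increments of P_n converge to integrals of [v]. *)
Let w x := limn (fun n => (P n).[x]).

Let w_cvg x : D x -> (P n).[x] @[n --> \oo] --> w x.
Proof.
have [x0 x01 Px0] : exists2 x0, -1 < x0 < 1 & (P n).[x0] @[n --> \oo] --> u x0.
  apply: ae_itv_exists; first lra.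
  apply: filterS uae; first exact: (ae_filter_ringOfSetsType mu).
  by move=> t Pt t11; apply: Pt; rewrite Ioo11E.
have Dx0 : D x0 by rewrite Ioo11E.
move=> Dx; suff : cvgn (fun n => (P n).[x]) by [].
have /orP[xx0|xx0] := le_total x x0.
  have -> : (fun n => (P n).[x]) = (fun n => (P n).[x0] - ((P n).[x0] - (P n).[x])).
    by apply/funext => n; rewrite opprB addrCA subrr addr0.
  apply: is_cvgB; first by apply/cvg_ex; exists (u x0).
  by apply/cvg_ex; eexists; exact: P_cvg.
have -> : (fun n => (P n).[x]) = (fun n => (P n).[x0] + ((P n).[x] - (P n).[x0])).
  by apply/funext => n; rewrite addrCA subrr addr0.
apply: is_cvgD; first by apply/cvg_ex; exists (u x0).
by apply/cvg_ex; eexists; exact: P_cvg.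
Qed.

Let w_prim c x : D c -> D x -> c <= x -> w x = w c + \int[mu]_(t in `[c, x]) v t.
Proof.
move=> Dc Dx cx; have wxc := cvgB (w_cvg Dx) (w_cvg Dc).
have := cvg_unique (@Rhausdorff R) (wxc _) (P_cvg Dc Dx cx).
by move=> <-; rewrite addrCA subrr addr0.
Qed.

Let dw x : D x -> derivable w x 1 /\ derive1 w x = v x.
Proof.
move=> Dx; pose c := (x - 1) / 2; pose d := (x + 1) / 2.
have [cx xd Dc Dd] : [/\ c < x, x < d, D c & D d].
  by move: Dx; rewrite !Ioo11E /c /d; split; lra.
have [] := @continuous_FTC1_closed R v c x d xd (int_v Dc Dd) cx (cv Dx).
set G := (fun x => _) => dG G'.
have near_eq : \forall t \near x, w c + G t = w t.
  have : \forall t \near x, t \in `]c, d[ by apply: near_in_itvoo; rewrite in_itv/= cx.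
  apply: filterS => t; rewrite in_itv/= => /andP[ct td]; rewrite /G -w_prim//; last exact: ltW.
  by apply: subD Dc Dd _ _; exact: ltW.
exact: near_cstD_derive1 dG G' near_eq.
Qed.

Lemma SL_closed : exists w, [/\ SLdom w, {ae mu, forall x, D x -> u x = w x} &
  {ae mu, forall x, D x -> L w x = h x}].
Proof.
have F_ := ae_filter_ringOfSetsType mu.
have uw : {ae mu, forall x, D x -> u x = w x}.
  apply: filterS uae => x H Dx.
  exact: (cvg_unique (@Rhausdorff R) (H Dx) (w_cvg Dx)).
have vw : {in D, v =1 derive1 w} by move=> x; rewrite inE => /dw[].
have acw : rAC_loc (derive1 w) by exact: eq_rAC_loc vw acv.
have dw1 x : D x -> derivable w x 1 by case/dw.
have Lw : {ae mu, forall x, D x -> L w x = h x}.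
  have H := prim_derive1 ik; apply: filterS2 H uw => x H1 H2 Dx.
  have [dF F'] := H1 Dx; have pn : p x != 0 by rewrite gt_eqF// (SLp_gt0).
  have h1 : is_derive x (1:R) F (k x * W x) by rewrite -F' derive1E; exact: DeriveDef.
  have h2 := dp Dx.
  have := is_deriveV pn => /(_ _ _ h2) h3.
  have near_eq : \forall t \near x, (F \* (fun t => (p t)^-1)) t = derive1 w t.
    by apply: filterS (near_Ioo11 Dx) => t Dt; rewrite -vw ?inE.
  have -> : L w x = (1 - x ^+ 2) * derive1 (derive1 w) x + b x * v x + q x * u x.
    by rewrite /SL -vw ?inE// H2.
  rewrite derive1E -(near_eq_derive _ near_eq) derive_val /GRing.scale /= /k /v /SLp.
  have W0 := W_gt0 Dx; have x0 := x2_gt0 Dx.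
  by field; rewrite !gt_eqF.
exists w; split => //; split => //.
- apply: (wL2_ae lu) => //; apply: continuous_Ioo11_measurable => x /dw1 dx.
  by apply: differentiable_continuous; rewrite -derivable1_diffP.
- apply: (wL2_ae lh'); first exact: (measurable_SL).
  by apply: filterS Lw => x H Dx; rewrite H.
have pF x : D x -> F x = p x * derive1 w x.
  by move=> Dx; rewrite -vw ?inE// /v mulrC divfK// gt_eqF// (SLp_gt0).
split.
  apply: cvg_trans FN1; apply: near_eq_cvg; near=> x; rewrite [LHS]pF//.
  by near: x; exact: near_rightN1_Ioo11.
apply: cvg_trans F1; apply: near_eq_cvg; near=> x; rewrite [LHS]pF//.
by near: x; exact: near_left1_Ioo11.
Unshelve. all: by end_near. Qed.

End Closed.

(** * Eigenfunction expansion and resolvent estimates *)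

Variables (e : nat -> {poly R}) (lam : nat -> R).
Hypothesis e_eigen : forall k x, D x -> L (horner (e k)) x = lam k * (e k).[x].
Hypothesis e_neq0 : forall k, e k != 0.
Hypothesis lam_inj : injective lam.

Implicit Types (c s : {poly R}).

(** The type of polynomials serves for [c] only as that of finitely supported sequences, with its
    subtraction; the actual polynomial in x is the value. *)
Definition lincomb c : {poly R} := \sum_(k < size c) c`_k *: e k.

Hypothesis e_dense : forall f, wL2 D W f -> forall eps : R, 0 < eps ->
  exists c, wsqn D W (f \- horner (lincomb c)) < eps.

Notation E := lincomb.
Notation H p := (horner p).

Lemma lincomb_widen n c : (size c <= n)%N -> E c = \sum_(k < n) c`_k *: e k.
Proof.
move=> cn; rewrite /lincomb (big_ord_widen n (fun k => c`_k *: e k) cn) big_mkcond /=.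
apply: eq_bigr => k _; case: ltnP => // ck.
by rewrite nth_default// scale0r.
Qed.

Lemma lincombB c s : E (c - s) = E c - E s.
Proof.
set n := maxn (size c) (size s).
have h1 : (size c <= n)%N by rewrite leq_maxl.
have h2 : (size s <= n)%N by rewrite leq_maxr.
have h3 : (size (c - s)%R <= n)%N by rewrite (leq_trans (size_polyD _ _))// size_polyN.
rewrite (lincomb_widen h1) (lincomb_widen h2) (lincomb_widen h3) -sumrB.
by apply: eq_bigr => k _; rewrite coefB scalerBl.
Qed.

Lemma wdot_lincomb f n (c : nat -> R) : wL2 D W f ->
  wdot D W f (H (\sum_(k < n) c k *: e k)) = \sum_(k < n) c k * wdot D W f (H (e k)).
Proof.
move=> lf; elim: n => [|n IH].
  rewrite !big_ord0 /wdot (_ : (fun _ => _) = cst 0).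
    by rewrite Rintegral_cst// mul0r.
  by apply/funext => x; rewrite horner0 mulr0 mul0r.
rewrite !big_ord_recr /= -IH wdotC.
have -> : H (\sum_(k < n) c k *: e k + c n *: e n) =
    H (\sum_(k < n) c k *: e k) \+ (fun x => c n * H (e n) x).
  by apply/funext => x; rewrite /= hornerD hornerZ.
rewrite (wdotDl mD mW W_gt0)//; last exact: (wL2Z mD _ (lh _)).
by rewrite (wdotZl mD mW W_gt0)// wdotC [wdot _ _ (H (e n)) _]wdotC.
Qed.

Lemma wdot_eigen u k : SLdom u -> wdot D W (L u) (H (e k)) = lam k * wdot D W u (H (e k)).
Proof.
move=> Su; rewrite (Green (e k) Su) wdotC.
have lu : wL2 D W u by case: Su.
rewrite [RHS](_ : _ = wdot D W (fun x => lam k * H (e k) x) u).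
  by apply: eq_wdot => // x; rewrite inE => /e_eigen ->.
by rewrite (wdotZl mD mW W_gt0)// wdotC.
Qed.

Lemma wdot_ortho j k : j != k -> wdot D W (H (e j)) (H (e k)) = 0.
Proof.
move=> jk; have := wdot_eigen k (SLdom_horner (e j)).
rewrite [LHS](_ : _ = wdot D W (fun x => lam j * H (e j) x) (H (e k))); last first.
  by apply: eq_wdot => // x; rewrite inE => /e_eigen ->.
rewrite (wdotZl mD mW W_gt0)// => /eqP; rewrite -subr_eq0 -mulrBl mulf_eq0 subr_eq0.
by case/orP => [/eqP/lam_inj jk'|/eqP//]; rewrite jk' eqxx in jk.
Qed.

Lemma wsqn_lincomb n c : (size c <= n)%N ->
  wsqn D W (H (E c)) = \sum_(k < n) c`_k ^+ 2 * wsqn D W (H (e k)).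
Proof.
move=> cn; rewrite /wsqn (lincomb_widen cn) wdot_lincomb//.
apply: eq_bigr => k _; rewrite wdotC wdot_lincomb// (bigD1 k)//= big1 ?addr0.
  by rewrite expr2 mulrA.
by move=> j jk; rewrite wdot_ortho ?mulr0// eq_sym.
Qed.

Lemma SLhornerE p' x :
  L (H p') x = (1 - x ^+ 2) * p'^`()^`().[x] + b x * p'^`().[x] + q x * p'.[x].
Proof. by rewrite /SL !derive1_horner. Qed.

Lemma SL_sum n (c : nat -> R) x : D x ->
  L (H (\sum_(k < n) c k *: e k)) x = \sum_(k < n) (c k * lam k) * (e k).[x].
Proof.
move=> Dx; elim: n => [|n IH].
  by rewrite !big_ord0 SLhornerE !linear0 !horner0; ring.
rewrite !big_ord_recr /= -IH -mulrA -(e_eigen n Dx) !SLhornerE !linearD !linearZ /=.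
by rewrite !hornerD !hornerZ; ring.
Qed.

(* [S = s1 + i s2] solves [(T - lambda) S = C], [lambda = a + i t], coefficientwise. *)
Definition coef_sol (a t : R) (c1 c2 s1 s2 : {poly R}) := forall k,
  (lam k - a) * s1`_k + t * s2`_k = c1`_k /\ (lam k - a) * s2`_k - t * s1`_k = c2`_k.

Lemma coef_solB a t c1 c2 s1 s2 c1' c2' s1' s2' :
  coef_sol a t c1 c2 s1 s2 -> coef_sol a t c1' c2' s1' s2' ->
  coef_sol a t (c1 - c1') (c2 - c2') (s1 - s1') (s2 - s2').
Proof.
move=> h h' k; have [h1 h2] := h k; have [h3 h4] := h' k.
by rewrite !coefB -h1 -h2 -h3 -h4; split; ring.
Qed.

(** If S solves the equation for lambda and C, then i times the conjugate of S solves it for the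
    conjugate of lambda and i times the conjugate of C. Statements about real parts thus transfer to
    imaginary parts. *)
Lemma coef_solC a t c1 c2 s1 s2 :
  coef_sol a t c1 c2 s1 s2 -> coef_sol a (- t) c2 c1 s2 s1.
Proof. by move=> h k; have [<- <-] := h k; split; ring. Qed.

(** Cramer's rule; the determinant of the k-th block is |lam k - lambda|^2. *)
Lemma coef_sol_exists a t c1 c2 : (forall k, (lam k - a) ^+ 2 + t ^+ 2 != 0) ->
  exists s1 s2, coef_sol a t c1 c2 s1 s2.
Proof.
move=> dl; pose n := maxn (size c1) (size c2).
exists (\poly_(k < n) (((lam k - a) * c1`_k - t * c2`_k) / ((lam k - a) ^+ 2 + t ^+ 2))).
exists (\poly_(k < n) (((lam k - a) * c2`_k + t * c1`_k) / ((lam k - a) ^+ 2 + t ^+ 2))).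
move=> k; rewrite !coef_poly; case: ltnP => kn; first by split; field.
rewrite !mulr0 addr0 subr0 !nth_default//; apply: leq_trans kn; first exact: leq_maxr.
exact: leq_maxl.
Qed.

Lemma coef_sol_bound a t d c1 c2 s1 s2 : 0 <= d ->
  (forall k, d <= (lam k - a) ^+ 2 + t ^+ 2) -> coef_sol a t c1 c2 s1 s2 ->
  d * (wsqn D W (H (E s1)) + wsqn D W (H (E s2))) <=
    wsqn D W (H (E c1)) + wsqn D W (H (E c2)).
Proof.
move=> d0 dl S.
pose n := maxn (maxn (size c1) (size c2)) (maxn (size s1) (size s2)).
rewrite !(@wsqn_lincomb n); try by rewrite !leq_max leqnn ?orbT.
rewrite -!big_split /= mulr_sumr; apply: ler_sum => k _.
have [<- <-] := S k; rewrite -!mulrDl mulrA ler_wpM2r ?(wsqn_ge0 W_gt0)//.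
have -> : ((lam k - a) * s1`_k + t * s2`_k) ^+ 2 + ((lam k - a) * s2`_k - t * s1`_k) ^+ 2 =
  ((lam k - a) ^+ 2 + t ^+ 2) * (s1`_k ^+ 2 + s2`_k ^+ 2) by ring.
by rewrite ler_wpM2r ?dl// addr_ge0 ?sqr_ge0.
Qed.

Lemma coef_sol_SL a t c1 c2 s1 s2 x : coef_sol a t c1 c2 s1 s2 -> D x ->
  L (H (E s1)) x = (E c1).[x] + a * (E s1).[x] - t * (E s2).[x].
Proof.
move=> S Dx; pose n := maxn (size c1) (maxn (size s1) (size s2)).
rewrite !(@lincomb_widen n); try by rewrite !leq_max leqnn ?orbT.
rewrite SL_sum// !horner_sum !mulr_sumr -big_split -sumrB /=; apply: eq_bigr => k _.
by have [<- _] := S k; rewrite !hornerZ; ring.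
Qed.

Lemma residual_cvg0 a t g u v (C S1 S2 : nat -> {poly R}) :
  wL2 D W g -> wL2 D W u -> wL2 D W v ->
  (forall n x, D x -> L (H (E (S1 n))) x = (E (C n)).[x] + a * (E (S1 n)).[x] - t * (E (S2 n)).[x]) ->
  wsqn D W (g \- H (E (C n))) @[n --> \oo] --> 0 ->
  wsqn D W (u \- H (E (S1 n))) @[n --> \oo] --> 0 ->
  wsqn D W (v \- H (E (S2 n))) @[n --> \oo] --> 0 ->
  wsqn D W ((fun x => g x + a * u x - t * v x) \- L (H (E (S1 n)))) @[n --> \oo] --> 0.
Proof.
move=> lg lu lv LE c1 c2 c3.
apply: (@squeeze_cvgr _ _ _ _ (fun=> 0) (fun n => 2 * (wsqn D W (g \- H (E (C n))) +
  2 * (a ^+ 2 * wsqn D W (u \- H (E (S1 n))) + t ^+ 2 * wsqn D W (v \- H (E (S2 n))))))).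
- apply: nearW => n; rewrite (wsqn_ge0 W_gt0) /=.
  have l1 := wL2B mD mW W_gt0 lg (lh (E (C n))).
  have l2 := wL2B mD mW W_gt0 lu (lh (E (S1 n))).
  have l3 := wL2B mD mW W_gt0 lv (lh (E (S2 n))).
  have l2a := wL2Z mD a l2; have l3t := wL2Z mD (- t) l3.
  have l23 := wL2D mD mW W_gt0 l2a l3t.
  rewrite -(wsqnZ mD mW W_gt0 a l2) -sqrrN -(wsqnZ mD mW W_gt0 (- t) l3).
  apply: (@le_trans _ _ (2 * (wsqn D W (g \- H (E (C n))) + wsqn D W
     ((fun x => a * (u \- H (E (S1 n))) x) \+ (fun x => - t * (v \- H (E (S2 n))) x))))).
    rewrite (_ : wsqn D W (_ \- L _) = wsqn D W ((g \- H (E (C n))) \+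
      ((fun x => a * (u \- H (E (S1 n))) x) \+ (fun x => - t * (v \- H (E (S2 n))) x)))).
      exact: wsqnD_le.
    by apply: eq_wdot => x; rewrite inE => Dx; rewrite /= LE//; ring.
  by rewrite ler_pM2l// lerD2l; exact: wsqnD_le.
- exact: cvg_cst.
- rewrite -[X in _ --> X](_ : 2 * (0 + 2 * (a ^+ 2 * 0 + t ^+ 2 * 0)) = 0); last by ring.
  by apply: cvgMr; apply: cvgD => //; apply: cvgMr; apply: cvgD; apply: cvgMr.
Qed.

(** Approximating the right-hand sides within squared distance 4^-n makes the coefficientwise
    solutions satisfy the geometric hypothesis of [wL2_complete], and [SL_closed] identifies their
    limits. The factor 4 comes from two doublings: from the limit to an approximate solution, and
    from an approximate right-hand side to the given one. *)
Lemma SL_surj a t d g1 g2 : 0 < d -> (forall k, d <= (lam k - a) ^+ 2 + t ^+ 2) ->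
  wL2 D W g1 -> wL2 D W g2 -> exists f1 f2, [/\ SLdom f1, SLdom f2,
    {ae mu, forall x, D x -> L f1 x - a * f1 x + t * f2 x = g1 x},
    {ae mu, forall x, D x -> L f2 x - a * f2 x - t * f1 x = g2 x} &
    d * (wsqn D W f1 + wsqn D W f2) <= 4 * (wsqn D W g1 + wsqn D W g2)].
Proof.
move=> d0 dl l1 l2.
have q4 n : 0 < 4^-1 ^+ n :> R by rewrite exprn_gt0.
have [C1 C1P] := choice (fun n => e_dense l1 (q4 n)).
have [C2 C2P] := choice (fun n => e_dense l2 (q4 n)).
have dl0 k : (lam k - a) ^+ 2 + t ^+ 2 != 0 by rewrite gt_eqF// (lt_le_trans d0).
have [S SP] := choice (fun n => coef_sol_exists (C1 n) (C2 n) dl0).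
have [S' SP'] := choice SP.
have Cn C g : wL2 D W g -> (forall n, wsqn D W (g \- H (E (C n))) < 4^-1 ^+ n) -> forall n,
    wsqn D W (H (E (C n.+1 - C n))) <= 4 * 4^-1 ^+ n.
  move=> lg CP n; have h1 := wL2B mD mW W_gt0 lg (lh (E (C n))).
  have h2 := wL2B mD mW W_gt0 (lh (E (C n.+1))) lg.
  have -> : H (E (C n.+1 - C n)) = (H (E (C n.+1)) \- g) \+ (g \- H (E (C n))).
    by apply/funext => x; rewrite lincombB hornerD hornerN /=; ring.
  apply: le_trans (wsqnD_le mD mW W_gt0 h2 h1) _; rewrite wsqnBC.
  have := CP n; have := CP n.+1; rewrite exprS; have := q4 n.
  by move: (4^-1 ^+ n) => r; lra.
have Sn n : wsqn D W (H (E (S n.+1)) \- H (E (S n))) + wsqn D W (H (E (S' n.+1)) \- H (E (S' n)))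
    <= 8 / d * 4^-1 ^+ n.
  have := coef_sol_bound (ltW d0) dl (coef_solB (SP' n.+1) (SP' n)).
  have hE s s' : H (E (s - s')) = H (E s) \- H (E s').
    by apply/funext => x; rewrite lincombB hornerD hornerN.
  have := Cn _ _ l1 C1P n; have := Cn _ _ l2 C2P n; rewrite -!hE => h1 h2 h3.
  rewrite mulrAC ler_pdivlMr// mulrC (le_trans h3)//.
  by move: h1 h2; move: (4^-1 ^+ n) => r; lra.
have S1n n : wsqn D W (H (E (S n.+1)) \- H (E (S n))) <= 8 / d * 4^-1 ^+ n.
  by apply: le_trans (Sn n); rewrite lerDl (wsqn_ge0 W_gt0).
have S2n n : wsqn D W (H (E (S' n.+1)) \- H (E (S' n))) <= 8 / d * 4^-1 ^+ n.
  by apply: le_trans (Sn n); rewrite lerDr (wsqn_ge0 W_gt0).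
have [u [lu uS uae]] := wL2_complete mD mW W_gt0 (fun n => lh (E (S n))) S1n.
have [v [lv vS vae]] := wL2_complete mD mW W_gt0 (fun n => lh (E (S' n))) S2n.
have geo0 (M : R) : M * 4^-1 ^+ n @[n --> \oo] --> 0.
  rewrite -(mulr0 M); apply: cvgMr; apply: cvg_expr.
  by rewrite ger0_norm ?invr_ge0//; lra.
have sq0 f (P : nat -> R -> R) (M : R) : (forall n, wsqn D W (f \- P n) <= M * 4^-1 ^+ n) ->
    wsqn D W (f \- P n) @[n --> \oo] --> 0.
  move=> fP; apply: (@squeeze_cvgr _ _ _ _ (fun=> 0) (fun n => M * 4^-1 ^+ n)).
  - by apply: nearW => n; rewrite fP (wsqn_ge0 W_gt0).
  - exact: cvg_cst.
  - exact: geo0.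
have u0 := sq0 _ _ _ uS; have v0 := sq0 _ _ _ vS.
have g10 : wsqn D W (g1 \- H (E (C1 n))) @[n --> \oo] --> 0.
  by apply: (sq0 _ _ 1) => n; rewrite mul1r ltW.
have g20 : wsqn D W (g2 \- H (E (C2 n))) @[n --> \oo] --> 0.
  by apply: (sq0 _ _ 1) => n; rewrite mul1r ltW.
have lh1 : wL2 D W (fun x => g1 x + a * u x - t * v x).
  by apply: (wL2B mD mW W_gt0); [apply: (wL2D mD mW W_gt0)|]; [|exact: wL2Z..].
have lh2 : wL2 D W (fun x => g2 x + a * v x - - t * u x).
  by apply: (wL2B mD mW W_gt0); [apply: (wL2D mD mW W_gt0)|]; [|exact: wL2Z..].
have r1 := residual_cvg0 l1 lu lv (fun n x => @coef_sol_SL _ _ _ _ _ _ x (SP' n)) g10 u0 v0.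
have r2 := residual_cvg0 l2 lv lu
  (fun n x => @coef_sol_SL _ _ _ _ _ _ x (coef_solC (SP' n))) g20 v0 u0.
have [w1 [dw1 uw1 Lw1]] := SL_closed lu lh1 u0 r1 uae.
have [w2 [dw2 vw2 Lw2]] := SL_closed lv lh2 v0 r2 vae.
have F_ := ae_filter_ringOfSetsType mu.
exists w1, w2; split => //.
- apply: filterS2 (filterI uw1 vw2) Lw1 => x [e1 e2] e3 Dx.
  by rewrite e3// e1// e2//; ring.
- apply: filterS2 (filterI uw1 vw2) Lw2 => x [e1 e2] e3 Dx.
  by rewrite e3// e1// e2//; ring.
have [_ _ lw1 _ _] := dw1; have [_ _ lw2 _ _] := dw2.
rewrite -(ae_wsqn mD mW W_gt0 lu lw1 uw1) -(ae_wsqn mD mW W_gt0 lv lw2 vw2).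
apply/ler_addgt0Pr => eps e0.
have c0 : 2 * d * wsqn D W (u \- H (E (S n))) + 2 * d * wsqn D W (v \- H (E (S' n))) +
    (4 * wsqn D W (g1 \- H (E (C1 n))) + 4 * wsqn D W (g2 \- H (E (C2 n)))) @[n --> \oo] --> 0.
  rewrite -[X in _ --> X](_ : 2 * d * 0 + 2 * d * 0 + (4 * 0 + 4 * 0) = 0); last by ring.
  by apply: cvgD; apply: cvgD; apply: cvgMr; [exact: u0|exact: v0|exact: g10|exact: g20].
have /cvgr0Pnorm_le/(_ _ e0)[N _ HN] := c0.
have {}HN := le_trans (ler_norm _) (HN N (leqnn N)).
have tri f p' : wL2 D W f -> wsqn D W f <= 2 * (wsqn D W (f \- H p') + wsqn D W (H p')).
  move=> lf; have h := wL2B mD mW W_gt0 lf (lh p').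
  have := wsqnD_le mD mW W_gt0 h (lh p'); congr (_ <= _); congr wsqn.
  by apply/funext => x /=; rewrite subrK.
have tri' f p' : wL2 D W f -> wsqn D W (H p') <= 2 * (wsqn D W (f \- H p') + wsqn D W f).
  move=> lf; have h := wL2B mD mW W_gt0 (lh p') lf.
  have := wsqnD_le mD mW W_gt0 h lf; rewrite wsqnBC; congr (_ <= _); congr wsqn.
  by apply/funext => x /=; rewrite subrK.
have h1 := tri _ (E (S N)) lu; have h2 := tri _ (E (S' N)) lv.
have h3 := tri' _ (E (C1 N)) l1; have h4 := tri' _ (E (C2 N)) l2.
have h5 := coef_sol_bound (ltW d0) dl (SP' N).
have h6 : d * (wsqn D W u + wsqn D W v) <=
    2 * (d * (wsqn D W (u \- H (E (S N))) + wsqn D W (v \- H (E (S' N))))) +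
    2 * (d * (wsqn D W (H (E (S N))) + wsqn D W (H (E (S' N))))).
  rewrite -mulrDr -mulrDr mulrCA ler_pM2l//; lra.
move: HN h1 h2 h3 h4 h5 h6; rewrite -!mulrA => HN h1 h2 h3 h4 h5 h6.
have := mulrDr d (wsqn D W (u \- H (E (S N)))) (wsqn D W (v \- H (E (S' N)))).
lra.
Qed.

(** Orthogonality removes the cross term, so |u|^2 <= |u - s|^2 for every s in the span, and density
    makes the right-hand side arbitrarily small. *)
Lemma wsqn_ortho u : wL2 D W u -> (forall k, wdot D W u (H (e k)) = 0) ->
  {ae mu, forall x, D x -> u x = 0}.
Proof.
move=> lu u0; apply: (wsqn_eq0 mD mW W_gt0 lu); apply/eqP.
rewrite -[_ == _]/(wsqn D W u == 0) eq_le (wsqn_ge0 W_gt0) andbT.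
apply/ler_addgt0Pr => eps e0; rewrite add0r.
have [c] := e_dense lu e0; rewrite (wsqnB mD mW W_gt0)//.
rewrite {1}/lincomb wdot_lincomb// big1 ?mulr0 ?subr0; last by move=> k _; rewrite u0 mulr0.
have := wsqn_ge0 W_gt0 (H (E c)); lra.
Qed.

(** Pairing with e_k and moving the operator by Green's identity leaves a homogeneous 2 x 2 system
    for the k-th coefficients of u and v, with determinant |lam k - lambda|^2. *)
Lemma SL_eigen_ortho a t u v k : SLdom u -> SLdom v ->
  {ae mu, forall x, D x -> L u x - a * u x + t * v x = 0} ->
  {ae mu, forall x, D x -> L v x - a * v x - t * u x = 0} ->
  (lam k - a) ^+ 2 + t ^+ 2 != 0 ->
  wdot D W u (H (e k)) = 0 /\ wdot D W v (H (e k)) = 0.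
Proof.
move=> Su Sv; have [_ _ lu lLu _] := Su; have [_ _ lv lLv _] := Sv.
have F_ := ae_filter_ringOfSetsType mu.
have aux f (g h : R -> R) (r s : R) : wL2 D W f -> wL2 D W g -> wL2 D W h ->
    {ae mu, forall x, D x -> f x - r * g x + s * h x = 0} ->
    wdot D W f (H (e k)) = r * wdot D W g (H (e k)) - s * wdot D W h (H (e k)).
  move=> lf lg lh' ae0; have lgr := wL2Z mD r lg; have lhs := wL2Z mD (- s) lh'.
  have lgh := wL2D mD mW W_gt0 lgr lhs.
  have -> : r * wdot D W g (H (e k)) - s * wdot D W h (H (e k)) =
      wdot D W ((fun x => r * g x) \+ (fun x => - s * h x)) (H (e k)).
    by rewrite (wdotDl mD mW W_gt0)// !(wdotZl mD mW W_gt0)//; ring.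
  apply/eqP; rewrite -subr_eq0 -(wdotBl mD mW W_gt0)//; apply/eqP.
  have ld := wL2B mD mW W_gt0 lf lgh.
  have d0 : wsqn D W (f \- ((fun x => r * g x) \+ (fun x => - s * h x))) = 0.
    apply: (ae_eq_wsqn mD mW W_gt0 lf lgh); apply: filterS ae0 => x Hx Dx.
    by have := Hx Dx => /= /eqP; rewrite -addrA addr_eq0 => /eqP ->; ring.
  (* A function of zero norm pairs to zero: scaling it by an arbitrary M does not change the bound
     given by [wdot_le]. *)
  have key (M : R) : 2 * `|M * wdot D W (f \- ((fun x => r * g x) \+ (fun x => - s * h x))) (H (e k))| <=
      wsqn D W (H (e k)).
    rewrite -(wdotZl mD mW W_gt0)//.
    apply: le_trans (wdot_le mD mW W_gt0 (wL2Z mD M ld) (lh (e k))) _.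
    by rewrite (wsqnZ mD mW W_gt0)// d0 mulr0 add0r.
  set z := wdot _ _ _ _ in key *; apply/eqP; apply: contraT => z0.
  have := key ((wsqn D W (H (e k)) + 1) / z); rewrite divfK//.
  have := wsqn_ge0 W_gt0 (H (e k)); move: (wsqn _ _ _) => y y0.
  by rewrite ger0_norm; lra.
move=> ae1 ae2 dl.
have := aux _ _ _ a t lLu lu lv ae1; have := aux _ _ _ a (- t) lLv lv lu.
rewrite !wdot_eigen// => /(_ _)/wrap[].
  by apply: filterS ae2 => x Hx Dx; rewrite mulNr Hx.
move: (wdot _ _ u _) (wdot _ _ v _) => x y h2 h1.
have e1 : ((lam k - a) ^+ 2 + t ^+ 2) * x = 0.
  have -> : ((lam k - a) ^+ 2 + t ^+ 2) * x = (lam k - a) * (lam k * x - (a * x - t * y))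
     - t * (lam k * y - (a * y - - t * x)) by ring.
  by rewrite h1 h2 !subrr; ring.
have e2 : ((lam k - a) ^+ 2 + t ^+ 2) * y = 0.
  have -> : ((lam k - a) ^+ 2 + t ^+ 2) * y = (lam k - a) * (lam k * y - (a * y - - t * x))
     + t * (lam k * x - (a * x - t * y)) by ring.
  by rewrite h1 h2 !subrr; ring.
by move/eqP: e1; move/eqP: e2; rewrite !mulf_eq0 (negbTE dl) /= => /eqP -> /eqP ->.
Qed.

Lemma SL_inj a t u v : SLdom u -> SLdom v ->
  {ae mu, forall x, D x -> L u x - a * u x + t * v x = 0} ->
  {ae mu, forall x, D x -> L v x - a * v x - t * u x = 0} ->
  (forall k, (lam k - a) ^+ 2 + t ^+ 2 != 0) ->
  {ae mu, forall x, D x -> u x = 0} /\ {ae mu, forall x, D x -> v x = 0}.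
Proof.
move=> Su Sv au av dl; have [_ _ lu _ _] := Su; have [_ _ lv _ _] := Sv.
by split; apply: wsqn_ortho => // k; have [] := SL_eigen_ortho Su Sv au av (dl k).
Qed.

(** The system is solved anew with the right-hand sides produced by u and v. By injectivity the
    solution coincides with (u, v) almost everywhere, and it carries the bound of [SL_surj]. *)
Lemma SL_bound a t d u v : 0 < d -> (forall k, d <= (lam k - a) ^+ 2 + t ^+ 2) ->
  SLdom u -> SLdom v ->
  d * (wsqn D W u + wsqn D W v) <=
    4 * (wsqn D W (fun x => L u x - a * u x + t * v x) +
         wsqn D W (fun x => L v x - a * v x - t * u x)).
Proof.
move=> d0 dl Su Sv; have [_ _ lu lLu _] := Su; have [_ _ lv lLv _] := Sv.
have F_ := ae_filter_ringOfSetsType mu.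
have lg1 : wL2 D W (fun x => L u x - a * u x + t * v x).
  by apply: (wL2D mD mW W_gt0); [apply: (wL2B mD mW W_gt0)|]; [|exact: wL2Z..].
have lg2 : wL2 D W (fun x => L v x - a * v x - t * u x).
  by apply: (wL2B mD mW W_gt0); [apply: (wL2B mD mW W_gt0)|]; [|exact: wL2Z..].
have [f1 [f2 [S1 S2 ae1 ae2 bd]]] := SL_surj d0 dl lg1 lg2.
have [_ _ lf1 _ _] := S1; have [_ _ lf2 _ _] := S2.
have dl0 k : (lam k - a) ^+ 2 + t ^+ 2 != 0 by rewrite gt_eqF// (lt_le_trans d0).
have B1 := ae_SLB Su S1; have B2 := ae_SLB Sv S2.
have [||z1 z2] := SL_inj (SLdomB Su S1) (SLdomB Sv S2) _ _ dl0.
- apply: filterS2 ae1 B1 => x h1 h2 Dx; rewrite h2//= -[RHS](subrr (L f1 x - a * f1 x + t * f2 x)).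
  by rewrite {1}h1//; ring.
- apply: filterS2 ae2 B2 => x h1 h2 Dx; rewrite h2//= -[RHS](subrr (L f2 x - a * f2 x - t * f1 x)).
  by rewrite {1}h1//; ring.
rewrite (ae_wsqn mD mW W_gt0 lu lf1) ?(ae_wsqn mD mW W_gt0 lv lf2)//.
  by apply: filterS z2 => x h Dx; apply/eqP; rewrite -subr_eq0; apply/eqP; exact: h.
by apply: filterS z1 => x h Dx; apply/eqP; rewrite -subr_eq0; apply/eqP; exact: h.
Qed.

Lemma horner_ae_neq0 p' : p' != 0 -> ~ {ae mu, forall x, D x -> p'.[x] = 0}.
Proof.
move=> p0 ae0; move/eqP: p0; apply; apply: eq_poly_Ioo11 => x x11; rewrite horner0.
apply/eqP; apply: contraT => px.
have cp : H p' t @[t --> x] --> p'.[x] by exact: continuous_horner.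
have npx := cvgr_neq0 (F := nbhs x) _ cp px.
have [d /= d0 Hd] := npx.
have xm : x < Num.min (x + d) 1 by rewrite lt_min ltrDl d0; case/andP: x11.
have [|t /andP[xt]] := ae_itv_exists (P := fun t => p'.[t] = 0) xm; last first.
  rewrite lt_min => /andP[td t1] pt.
  suff /Hd : ball_ Num.norm x d t by rewrite pt eqxx.
  by rewrite /ball_/= ltr_norml; apply/andP; split; lra.
apply: filterS ae0; first exact: (ae_filter_ringOfSetsType mu).
move=> t pt /andP[xt]; rewrite lt_min => /andP[_ t1]; apply: pt; rewrite Ioo11E t1 andbT.
by case/andP: x11 => x1 _; exact: lt_trans xt.
Qed.

(** Subtracting the projection onto e_n leaves a function orthogonal to every e_k. *)
Lemma SL_simple n u : SLdom u ->
  {ae mu, forall x, D x -> L u x = lam n * u x} ->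
  exists r : R, {ae mu, forall x, D x -> u x = r * (e n).[x]}.
Proof.
move=> Su ae1; have [_ _ lu _ _] := Su.
have F_ := ae_filter_ringOfSetsType mu.
have en0 : wsqn D W (H (e n)) != 0.
  by apply/eqP => /(wsqn_eq0 mD mW W_gt0 (lh _)); exact: horner_ae_neq0.
pose r := wdot D W u (H (e n)) / wsqn D W (H (e n)); exists r.
have lr := wL2Z mD r (lh (e n)); have lz := wL2B mD mW W_gt0 lu lr.
have := wsqn_ortho lz; rewrite -/(wsqn _ _ _) => z0.
suff {z0} /z0 : forall k, wdot D W (u \- (fun x => r * H (e n) x)) (H (e k)) = 0.
  by apply: filterS => x Hx Dx; apply/eqP; rewrite -subr_eq0; apply/eqP; exact: Hx.
move=> k; rewrite (wdotBl mD mW W_gt0)// (wdotZl mD mW W_gt0)//.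
have [->|kn] := eqVneq k n; first by rewrite -/(wsqn _ _ _) divfK// subrr.
(* With t = 0 the two equations decouple, so [u] can be its own partner in the coupled system. *)
have aeu : {ae mu, forall x, D x -> L u x - lam n * u x + 0 * u x = 0}.
  by apply: filterS ae1 => x Hx Dx; rewrite Hx// mul0r addr0 subrr.
have aeu' : {ae mu, forall x, D x -> L u x - lam n * u x - 0 * u x = 0}.
  by apply: filterS ae1 => x Hx Dx; rewrite Hx// mul0r subr0 subrr.
have [|-> _] := SL_eigen_ortho (k := k) Su Su aeu aeu'.
  rewrite expr0n /= addr0 sqrf_eq0 subr_eq0; apply: contra_neq kn; exact: lam_inj.
by rewrite wdot_ortho 1?eq_sym// mulr0 subrr.
Qed.

End SturmLiouville.

(** * The exceptional Jacobi weight *)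

Section NonnegativeDerivative.
Context {R : realType}.
Notation mu := (@lebesgue_measure R).
Notation D := (Ioo11 R).
Variables (G g : R -> R) (M : R).
Hypothesis dG : forall x, D x -> is_derive x (1:R) G (g x).
Hypothesis cg : forall x, D x -> {for x, continuous g}.
Hypothesis g_ge0 : forall x, D x -> 0 <= g x.
Hypothesis G_le : forall x, D x -> `|G x| <= M.

Let mD' : measurable (D : set (measurableTypeR R)). Proof. exact: measurable_itv. Qed.

(** Monotone convergence over compact subintervals, on each of which the integral is an increment of
    [G], hence at most 2 M. *)
Lemma ge0_derive_integrable : mu.-integrable D (EFin \o g).
Proof.
have mg : measurable_fun D g by exact: continuous_Ioo11_measurable.
pose a n : R := -1 + n.+2%:R^-1; pose b n : R := 1 - n.+2%:R^-1.
have n2 n : 0 < n.+2%:R^-1 :> R by rewrite invr_gt0.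
have n2' n : n.+2%:R^-1 <= 2^-1 :> R by rewrite lef_pV2 ?posrE// ler_nat.
have Da n : D (a n).
  by rewrite Ioo11E /a; have := n2 n; have := n2' n; move: (_^-1) => r; lra.
have Db n : D (b n).
  by rewrite Ioo11E /b; have := n2 n; have := n2' n; move: (_^-1) => r; lra.
have ab n : a n <= b n.
  by rewrite /a /b; have := n2 n; have := n2' n; move: (_^-1) => r; lra.
have sub n x : `[a n, b n]%classic x -> D x.
  rewrite /= in_itv/= => /andP[ax xb]; have := Da n; have := Db n; rewrite !Ioo11E; lra.
have acG : rAC_loc G.
  by apply: (@C1_rAC_loc _ _ g) => x; rewrite -Ioo11E => Dx; (exact: cg || exact: dG).
have bigD : D = \bigcup_n `[a n, b n]%classic.
  apply/seteqP; split => [x|x [n _]]; last exact: sub.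
  rewrite Ioo11E => /andP[x1 x2].
  pose r := Num.min (x + 1) (1 - x); have r0 : 0 < r by rewrite lt_min; lra.
  have [n _ Hn] := near_infty_natSinv_lt (PosNum r0); exists n => //=.
  have := Hn n (leqnn _); rewrite /= lt_min in_itv/= /a /b.
  have : n.+2%:R^-1 <= n.+1%:R^-1 :> R by rewrite lef_pV2 ?posrE// ler_nat.
  by move: (n.+1%:R^-1) (n.+2%:R^-1) => s t st /andP[h1 h2]; lra.
apply/integrableP; split; first exact/measurable_EFinP.
have -> : (\int[mu]_(x in D) `|(EFin \o g) x| = \int[mu]_(x in D) (g x)%:E)%E.
  by apply: eq_integral => x; rewrite inE => Dx; rewrite /= ger0_norm// g_ge0.
apply: (@le_lt_trans _ _ (2 * M)%:E); last exact: ltry.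
rewrite bigD; have c : (\int[mu]_(x in `[a n, b n]%classic) (g x)%:E)%E @[n --> \oo] -->
    (\int[mu]_(x in \bigcup_n `[a n, b n]%classic) (g x)%:E)%E.
  apply: ge0_nondecreasing_set_cvg_integral => //.
  - move=> i j ij; rewrite subsetEset; apply: subset_itv; rewrite bnd_simp /a /b.
      by rewrite lerD2l lef_pV2 ?posrE// ler_nat.
    by rewrite lerD2l lerN2 lef_pV2 ?posrE// ler_nat.
  - by move=> n; apply/measurable_EFinP; apply: measurable_funS mg => //; exact: sub.
  - by move=> n x /sub Dx; rewrite lee_fin g_ge0.
apply: cvge_le c; apply: nearW => n.
have [|||ig Ig] := @rAC_integral _ (a n) (b n) G g (ab n).
- by apply: acG => //; [have := Da n|have := Db n]; rewrite Ioo11E => /andP[].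
- by apply: measurable_funS mg => //; exact: sub.
- apply: aeW => x /andP[ax xb] _; have Dx : D x by apply: (sub n); rewrite /= in_itv/= !ltW.
  by have := dG Dx => dGx; rewrite derive1E derive_val.
have -> : (\int[mu]_(x in `[a n, b n]) (g x)%:E = (\int[mu]_(x in `[a n, b n]) g x)%:E)%E.
  by rewrite /Rintegral fineK//; apply: integrable_fin_num.
rewrite -Ig lee_fin; have := G_le (Da n); have := G_le (Db n).
by rewrite !ler_norml; lra.
Qed.

End NonnegativeDerivative.

(** * Jacobi weights divided by the square of a zero-free polynomial *)

Section JacobiWeight.
Context {R : realType}.
Notation mu := (@lebesgue_measure R).
Notation D := (Ioo11 R).
Variables (al be c0 : R) (h : {poly R}).
Hypothesis al_gt : -1 < al.
Hypothesis be_gt : -1 < be.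
Hypothesis h_neq0 : forall x, -1 <= x <= 1 -> h.[x] != 0.

Definition jweight x : R := (1 - x) `^ al * (1 + x) `^ be / h.[x] ^+ 2.
Definition jcoef1 x : R :=
  be - al - (be + al + 2) * x - 2 * (1 - x ^+ 2) * (h^`().[x] / h.[x]).
Definition jcoef0 x : R := c0 - 2 * be * (1 - x) * (h^`().[x] / h.[x]).

Notation W := jweight.
Notation b := jcoef1.
Notation q := jcoef0.
Notation p := (SLp W).

Let Dcc x : D x -> -1 <= x <= 1. Proof. by rewrite Ioo11E; lra. Qed.

Let h0 x : D x -> h.[x] != 0. Proof. by move=> /Dcc/h_neq0. Qed.

Let x1_gt0 x : D x -> 0 < 1 - x. Proof. by rewrite Ioo11E; lra. Qed.
Let x2_gt0 x : D x -> 0 < 1 + x. Proof. by rewrite Ioo11E; lra. Qed.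

Lemma jweight_gt0 x : D x -> 0 < W x.
Proof.
move=> Dx; rewrite /jweight divr_gt0//.
  by rewrite mulr_gt0// powR_gt0 ?x1_gt0 ?x2_gt0.
by rewrite exprn_even_gt0//= h0.
Qed.

Lemma is_derive_powR_1B (a : R) x : D x ->
  is_derive x (1:R) (fun t => (1 - t) `^ a) (- (a * (1 - x) `^ (a - 1))).
Proof.
move=> Dx; have d1 : is_derive x (1:R) (fun t : R => 1 - t) (-1).
  have H := is_deriveB (is_derive_cst (1:R) x (1:R)) (is_derive_id x (1:R)).
  by apply: (is_derive_eq H); rewrite sub0r.
have d2 := is_derive1_powR a (x1_gt0 Dx).
have := @is_derive1_comp _ (@powR R ^~ a) (fun t => 1 - t) x _ _ d2 d1.
by rewrite mulrN1.
Qed.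

Lemma is_derive_powR_1D (a : R) x : D x ->
  is_derive x (1:R) (fun t => (1 + t) `^ a) (a * (1 + x) `^ (a - 1)).
Proof.
move=> Dx; have d1 : is_derive x (1:R) (fun t : R => 1 + t) 1.
  have H := is_deriveD (is_derive_cst (1:R) x (1:R)) (is_derive_id x (1:R)).
  by apply: (is_derive_eq H); rewrite add0r.
have d2 := is_derive1_powR a (x2_gt0 Dx).
have := @is_derive1_comp _ (@powR R ^~ a) (fun t => 1 + t) x _ _ d2 d1.
by rewrite mulr1.
Qed.

Let powRB1 (a t : R) : 0 < t -> t `^ (a - 1) = t `^ a / t.
Proof.
move=> t0; have h1 : (a == 1) ==> (t != 0) by rewrite (gt_eqF t0) implybT.
by rewrite powRB// powRr1// ltW.
Qed.

Let powRD1 (a t : R) : 0 < t -> t `^ (a + 1) = t `^ a * t.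
Proof.
move=> t0; have h1 : (a + 1 == 0) ==> (t != 0) by rewrite (gt_eqF t0) implybT.
by rewrite powRD// powRr1// ltW.
Qed.

Lemma is_derive_jweight x : D x -> is_derive x (1:R) W
  (W x * (- al / (1 - x) + be / (1 + x) - 2 * (h^`().[x] / h.[x]))).
Proof.
move=> Dx; have d1 := is_derive_powR_1B al Dx; have d2 := is_derive_powR_1D be Dx.
have d3 : is_derive x (1:R) (horner h) (h^`().[x]) by exact: is_derive_poly.
have d4 := is_deriveM d3 d3.
have hh : (horner h * horner h) x != 0 by rewrite mulf_neq0 ?h0.
have := is_deriveV hh => /(_ _ _ d4) d5.
have d6 := is_deriveM (is_deriveM d1 d2) d5.
have E : W = (fun t => (1 - t) `^ al) * (fun t => (1 + t) `^ be) *
    (fun t => ((horner h * horner h) t)^-1).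
  by apply/funext => t; rewrite /jweight expr2.
rewrite [X in is_derive _ _ X _]E; apply: is_derive_eq; rewrite /jweight /GRing.scale /=.
rewrite !powRB1 ?x1_gt0 ?x2_gt0//.
have := h0 Dx; have := lt0r_neq0 (x1_gt0 Dx); have := lt0r_neq0 (x2_gt0 Dx).
move=> n1 n2 n3; rewrite !mulrfctE; field.
by rewrite n1 n2 n3.
Qed.

(** This is formal symmetry: (p u')' / W has exactly the second- and first-order coefficients of the
    differential expression. *)
Lemma is_derive_jp x : D x -> is_derive x (1:R) p (W x * b x).
Proof.
move=> Dx; have d1 := is_derive_jweight Dx.
have d0 : is_derive x (1:R) (horner (1 - 'X^2)) ((1 - 'X^2 : {poly R})^`().[x]) by exact: is_derive_poly.
have d2 := is_deriveM d0 d1.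
have E : p = horner (1 - 'X^2) * W.
  by apply/funext => t; rewrite /SLp mulrfctE hornerD hornerN hornerXn hornerC.
rewrite [X in is_derive _ _ X _]E; apply: is_derive_eq.
have -> : (1 - 'X^2 : {poly R})^`().[x] = - (2 * x).
  by rewrite derivB derivXn -polyC1 derivC sub0r hornerN hornerMn hornerX mulr_natl.
rewrite /GRing.scale /= /jcoef1 hornerD hornerN hornerXn hornerC.
have := h0 Dx; have := lt0r_neq0 (x1_gt0 Dx); have := lt0r_neq0 (x2_gt0 Dx).
move=> n1 n2 n3; field; rewrite n1 n2 n3 //.
Qed.

Lemma h_le : exists m M : R, [/\ 0 < m, 0 < M & forall x, -1 <= x <= 1 ->
  [/\ m <= h.[x] ^+ 2, h.[x] ^+ 2 <= M & `|h^`().[x] / h.[x]| <= M]].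
Proof.
have n11 : (-1 : R) <= 1 by lra.
have cE e : {within `[-1, 1 : R]%classic, continuous (horner e)}.
  by apply: continuous_in_subspaceT => x _; exact: continuous_horner.
have [x1 x1P min1] := EVT_min n11 (cE (h ^+ 2)).
have [x2 x2P max2] := EVT_max n11 (cE (h ^+ 2)).
have cq : {within `[-1, 1 : R]%classic, continuous (fun x => `|h^`().[x] / h.[x]|)}.
  apply: continuous_in_subspaceT => x; rewrite inE/= in_itv/= => x11.
  apply: cvg_norm; apply: cvgM; first exact: continuous_horner.
  by apply: cvgV; [exact: h_neq0|exact: continuous_horner].
have [x3 x3P max3] := EVT_max n11 cq.
exists ((h ^+ 2).[x1]), ((h ^+ 2).[x2] + `|h^`().[x3] / h.[x3]|).
have pos x : -1 <= x <= 1 -> 0 < (h ^+ 2).[x].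
  by move=> x11; rewrite horner_exp exprn_even_gt0//= h_neq0.
rewrite in_itv/= in x1P; rewrite in_itv/= in x2P.
split; [exact: pos|by rewrite ltr_wpDr// pos|] => x x11; rewrite -horner_exp.
split; first by apply: min1; rewrite in_itv.
  by rewrite (le_trans (max2 x _)) ?in_itv// lerDl.
by rewrite (le_trans (max3 x _)) ?in_itv// lerDr ltW// pos.
Qed.

Let cW x : D x -> {for x, continuous W}.
Proof.
move=> /is_derive_jweight [dx _]; apply: differentiable_continuous.
by rewrite -derivable1_diffP.
Qed.

Let cpoly (e : {poly R}) x : {for x, continuous (horner e)}.
Proof. exact: continuous_horner. Qed.

Let cquot x : D x -> {for x, continuous (fun t => h^`().[t] / h.[t])}.
Proof. by move=> Dx; apply: cvgM; [exact: cpoly|apply: cvgV; [exact: h0|exact: cpoly]]. Qed.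

Let cb x : D x -> {for x, continuous b}.
Proof.
move=> Dx; have -> : b = (fun t => ((be - al)%:P - (be + al + 2) *: 'X).[t] +
   ((- 2) *: (1 - 'X^2)).[t] * (h^`().[t] / h.[t])).
  apply/funext => t; rewrite /jcoef1 hornerD hornerN !hornerZ hornerD hornerN.
  by rewrite hornerXn !hornerC hornerX; ring.
by apply: cvgD; [exact: cpoly|apply: cvgM; [exact: cpoly|exact: cquot]].
Qed.

Let cq x : D x -> {for x, continuous q}.
Proof.
move=> Dx; have -> : q = (fun t => c0%:P.[t] +
   ((- 2 * be) *: (1 - 'X)).[t] * (h^`().[t] / h.[t])).
  apply/funext => t; rewrite /jcoef0 hornerZ hornerD hornerN.
  by rewrite !hornerC hornerX; ring.
by apply: cvgD; [exact: cpoly|apply: cvgM; [exact: cpoly|exact: cquot]].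
Qed.

Let bounded_bq : exists M : R, forall x, D x -> `|b x| <= M /\ `|q x| <= M.
Proof.
have [m [M [m0 M0 H]]] := h_le.
pose N := `|be - al| + `|be + al + 2| + 2 * M + `|c0| + 4 * `|be| * M.
have N1 : 0 <= `|c0| by []. have N2 : 0 <= 4 * `|be| * M by rewrite !mulr_ge0// ltW.
have N3 : 0 <= `|be - al| by []. have N4 : 0 <= `|be + al + 2| by [].
exists N => x Dx; have [_ _ hM] := H x (Dcc Dx).
have x1 : `|x| <= 1 by rewrite ler_norml; exact: Dcc.
have xx : `|1 - x ^+ 2| <= 1.
  by rewrite ler_norml; have := sqr_ge0 x; move: x1; rewrite ler_norml => /andP[]; nra.
have x2 : `|1 - x| <= 2 by rewrite ler_norml; move: Dx; rewrite Ioo11E; lra.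
split; rewrite /jcoef1 /jcoef0.
  apply: (@le_trans _ _ (`|be - al| + `|be + al + 2| + 2 * M)); last first.
    by rewrite /N; move: N1 N2; lra.
  apply: le_trans (ler_normB _ _) _; apply: lerD.
    apply: le_trans (ler_normB _ _) _; rewrite lerD2l normrM.
    by rewrite ler_piMr.
  rewrite normrM [`|2 * _|]normrM [`|2|]ger0_norm// -mulrA ler_pM2l//.
  by rewrite -[leRHS]mul1r ler_pM.
apply: (@le_trans _ _ (`|c0| + 4 * `|be| * M)).
  apply: le_trans (ler_normB _ _) _; rewrite lerD2l normrM ler_pM//.
  rewrite !normrM [`|2|]ger0_norm// (_ : 4 * `|be| = 2 * `|be| * 2); last by ring.
  by rewrite ler_wpM2l// mulr_ge0.
by rewrite /N; move: N1 N2 N3 N4; lra.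
Qed.

Lemma jpE x : D x -> p x = (1 - x) `^ (al + 1) * (1 + x) `^ (be + 1) / h.[x] ^+ 2.
Proof.
move=> Dx; have n1 := x1_gt0 Dx; have n2 := x2_gt0 Dx.
rewrite /SLp /jweight !powRD1//.
by field; rewrite h0.
Qed.

Let al1 : 0 < al + 1. Proof. by rewrite -ltrBlDr sub0r. Qed.
Let be1 : 0 < be + 1. Proof. by rewrite -ltrBlDr sub0r. Qed.

Let powR_mono (a s t : R) : 0 < a -> 0 < s -> s <= t -> s `^ a <= t `^ a.
Proof.
by move=> a0 s0 st; apply: (ge0_ler_powR (ltW a0)) => //; rewrite nnegrE ltW// (lt_le_trans s0).
Qed.

(** h^2 lies between positive constants on [-1, 1]. The power belonging to the opposite endpoint is
    bounded by a power of 2 throughout and is at least 1 on the half of the interval adjacent to the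
    endpoint considered. *)
Lemma jp_equiv : exists k K : R, [/\ 0 < k, 0 < K,
  (forall x, D x -> 0 <= x -> k * (1 - x) `^ (al + 1) <= p x) /\
  (forall x, D x -> p x <= K * (1 - x) `^ (al + 1)) &
  (forall x, D x -> x <= 0 -> k * (1 + x) `^ (be + 1) <= p x) /\
  (forall x, D x -> p x <= K * (1 + x) `^ (be + 1))].
Proof.
have [m [M [m0 M0 H]]] := h_le.
pose A := (2 : R) `^ (al + 1); pose B := (2 : R) `^ (be + 1).
have A0 : 0 < A by apply: powR_gt0.
have B0 : 0 < B by apply: powR_gt0.
have one (a : R) : (1 : R) `^ a = 1 by rewrite powR1.
exists M^-1, (Num.max A B / m); split.
- by rewrite invr_gt0.
- by rewrite divr_gt0// lt_max A0.
- split; last first.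
  move=> x Dx; rewrite jpE//; have [h1 _ _] := H x (Dcc Dx).
  have h3 : 0 < h.[x] ^+ 2 by rewrite exprn_even_gt0//= h0.
  have hm : (h.[x] ^+ 2)^-1 <= m^-1 by rewrite lef_pV2 ?posrE.
  rewrite -mulrA [leRHS]mulrC ler_wpM2l ?powR_ge0//.
  apply: ler_pM => //; [exact: powR_ge0|by rewrite invr_ge0 ltW|].
  rewrite le_max; apply/orP; right; apply: powR_mono => //; first exact: x2_gt0.
  by move: Dx; rewrite Ioo11E; lra.
  move=> x Dx x0; rewrite jpE//; have [_ h2 _] := H x (Dcc Dx).
  have h3 : 0 < h.[x] ^+ 2 by rewrite exprn_even_gt0//= h0.
  rewrite mulrC; apply: ler_pM; [exact: powR_ge0|by rewrite invr_ge0 ltW| |by rewrite lef_pV2 ?posrE].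
  by rewrite ler_peMr ?powR_ge0// -[leLHS](one (be + 1)); apply: powR_mono => //; lra.
- split; last first.
  move=> x Dx; rewrite jpE//; have [h1 _ _] := H x (Dcc Dx).
  have h3 : 0 < h.[x] ^+ 2 by rewrite exprn_even_gt0//= h0.
  have hm : (h.[x] ^+ 2)^-1 <= m^-1 by rewrite lef_pV2 ?posrE.
  rewrite [_ `^ _ * _]mulrC -mulrA [leRHS]mulrC ler_wpM2l ?powR_ge0//.
  apply: ler_pM => //; [exact: powR_ge0|by rewrite invr_ge0 ltW|].
  rewrite le_max; apply/orP; left; apply: powR_mono => //; first exact: x1_gt0.
  by move: Dx; rewrite Ioo11E; lra.
  move=> x Dx x0; rewrite jpE//; have [_ h2 _] := H x (Dcc Dx).
  have h3 : 0 < h.[x] ^+ 2 by rewrite exprn_even_gt0//= h0.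
  rewrite mulrC; apply: ler_pM; [exact: powR_ge0|by rewrite invr_ge0 ltW| |by rewrite lef_pV2 ?posrE].
  by rewrite ler_peMl ?powR_ge0// -[leLHS](one (al + 1)); apply: powR_mono => //; lra.
Qed.

Lemma powR_1B_cvg0 (a : R) : 0 < a -> (1 - x) `^ a @[x --> (1 : R)^'-] --> 0.
Proof.
move=> a0; apply/cvgr0Pnorm_le => eps e0.
have /cvgr0Pnorm_le/(_ _ e0)[d /= d0 Hd] := powR_cvg0 a0.
near=> x; have x1 : x < 1 by near: x; exact: nbhs_left_lt.
have xd : 1 - d < x by near: x; apply: nbhs_left_gt; lra.
by apply: Hd; rewrite /= ?sub0r ?normrN ?ger0_norm; lra.
Unshelve. all: by end_near. Qed.

Lemma powR_1D_cvg0 (a : R) : 0 < a -> (1 + x) `^ a @[x --> (-1 : R)^'+] --> 0.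
Proof.
move=> a0; apply/cvgr0Pnorm_le => eps e0.
have /cvgr0Pnorm_le/(_ _ e0)[d /= d0 Hd] := powR_cvg0 a0.
near=> x; have x1 : -1 < x by near: x; exact: nbhs_right_gt.
have xd : x < -1 + d by near: x; apply: nbhs_right_lt; lra.
by apply: Hd; rewrite /= ?sub0r ?normrN ?ger0_norm; lra.
Unshelve. all: by end_near. Qed.

Let p_cvg1 : p x @[x --> (1 : R)^'-] --> 0.
Proof.
have [k [K [k0 K0 [_ pK] _]]] := jp_equiv.
apply: (@squeeze_cvgr _ _ _ _ (fun=> 0) (fun x => K * (1 - x) `^ (al + 1))).
- apply: filterS near_left1_Ioo11 => x Dx; rewrite pK// andbT ltW// mulr_gt0 ?jweight_gt0//.
  by move: Dx; rewrite Ioo11E => /andP[] *; nra.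
- exact: cvg_cst.
- by rewrite -(mulr0 K); apply: cvgMr; exact: powR_1B_cvg0.
Qed.

Let p_cvgN1 : p x @[x --> (-1 : R)^'+] --> 0.
Proof.
have [k [K [k0 K0 _ [_ pK]]]] := jp_equiv.
apply: (@squeeze_cvgr _ _ _ _ (fun=> 0) (fun x => K * (1 + x) `^ (be + 1))).
- apply: filterS near_rightN1_Ioo11 => x Dx; rewrite pK// andbT ltW// mulr_gt0 ?jweight_gt0//.
  by move: Dx; rewrite Ioo11E => /andP[] *; nra.
- exact: cvg_cst.
- by rewrite -(mulr0 K); apply: cvgMr; exact: powR_1D_cvg0.
Qed.

Let p_mono : exists K : R, [/\ 0 <= K,
    forall s x, 0 <= s -> s <= x -> x < 1 -> p x <= K * p s &
    forall s x, -1 < x -> x <= s -> s <= 0 -> p x <= K * p s].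
Proof.
have [k [K [k0 K0 [p1 p2] [p3 p4]]]] := jp_equiv.
exists (K / k); split; first by rewrite divr_ge0 ?ltW.
- move=> s x s0 sx x1; have Dx : D x by rewrite Ioo11E; lra.
  have Ds : D s by rewrite Ioo11E; lra.
  apply: (le_trans (p2 x Dx)); rewrite -mulrA ler_pM2l// mulrC ler_pdivlMr// mulrC.
  apply: le_trans (p1 s Ds s0); rewrite ler_pM2l//; apply: powR_mono => //; first exact: x1_gt0.
  by rewrite lerD2l lerN2.
- move=> s x x1 xs s0; have Dx : D x by rewrite Ioo11E; lra.
  have Ds : D s by rewrite Ioo11E; lra.
  apply: (le_trans (p4 x Dx)); rewrite -mulrA ler_pM2l// mulrC ler_pdivlMr// mulrC.
  apply: le_trans (p3 s Ds s0); rewrite ler_pM2l//; apply: powR_mono => //; first exact: x2_gt0.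
  by rewrite lerD2l.
Qed.

Let int_1B : mu.-integrable D (EFin \o (fun x => (1 - x) `^ al)).
Proof.
have dG x : D x -> is_derive x (1:R) (fun t => - (al + 1)^-1 * (1 - t) `^ (al + 1)) ((1 - x) `^ al).
  move=> Dx; have d1 := is_derive_powR_1B (al + 1) Dx.
  have := is_deriveM (is_derive_cst (- (al + 1)^-1) x (1:R)) d1 => H.
  apply: (is_derive_eq H); rewrite /GRing.scale /= addrK mulr0 addr0.
  by field; rewrite gt_eqF.
apply: (@ge0_derive_integrable R _ _ (((al + 1)^-1) * 2 `^ (al + 1)) dG).
- move=> x /(is_derive_powR_1B al) [dx _]; apply: differentiable_continuous.
  by rewrite -derivable1_diffP.
- by move=> x _; exact: powR_ge0.
- move=> x Dx; rewrite normrM normrN !ger0_norm ?invr_ge0 ?powR_ge0 ?(ltW al1)//.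
  rewrite ler_wpM2l ?invr_ge0 ?(ltW al1)//; apply: powR_mono => //; first exact: x1_gt0.
  by move: Dx; rewrite Ioo11E; lra.
Qed.

Let int_1D : mu.-integrable D (EFin \o (fun x => (1 + x) `^ be)).
Proof.
have dG x : D x -> is_derive x (1:R) (fun t => (be + 1)^-1 * (1 + t) `^ (be + 1)) ((1 + x) `^ be).
  move=> Dx; have d1 := is_derive_powR_1D (be + 1) Dx.
  have := is_deriveM (is_derive_cst ((be + 1)^-1) x (1:R)) d1 => H.
  apply: (is_derive_eq H); rewrite /GRing.scale /= addrK mulr0 addr0.
  by field; rewrite gt_eqF.
apply: (@ge0_derive_integrable R _ _ (((be + 1)^-1) * 2 `^ (be + 1)) dG).
- move=> x /(is_derive_powR_1D be) [dx _]; apply: differentiable_continuous.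
  by rewrite -derivable1_diffP.
- by move=> x _; exact: powR_ge0.
- move=> x Dx; rewrite normrM !ger0_norm ?invr_ge0 ?powR_ge0 ?(ltW be1)//.
  rewrite ler_wpM2l ?invr_ge0 ?(ltW be1)//; apply: powR_mono => //; first exact: x2_gt0.
  by move: Dx; rewrite Ioo11E; lra.
Qed.

Let powR_le2 (a t : R) : 1 <= t -> t <= 2 -> t `^ a <= 2 `^ `|a|.
Proof.
move=> t1 t2; apply: (@le_trans _ _ (t `^ `|a|)); first by apply: ler_powR => //; exact: ler_norm.
by apply: ge0_ler_powR => //; rewrite nnegrE; lra.
Qed.

Let mD' : measurable (D : set (measurableTypeR R)). Proof. exact: measurable_itv. Qed.

(** On each half of the interval one of the two powers has its base between 1 and 2, hence is
    bounded, and the weight is dominated by a multiple of the sum of the two powers. *)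
Lemma jweight_integrable : mu.-integrable D (EFin \o W).
Proof.
have [m [M [m0 M0 H]]] := h_le.
pose c := m^-1 * (2 `^ `|al| + 2 `^ `|be|).
have c_ge0 : 0 <= 2 `^ `|al| + 2 `^ `|be| :> R by rewrite addr_ge0 ?powR_ge0.
have i1 := integrableZl mD' c (integrableD mD' int_1B int_1D).
apply: le_integrable i1 => //.
  by apply/measurable_EFinP; exact: continuous_Ioo11_measurable.
move=> x Dx; have [h1 _ _] := H x (Dcc Dx).
rewrite /= lee_fin gtr0_norm ?jweight_gt0// ger0_norm; last first.
  by rewrite mulr_ge0 ?mulr_ge0 ?invr_ge0 ?addr_ge0 ?powR_ge0 ?(ltW m0).
rewrite /jweight /c mulrC -mulrA.
have h3 : 0 < h.[x] ^+ 2 by rewrite exprn_even_gt0//= h0.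
apply: ler_pM; [by rewrite invr_ge0 ltW|by rewrite mulr_ge0 ?powR_ge0|by rewrite lef_pV2 ?posrE|].
have a0 := powR_ge0 (1 - x) al; have b0 := powR_ge0 (1 + x) be.
have A0 := powR_ge0 2 `|al|; have B0 := powR_ge0 2 `|be|.
move: Dx; rewrite Ioo11E => /andP[x1 x2].
have [x0|x0] := leP 0 x.
  have : (1 + x) `^ be <= 2 `^ `|be| by apply: powR_le2; lra.
  move: ((1 - x) `^ al) ((1 + x) `^ be) (2 `^ `|al|) (2 `^ `|be|) a0 b0 A0 B0 => a b' A B; nra.
have : (1 - x) `^ al <= 2 `^ `|al| by apply: powR_le2; lra.
move: ((1 - x) `^ al) ((1 + x) `^ be) (2 `^ `|al|) (2 `^ `|be|) a0 b0 A0 B0 => a b' A B; nra.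
Qed.

Lemma jweight_regular : SLregular W b q.
Proof.
exact: (SLRegular jweight_gt0 jweight_integrable cW cb cq bounded_bq is_derive_jp
  p_cvgN1 p_cvg1 p_mono).
Qed.

End JacobiWeight.

(** * Blow-up and nonintegrability at an endpoint *)

Section Blowup.
Context {R : realType}.
Notation mu := (@lebesgue_measure R).
Notation D := (Ioo11 R).
Implicit Types (U g : R -> R) (a c s : R).

(** U - (c/a) s^(-a) is nonincreasing, hence bounded below near 0; half of the coefficient c/a
    absorbs this bound, as s^(-a) is unbounded. *)
Lemma powR_blowup U U' a c s0 : 0 < a -> 0 < c -> 0 < s0 ->
  (forall s, 0 < s < s0 -> is_derive s (1:R) U (U' s)) ->
  (forall s, 0 < s < s0 -> U' s <= - (c * s `^ (- (a + 1)))) ->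
  exists c' s1, [/\ 0 < c', 0 < s1 & forall s, 0 < s < s1 -> c' * s `^ (- a) <= U s].
Proof.
move=> a0 c_gt0 s00 dU U'le; pose k := c / a; pose t0 := s0 / 2.
have k0 : 0 < k by rewrite divr_gt0.
have t00 : 0 < t0 < s0 by rewrite /t0; lra.
pose V s := U s - k * s `^ (- a).
have dV s : 0 < s < s0 -> is_derive s (1:R) V (U' s + c * s `^ (- (a + 1))).
  move=> ss0; have s_gt0 : 0 < s by case/andP: ss0.
  have d1 := dU s ss0; have d2 := is_derive1_powR (- a) s_gt0.
  have := is_deriveB d1 (is_deriveM (is_derive_cst k s (1:R)) d2) => H.
  apply: (is_derive_eq H); rewrite /GRing.scale /= mulr0 addr0 opprD /k.
  by field; rewrite gt_eqF.
have Vle s : 0 < s -> s <= t0 -> V t0 <= V s.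
  move=> s_gt0 st0; have sub t : s <= t -> t <= t0 -> 0 < t < s0 by move=> *; lra.
  have [||t] := @MVT_segment R V (fun s => U' s + c * s `^ (- (a + 1))) s t0 st0.
  - by move=> t; rewrite in_itv/= => /andP[h1 h2]; apply: dV; apply: sub; exact: ltW.
  - apply: derivable_within_continuous => t; rewrite in_itv/= => /andP[h1 h2].
    by case: (dV t (sub t h1 h2)).
  rewrite in_itv/= => /andP[h1 h2] VE; rewrite -subr_le0 VE mulr_le0_ge0 ?subr_ge0//.
  by have := U'le t (sub t h1 h2); lra.
pose B : R := `|V t0|; have B0 : 0 <= B by exact: normr_ge0.
have kB : 0 < k / 2 / (B + 1) by rewrite !divr_gt0// ltr_wpDl.
have /cvgr0Pnorm_le/(_ _ kB)[d /= d0 Hd] := powR_cvg0 a0.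
exists (k / 2), (Num.min d t0); split; first by rewrite divr_gt0.
  by rewrite lt_min d0; case/andP: t00.
move=> s /andP[s_gt0]; rewrite lt_min => /andP[sd st0].
have sa0 : 0 < s `^ a by exact: powR_gt0.
have sab : s `^ a <= k / 2 / (B + 1).
  have := Hd s; rewrite /= sub0r normrN (gtr0_norm s_gt0) => /(_ sd s_gt0).
  by rewrite gtr0_norm.
have Bs : B <= k / 2 * s `^ (- a).
  rewrite powRN ler_pdivlMr//; move: sab; rewrite ler_pdivlMr ?ltr_wpDl//.
  by apply: le_trans; rewrite mulrC ler_wpM2l ?(ltW sa0)// lerDl.
have := Vle s s_gt0 (ltW st0); have : - B <= V t0 by rewrite lerNl /B -normrN ler_norm.
have VE : V s = U s - k * s `^ (- a) by [].
by rewrite VE; move: Bs; move: (s `^ _) (V t0) => r vt; lra.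
Qed.

(** Here s is the distance to the endpoint. As P v' stays within |l|/2 of l, |v'| is at least of
    order s^(-a-1) and |v| of order s^(-a). The weight is at least of order s^a, so v^2 Wt is at
    least of order s^(-a), hence of 1/s because a >= 1. *)
Lemma limit_point_lower (v v' P Wt T : R -> R) a k K l s0 : 1 <= a ->
  0 < k -> 0 < K -> l != 0 -> 0 < s0 -> s0 <= 1 ->
  (forall s, 0 < s < s0 -> [/\ is_derive s (1:R) v (v' s), 0 < P s,
     k * s `^ (a + 1) <= P s, P s <= K * s `^ (a + 1) & `|l - P s * v' s| <= `|l| / 2]) ->
  (forall s, 0 < s < s0 -> P s = T s * Wt s /\ 0 < T s <= 2 * s) ->
  exists c s1, [/\ 0 < c, 0 < s1 & forall s, 0 < s < s1 -> c / s <= v s ^+ 2 * Wt s].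
Proof.
move=> a1 k0 K0 l0 s00 s01 H1 H2; have a0 : 0 < a by lra.
have l2 : 0 < `|l| / 2 by rewrite divr_gt0// normr_gt0.
have ck : 0 < `|l| / 2 / K by rewrite divr_gt0.
(* With this sign, -sg v grows towards the endpoint, as [powR_blowup] requires. *)
pose sg := Num.sg l.
have [||c' [s1 [c'0 s10 HU]]] := @powR_blowup (fun s => - sg * v s) (fun s => - sg * v' s)
    a (`|l| / 2 / K) s0 a0 ck s00.
- move=> s /H1[dv _ _ _ _]; have H := is_deriveM (is_derive_cst (- sg) s (1:R)) dv.
  by apply: (is_derive_eq H); rewrite /GRing.scale /= mulr0 addr0.
- move=> s ss0; have [_ P0 _ PK dist] := H1 s ss0; have s_gt0 : 0 < s by case/andP: ss0.
  have S0 : 0 < s `^ (a + 1) by exact: powR_gt0.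
  rewrite mulNr lerN2 powRN.
  have sgl : `|l| / 2 <= P s * (sg * v' s).
    rewrite mulrCA; have : `|sg * (l - P s * v' s)| <= `|l| / 2.
      by rewrite normrM normr_sg l0 mul1r.
    by rewrite mulrBr -normrEsg ler_norml; move/andP => [_]; lra.
  have z0 : 0 <= sg * v' s.
    by rewrite -(pmulr_rge0 _ P0); apply: le_trans sgl; exact: ltW.
  rewrite ler_pdivrMr// ler_pdivrMr//; apply: (le_trans sgl).
  by rewrite mulrC -mulrA ler_wpM2l// mulrC.
exists (c' ^+ 2 * k / 2), (Num.min s1 s0); split.
- by rewrite divr_gt0// mulr_gt0// exprn_gt0.
- by rewrite lt_min s10.
move=> s /andP[s_gt0]; rewrite lt_min => /andP[ss1 ss0].
have {HU} := HU s; rewrite s_gt0 ss1 => /(_ isT) HU.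
have sss : 0 < s < s0 by rewrite s_gt0.
have [_ P0 Pk _ _] := H1 s sss; have [PE /andP[T0 T2]] := H2 s sss.
have A0 : 0 < s `^ a by exact: powR_gt0.
have As : s `^ a <= s by apply: ge1r_powR => //; rewrite s_gt0 (le_trans (ltW ss0)).
have SE : s `^ (a + 1) = s `^ a * s.
  have h1 : (a + 1 == 0) ==> (s != 0) by rewrite (gt_eqF s_gt0) implybT.
  by rewrite powRD// powRr1// ltW.
rewrite powRN in HU; rewrite SE in Pk.
move: HU Pk A0 As; set A := s `^ a => HU Pk A0 As.
have Wt0 : 0 < Wt s by rewrite -(pmulr_rgt0 _ T0) -PE.
have WA : k * A / 2 <= Wt s.
  rewrite -(ler_pM2r s_gt0) mulrAC ler_pdivrMr// -mulrA (le_trans Pk)// PE.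
  by rewrite -mulrA [leRHS]mulrC ler_pM2r// mulrC.
have U2 : c' ^+ 2 / A ^+ 2 <= v s ^+ 2.
  have -> : v s ^+ 2 = (- sg * v s) ^+ 2.
    by rewrite exprMn sqrrN sqr_sg l0 mul1r.
  rewrite -expr_div_n ler_sqr ?nnegrE//; first by rewrite divr_ge0 ?ltW.
  by apply: le_trans HU; rewrite divr_ge0 ?ltW.
apply: (@le_trans _ _ (c' ^+ 2 / A ^+ 2 * (k * A / 2))); last first.
  apply: ler_pM => //; first by rewrite divr_ge0// ?sqr_ge0.
  by rewrite divr_ge0// mulr_ge0 ?ltW.
have -> : c' ^+ 2 / A ^+ 2 * (k * A / 2) = c' ^+ 2 * k / 2 / A by field; rewrite gt_eqF.
by rewrite ler_pM2l ?divr_gt0 ?mulr_gt0 ?exprn_gt0// lef_pV2 ?posrE.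
Qed.

Lemma prim_ge g c x y : mu.-integrable D (EFin \o g) -> D x -> D y -> x <= y ->
  (forall t, x <= t <= y -> c <= g t) -> c * (y - x) <= prim g y - prim g x.
Proof.
rewrite !Ioo11E => ig /andP[x1 x2] /andP[y1 y2] xy gc; rewrite primB//.
have mxy : measurable (`[x, y]%classic : set (measurableTypeR R)) := measurable_itv _.
have mE : mu `[x, y]%classic = (y - x)%:E.
  rewrite lebesgue_measure_itv/= lte_fin; case: ltP => yx; first by rewrite -EFinB.
  by congr EFin; apply/esym/eqP; rewrite subr_eq0; apply/eqP/le_anti; rewrite xy yx.
rewrite (_ : c * (y - x) = \int[mu]_(t in `[x, y]) c); last first.
  by rewrite Rintegral_cst// [X in fine X](_ : _ = (y - x)%:E)//; exact: mE.
apply: le_Rintegral => //.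
- apply: continuous_compact_integrable; first exact: segment_compact.
  by apply: continuous_in_subspaceT => t _; exact: cvg_cst.
by apply: integrable_Ioo11S ig _ _; rewrite /= bnd_simp.
Qed.

(** Over [1 - r, 1 - r/2] the integrand is at least c/r, so the integral is at least c/2 for every
    small r, whereas convergence of the primitive at 1 allows at most c/4. *)
Lemma not_integrable_right g c s1 : mu.-integrable D (EFin \o g) -> 0 < c -> 0 < s1 ->
  ~ (forall x, D x -> 1 - x < s1 -> c / (1 - x) <= g x).
Proof.
move=> ig c0 s10 H; have c8 : 0 < c / 8 by rewrite divr_gt0.
have /cvgrPdist_le/(_ _ c8)[d /= d0 Hd] := prim_at_left1 ig.
pose r := Num.min (Num.min d s1) 1 / 2.
have [r0 rd rs r1] : [/\ 0 < r, r < d, r < s1 & r < 1].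
  have : 0 < Num.min (Num.min d s1) 1 by rewrite !lt_min d0 s10 ltr01.
  have : Num.min (Num.min d s1) 1 <= d by rewrite !ge_min lexx.
  have : Num.min (Num.min d s1) 1 <= s1 by rewrite !ge_min lexx orbT.
  have : Num.min (Num.min d s1) 1 <= 1 by rewrite !ge_min lexx !orbT.
  by rewrite /r; move: (Num.min _ _) => z h1 h2 h3 h4; split; lra.
have Dx : D (1 - r) by rewrite Ioo11E; lra.
have Dy : D (1 - r / 2) by rewrite Ioo11E; lra.
have := @prim_ge g (c / r) (1 - r) (1 - r / 2) ig Dx Dy ltac:(lra).
have -> : c / r * (1 - r / 2 - (1 - r)) = c / 2 by field; rewrite gt_eqF.
have pos t : 1 - r <= t <= 1 - r / 2 -> c / r <= g t.
  move=> trr; apply: le_trans (H t _ _); last by lra.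
    by rewrite ler_pM2l// lef_pV2 ?posrE//; lra.
  by rewrite Ioo11E; lra.
move=> /(_ pos).
have near t : 0 < t < d -> `|\int[mu]_(s in D) g s - prim g (1 - t)| <= c / 8.
  move=> /andP[t0 td]; apply: Hd; last by rewrite ltrBlDr ltrDl.
  by rewrite /= opprB addrC subrK gtr0_norm.
have := near r ltac:(lra); have := near (r / 2) ltac:(lra).
by rewrite !ler_norml; lra.
Qed.

Lemma not_integrable_left g c s1 : mu.-integrable D (EFin \o g) -> 0 < c -> 0 < s1 ->
  ~ (forall x, D x -> 1 + x < s1 -> c / (1 + x) <= g x).
Proof.
move=> ig c0 s10 H; have c8 : 0 < c / 8 by rewrite divr_gt0.
have /cvgrPdist_le/(_ _ c8)[d /= d0 Hd] := prim_at_rightN1 ig.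
pose r := Num.min (Num.min d s1) 1 / 2.
have [r0 rd rs r1] : [/\ 0 < r, r < d, r < s1 & r < 1].
  have : 0 < Num.min (Num.min d s1) 1 by rewrite !lt_min d0 s10 ltr01.
  have : Num.min (Num.min d s1) 1 <= d by rewrite !ge_min lexx.
  have : Num.min (Num.min d s1) 1 <= s1 by rewrite !ge_min lexx orbT.
  have : Num.min (Num.min d s1) 1 <= 1 by rewrite !ge_min lexx !orbT.
  by rewrite /r; move: (Num.min _ _) => z h1 h2 h3 h4; split; lra.
have Dx : D (-1 + r) by rewrite Ioo11E; lra.
have Dy : D (-1 + r / 2) by rewrite Ioo11E; lra.
have := @prim_ge g (c / r) (-1 + r / 2) (-1 + r) ig Dy Dx ltac:(lra).
have -> : c / r * (-1 + r - (-1 + r / 2)) = c / 2 by field; rewrite gt_eqF.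
have pos t : -1 + r / 2 <= t <= -1 + r -> c / r <= g t.
  move=> trr; apply: le_trans (H t _ _); last by lra.
    by rewrite ler_pM2l// lef_pV2 ?posrE//; lra.
  by rewrite Ioo11E; lra.
move=> /(_ pos).
have near t : 0 < t < d -> `|0 - prim g (-1 + t)| <= c / 8.
  move=> /andP[t0 td]; apply: Hd; last by rewrite ltrDl.
  by rewrite /= opprD addrA subrr sub0r normrN gtr0_norm.
have := near r ltac:(lra); have := near (r / 2) ltac:(lra).
by rewrite !ler_norml; lra.
Qed.

End Blowup.

(** * The limit point case *)

Section LimitPoint.
Context {R : realType}.
Notation mu := (@lebesgue_measure R).
Notation D := (Ioo11 R).
Variables (al be c0 : R) (h : {poly R}).
Hypothesis al_gt : -1 < al.
Hypothesis be_gt : -1 < be.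
Hypothesis h_neq0 : forall x, -1 <= x <= 1 -> h.[x] != 0.

Notation W := (jweight al be h).
Notation b := (jcoef1 al be h).
Notation q := (jcoef0 be c0 h).
Notation p := (SLp W).
Notation L := (SL b q).

Let reg : SLregular W b q. Proof. exact: jweight_regular. Qed.

Variable u : R -> R.
Hypothesis du : forall x, D x -> derivable u x 1.
Hypothesis acu : rAC_loc (derive1 u).
Hypothesis lu : wL2 D W u.
Hypothesis lLu : wL2 D W (L u).

Let is_du x : D x -> is_derive x (1:R) u (derive1 u x).
Proof. by move=> Dx; rewrite derive1E; apply: DeriveDef => //; exact: du. Qed.

Let iu2 : mu.-integrable D (EFin \o (fun x => u x ^+ 2 * W x)).
Proof. by case: lu. Qed.

(** The limit l of p u' exists by [SLp_deriv_prim]; if it were nonzero, u^2 W would exceed c/(1 - x)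
    near 1, against integrability. *)
Lemma limit_point_right : 1 <= al -> p x * derive1 u x @[x --> (1 : R)^'-] --> 0.
Proof.
move=> al1; have [ig GE] := SLp_deriv_prim reg du acu lu lLu.
set g := fun t => _ in ig GE.
pose l := p 0 * derive1 u 0 - prim g 0 + \int[mu]_(t in D) g t.
have lim : p x * derive1 u x @[x --> (1 : R)^'-] --> l.
  apply: cvg_trans (cvgD (cvg_cst _) (prim_at_left1 ig)).
  apply: near_eq_cvg; near=> t; rewrite [RHS]GE//.
  by near: t; exact: near_left1_Ioo11.
have [<-//|l0] := eqVneq l 0; exfalso.
have l2 : 0 < `|l| / 2 by rewrite divr_gt0// normr_gt0.
have /cvgrPdist_le/(_ _ l2)[d /= d0 Hd] := lim.
have [k [K [k0 K0 [pk pK] _]]] := jp_equiv al_gt be_gt h_neq0.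
pose s0 : R := Num.min d 1.
have s00 : 0 < s0 by rewrite lt_min d0 ltr01.
have s01 : s0 <= 1 by rewrite ge_min lexx orbT.
have s0D s : 0 < s < s0 -> D (1 - s) by rewrite Ioo11E; lra.
(* In the variable s = 1 - x the derivative changes sign, so the relevant limit is -l. *)
have Nl0 : - l != 0 by rewrite oppr_eq0.
have [||c [s1 [c_gt0 s10 H]]] := @limit_point_lower R (fun s => u (1 - s))
  (fun s => - derive1 u (1 - s)) (fun s => p (1 - s)) (fun s => W (1 - s))
  (fun s => 1 - (1 - s) ^+ 2) al k K (- l) s0 al1 k0 K0 Nl0 s00 s01.
- move=> s ss0; have Ds := s0D s ss0; have E : 1 - (1 - s) = s by ring.
  split.
  + have d1 : is_derive s (1:R) (fun t : R => 1 - t) (-1).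
      have H := is_deriveB (is_derive_cst (1:R) s (1:R)) (is_derive_id s (1:R)).
      by apply: (is_derive_eq H); rewrite sub0r.
    have := @is_derive1_comp _ u (fun t => 1 - t) s _ _ (is_du Ds) d1.
    by rewrite mulrN1.
  + exact: (SLp_gt0 reg).
  + by have := pk _ Ds; rewrite E; apply; move: ss0; lra.
  + by have := pK _ Ds; rewrite E.
  have -> : - l - p (1 - s) * - derive1 u (1 - s) = - (l - p (1 - s) * derive1 u (1 - s)).
    by ring.
  rewrite !normrN; apply: Hd => /=.
    rewrite E gtr0_norm; last by case/andP: ss0.
    by case/andP: ss0 => _; rewrite lt_min => /andP[].
  by case/andP: ss0; lra.
- by move=> s ss0; split => //; have := s0D s ss0; rewrite Ioo11E; nra.
apply: (not_integrable_right iu2 c_gt0 s10) => x Dx xs.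
have := H (1 - x); rewrite (_ : 1 - (1 - x) = x); last by ring.
apply.
by move: Dx; rewrite Ioo11E xs andbT; lra.
Unshelve. all: by end_near. Qed.

Lemma limit_point_left : 1 <= be -> p x * derive1 u x @[x --> (-1 : R)^'+] --> 0.
Proof.
move=> be1; have [ig GE] := SLp_deriv_prim reg du acu lu lLu.
set g := fun t => _ in ig GE.
pose l := p 0 * derive1 u 0 - prim g 0 + 0.
have lim : p x * derive1 u x @[x --> (-1 : R)^'+] --> l.
  apply: cvg_trans (cvgD (cvg_cst _) (prim_at_rightN1 ig)).
  apply: near_eq_cvg; near=> t; rewrite [RHS]GE//.
  by near: t; exact: near_rightN1_Ioo11.
have [<-//|l0] := eqVneq l 0; exfalso.
have l2 : 0 < `|l| / 2 by rewrite divr_gt0// normr_gt0.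
have /cvgrPdist_le/(_ _ l2)[d /= d0 Hd] := lim.
have [k [K [k0 K0 _ [pk pK]]]] := jp_equiv al_gt be_gt h_neq0.
pose s0 : R := Num.min d 1.
have s00 : 0 < s0 by rewrite lt_min d0 ltr01.
have s01 : s0 <= 1 by rewrite ge_min lexx orbT.
have s0D s : 0 < s < s0 -> D (-1 + s) by rewrite Ioo11E; lra.
have [||c [s1 [c_gt0 s10 H]]] := @limit_point_lower R (fun s => u (-1 + s))
  (fun s => derive1 u (-1 + s)) (fun s => p (-1 + s)) (fun s => W (-1 + s))
  (fun s => 1 - (-1 + s) ^+ 2) be k K l s0 be1 k0 K0 l0 s00 s01.
- move=> s ss0; have Ds := s0D s ss0; have E : 1 + (-1 + s) = s by ring.
  split.
  + have d1 : is_derive s (1:R) (fun t : R => -1 + t) 1.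
      have H := is_deriveD (is_derive_cst (-1:R) s (1:R)) (is_derive_id s (1:R)).
      by apply: (is_derive_eq H); rewrite add0r.
    have := @is_derive1_comp _ u (fun t => -1 + t) s _ _ (is_du Ds) d1.
    by rewrite mulr1.
  + exact: (SLp_gt0 reg).
  + by have := pk _ Ds; rewrite E; apply; move: ss0; lra.
  + by have := pK _ Ds; rewrite E.
  apply: Hd => /=.
    rewrite opprD addrA subrr sub0r normrN gtr0_norm; last by case/andP: ss0.
    by case/andP: ss0 => _; rewrite lt_min => /andP[].
  by case/andP: ss0; lra.
- by move=> s ss0; split => //; have := s0D s ss0; rewrite Ioo11E; nra.
apply: (not_integrable_left iu2 c_gt0 s10) => x Dx xs.
have := H (1 + x); rewrite addrA addNr add0r; apply.
by move: Dx; rewrite Ioo11E xs andbT; lra.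
Unshelve. all: by end_near. Qed.

End LimitPoint.

(** * The exceptional Jacobi operator *)

Local Open Scope complex_scope.

(** * From complex functions to real and imaginary parts *)

Section ComplexParts.
Context {R : realType}.
Notation mu := (@lebesgue_measure R).
Notation D := (Ioo11 R).
Implicit Types (f g : R -> R[i]) (z : R[i]).

Notation Re := complex.Re.
Notation Im := complex.Im.

Lemma normc_sqr z : normc z ^+ 2 = Re z ^+ 2 + Im z ^+ 2.
Proof. by case: z => x y; rewrite /normc sqr_sqrtr// addr_ge0 ?sqr_ge0. Qed.

Lemma normc_nneg z : 0 <= normc z.
Proof. by case: z => x y; exact: sqrtr_ge0. Qed.

Lemma Re_le_normc z : `|Re z| <= normc z.
Proof.
by rewrite -ler_sqr ?nnegrE ?normc_nneg// normc_sqr real_normK ?num_real// lerDl sqr_ge0.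
Qed.

Lemma Im_le_normc z : `|Im z| <= normc z.
Proof.
by rewrite -ler_sqr ?nnegrE ?normc_nneg// normc_sqr real_normK ?num_real// lerDr sqr_ge0.
Qed.

Lemma normc_le_ReIm z : normc z <= `|Re z| + `|Im z|.
Proof.
rewrite -ler_sqr ?nnegrE ?normc_nneg ?addr_ge0// normc_sqr sqrrD !real_normK ?num_real//.
by rewrite addrAC lerDl mulrn_wge0// mulr_ge0.
Qed.

Lemma ReB z1 z2 : Re (z1 - z2) = Re z1 - Re z2.
Proof. by case: z1 z2 => [a b] [c d]. Qed.

Lemma ImB z1 z2 : Im (z1 - z2) = Im z1 - Im z2.
Proof. by case: z1 z2 => [a b] [c d]. Qed.

Lemma eq_complexP z1 z2 : Re z1 = Re z2 -> Im z1 = Im z2 -> z1 = z2.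
Proof. by case: z1 z2 => [a b] [c d] /= -> ->. Qed.

Lemma AC_locP f : AC_loc f <-> rAC_loc (fun x => Re (f x)) /\ rAC_loc (fun x => Im (f x)).
Proof.
split=> [acf|[acr aci]].
  split=> c d c1 cd d1 eps e0; have [delta d0 H] := acf c d c1 cd d1 eps e0;
    exists delta => // s s1 s2 s3; apply: le_lt_trans (H s s1 s2 s3); apply: ler_sum => p _.
    by rewrite -ReB Re_le_normc.
  by rewrite -ImB Im_le_normc.
move=> c d c1 cd d1 eps e0; have e20 : 0 < eps / 2 by rewrite divr_gt0.
have [r r0 Hr] := acr c d c1 cd d1 _ e20; have [i i0 Hi] := aci c d c1 cd d1 _ e20.
exists (Num.min r i); first by rewrite lt_min r0.
move=> s s1 s2; rewrite lt_min => /andP[s3 s4].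
rewrite [ltRHS](splitr eps); apply: le_lt_trans (ltrD (Hr s s1 s2 s3) (Hi s s1 s2 s4)).
rewrite -big_split /=; apply: ler_sum => p _.
by apply: le_trans (normc_le_ReIm _) _; rewrite ReB ImB.
Qed.

Lemma normcZ (r : R) z : 0 <= r -> normc (r%:C * z) = r * normc z.
Proof.
case: z => a b r0; simpc; rewrite /normc !exprMn -mulrDr sqrtrM ?sqr_ge0//.
by rewrite sqrtr_sqr ger0_norm.
Qed.

(** The boundary conditions are stated with pure powers, the real theory with p; the two are
    comparable near the endpoint, which makes the conditions equivalent. *)
Lemma normcZ_cvg0 (F : set_system R) {FF : Filter F} (A P : R -> R) f (k K : R) :
  0 < k -> 0 < K ->
  (\forall x \near F, [/\ 0 <= A x, k * A x <= P x & P x <= K * A x]) ->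
  (normc ((A x)%:C * f x) @[x --> F] --> 0) <->
  (P x * Re (f x) @[x --> F] --> 0) /\ (P x * Im (f x) @[x --> F] --> 0).
Proof.
move=> k0 K0 nF; split=> [H|[H1 H2]].
  have part (u : R -> R) : (forall x, `|u x| <= normc (f x)) -> P x * u x @[x --> F] --> 0.
    move=> uf; apply/cvgr0Pnorm_le => eps e0; have eK : 0 < eps / K by rewrite divr_gt0.
    have /cvgr0Pnorm_le/(_ _ eK) := H; apply: filterS2 nF => x [A0 kA AK].
    rewrite normcZ// (ger0_norm (mulr_ge0 A0 (normc_nneg _))) ler_pdivlMr// => nA.
    have P0 : 0 <= P x by rewrite (le_trans _ kA)// mulr_ge0// ltW.
    rewrite normrM (ger0_norm P0) (le_trans _ nA)// [leRHS]mulrAC.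
    by apply: ler_pM; [exact: P0|exact: normr_ge0|rewrite mulrC|exact: uf].
  by split; apply: part => x; [exact: Re_le_normc|exact: Im_le_normc].
apply/cvgr0Pnorm_le => eps e0; have ek : 0 < eps * k / 2 by rewrite divr_gt0// mulr_gt0.
have /cvgr0Pnorm_le/(_ _ ek) n1 := H1; have /cvgr0Pnorm_le/(_ _ ek) n2 := H2.
apply: filterS2 nF (filterI n1 n2) => x [A0 kA AK] [h1 h2].
rewrite normcZ// (ger0_norm (mulr_ge0 A0 (normc_nneg _))).
have P0 : 0 <= P x by rewrite (le_trans _ kA)// mulr_ge0// ltW.
rewrite normrM (ger0_norm P0) in h1; rewrite normrM (ger0_norm P0) in h2.
rewrite -(ler_pM2r k0); apply: (@le_trans _ _ (P x * (`|Re (f x)| + `|Im (f x)|))).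
  rewrite mulrAC [A x * k]mulrC; apply: ler_pM => //; first by rewrite mulr_ge0// ltW.
    exact: normc_nneg.
  exact: normc_le_ReIm.
by rewrite mulrDr; lra.
Qed.

Variable W : R -> R.
Hypothesis mW : measurable_fun D W.
Hypothesis W_gt0 : forall x, D x -> 0 < W x.

Let mD : measurable (D : set R). Proof. exact: measurable_itv. Qed.

Lemma L2sqnorm_parts f : wL2 D W (fun x => Re (f x)) -> wL2 D W (fun x => Im (f x)) ->
  L2sqnorm W f = (wsqn D W (fun x => Re (f x)) + wsqn D W (fun x => Im (f x)))%:E.
Proof.
move=> lr li; rewrite /L2sqnorm EFinD !(wL2_EFin mD mW W_gt0)// -ge0_integralD//.
- by apply: eq_integral => x _; rewrite normc_sqr -EFinD; congr EFin; ring.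
- by move=> x Dx; rewrite lee_fin mulr_ge0 -?expr2 ?sqr_ge0// ltW// W_gt0.
- by have /integrableP[] := wL2_integrable mD mW W_gt0 lr lr.
- by move=> x Dx; rewrite lee_fin mulr_ge0 -?expr2 ?sqr_ge0// ltW// W_gt0.
- by have /integrableP[] := wL2_integrable mD mW W_gt0 li li.
Qed.

Lemma inL2P f : inL2 W f <-> wL2 D W (fun x => Re (f x)) /\ wL2 D W (fun x => Im (f x)).
Proof.
split=> [[[mr mi] fin]|[lr li]]; last first.
  split; first by split; [case: lr|case: li].
  by rewrite L2sqnorm_parts// ltry.
have mn : measurable_fun D (fun x => normc (f x) ^+ 2 * W x).
  rewrite (_ : (fun x => _) = (fun x => (Re (f x) ^+ 2 + Im (f x) ^+ 2) * W x)).
    by apply: measurable_funM => //; apply: measurable_funD; exact: measurable_funX.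
  by apply/funext => x; rewrite normc_sqr.
have le (u : R -> R) : measurable_fun D u -> (forall x, `|u x| <= normc (f x)) -> wL2 D W u.
  move=> mu_ uf; apply: wL2_lty => //; apply: le_lt_trans fin; apply: ge0_le_integral => //.
  - by move=> x Dx; rewrite lee_fin mulr_ge0 -?expr2 ?sqr_ge0// ltW// W_gt0.
  - by apply/measurable_EFinP; apply: measurable_funM => //; exact: measurable_funM.
  - exact/measurable_EFinP.
  - move=> x Dx; rewrite lee_fin ler_wpM2r ?(ltW (W_gt0 Dx))// -expr2.
    by rewrite -(real_normK (num_real (u x))) ler_sqr ?nnegrE ?normc_nneg.
by split; apply: le => // x; [exact: Re_le_normc|exact: Im_le_normc].
Qed.

Lemma L2norm_parts (u v : R -> R) : wL2 D W u -> wL2 D W v ->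
  L2norm W (fun x => u x +i* v x) = (Num.sqrt (wsqn D W u + wsqn D W v))%:E.
Proof.
move=> lu lv; rewrite /L2norm (@L2sqnorm_parts (fun x => u x +i* v x))//=.
by rewrite powR12_sqrt// addr_ge0// (wsqn_ge0 W_gt0).
Qed.

Lemma ae_eq11P f g : ae_eq11 f g <->
  {ae mu, forall x, D x -> Re (f x) = Re (g x)} /\
  {ae mu, forall x, D x -> Im (f x) = Im (g x)}.
Proof.
have F_ := ae_filter_ringOfSetsType mu.
split=> [fg|[h1 h2]].
  by split; apply: filterS fg => x H Dx; rewrite H.
by apply: filterS2 h1 h2 => x H1 H2 Dx; apply: eq_complexP; [exact: H1|exact: H2].
Qed.

End ComplexParts.

Section PositiveInfimum.
Context {R : realType}.

(** Only finitely many values can lie below 1. The predicate [P] allows an index to be left out, as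
    when the gap around an eigenvalue is measured. *)
Lemma inf_gt0 (P : nat -> Prop) (phi : nat -> R) N :
  (forall k, P k -> 0 < phi k) -> (forall k, (N <= k)%N -> 1 <= phi k) ->
  exists2 d : R, 0 < d & forall k, P k -> d <= phi k.
Proof.
move=> phi0 phi1.
suff [d d0 H] : exists2 d : R, 0 < d & forall k, P k -> (k < N)%N -> d <= phi k.
  exists (Num.min d 1); first by rewrite lt_min d0 ltr01.
  move=> k Pk; have [Nk|kN] := leqP N k; first by rewrite ge_min phi1 ?orbT.
  by rewrite ge_min H.
elim: N {phi1} => [|N [d d0 H]]; first by exists 1.
have [PN|nPN] := pselect (P N).
  exists (Num.min d (phi N)); first by rewrite lt_min d0 phi0.
  move=> k Pk; rewrite ltnS leq_eqVlt => /predU1P[->|kN]; first by rewrite ge_min lexx orbT.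
  by rewrite ge_min H.
exists d => // k Pk; rewrite ltnS leq_eqVlt => /predU1P[kN|kN]; last exact: H.
by case: nPN; rewrite -kN.
Qed.

End PositiveInfimum.

(** * The sequence of eigenvalues *)

Section Eigenvalues.
Context {R : realType}.
Variables (alpha beta : R).
Hypothesis alpha_gt : -1 < alpha.
Hypothesis beta_gt : -1 < beta.

Definition eigenvalue k : R := - (k%:R * (1 + alpha + beta + k%:R)).
Notation lam := eigenvalue.

Lemma eigenvalue_le (A : R) : exists N, forall k, (N <= k)%N -> lam k <= A.
Proof.
have [N NA] : exists N : nat, `|A| + 1 < N%:R.
  by exists (Num.truncn (`|A| + 1)).+1; apply: truncnS_gt.
exists N.+1 => k Nk.
have k1 : 1 <= k%:R :> R by rewrite ler1n (leq_trans _ Nk).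
have Nk' : N%:R <= k%:R - 1 :> R.
  by rewrite lerBrDr natr1 ler_nat.
rewrite /eigenvalue lerNl; apply: (@le_trans _ _ (1 + alpha + beta + k%:R)).
  have : - A <= `|A| by rewrite -normrN ler_norm.
  by move: alpha_gt beta_gt; lra.
have : 0 <= `|A| by [].
by move=> A0; rewrite ler_peMl//; move: alpha_gt beta_gt; lra.
Qed.

Let h0 n : 0 < 1 + alpha + beta + n.+1%:R.
Proof. by rewrite -natr1; have := ler0n R n; move: (n%:R) alpha_gt beta_gt => r; lra. Qed.

Let lam_dist j k : lam j - lam k = (k%:R - j%:R) * (1 + alpha + beta + (j + k)%:R).
Proof. by rewrite /eigenvalue natrD; ring. Qed.

(** In the factorization (k - j)(1 + alpha + beta + j + k) of the difference, the second factor is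
    positive as soon as j + k >= 1, since alpha + beta > -2. *)
Lemma eigenvalue_inj : injective lam.
Proof.
move=> j k /eqP; rewrite -subr_eq0 lam_dist mulf_eq0 subr_eq0 eqr_nat => /orP[/eqP//|].
by case: j => [|j]; case: k => [|k] //; rewrite gt_eqF// ?addnS ?addSn; exact: h0.
Qed.

End Eigenvalues.

(** * Domain, spectrum and completeness of the exceptional operator *)

Section ExceptionalOperator.
Context {R : realType}.
Notation mu := (@lebesgue_measure R).
Notation D := (Ioo11 R).
Notation Re := complex.Re.
Notation Im := complex.Im.
Variables (m : nat) (alpha beta : R).
Hypothesis alpha_gt : -1 < alpha.
Hypothesis beta_gt : -1 < beta.
Hypothesis sgn_eq : Num.sg (alpha + 1 - m%:R) = Num.sg beta.
Hypothesis eta_neq0 : forall x : R, -1 < x < 1 -> (eta alpha beta m).[x] != 0.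
Hypothesis deg_xjacobi : forall n : nat, (m <= n)%N ->
  size (xjacobi alpha beta m n) = n.+1.

Notation h := (eta alpha beta m).
Notation W := (xjacobi_weight alpha beta m).
Notation b := (jcoef1 alpha beta h).
Notation q := (jcoef0 beta ((alpha - beta - m%:R + 1) * m%:R) h).
Notation p := (SLp W).
Notation L := (SL b q).
Notation T := (xjacobi_expr alpha beta m).
Notation dom := (SLdom W b q).

Let e k := xjacobi alpha beta m (m + k).
Notation lam := (eigenvalue alpha beta).

(** On the closed interval eta is then bounded away from 0, so W has the endpoint behaviour of the
    classical Jacobi weight. *)
Lemma eta_neq0_cc x : -1 <= x <= 1 -> h.[x] != 0.
Proof.
move=> /andP[]; rewrite le_eqVlt => /predU1P[<- _|x1].
  exact: (etaN1_neq0 beta_gt sgn_eq deg_xjacobi).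
rewrite le_eqVlt => /predU1P[->|x2]; first exact: (eta1_neq0 deg_xjacobi).
by apply: eta_neq0; rewrite x1.
Qed.

Lemma xjacobi_regular : SLregular W b q.
Proof. exact: (jweight_regular _ alpha_gt beta_gt eta_neq0_cc). Qed.

Let reg := xjacobi_regular.
Let W_gt0 := SL_W_gt0 reg.
Let W_int := SL_W_int reg.
Let mD : measurable (D : set R). Proof. exact: measurable_itv. Qed.
Let mD' : measurable (D : set (measurableTypeR R)) := mD.
Let mW : measurable_fun D W. Proof. exact: (continuous_Ioo11_measurable (SL_cW reg)). Qed.

Lemma xjacobi_exprE f x :
  T f x = L (fun t => Re (f t)) x +i* L (fun t => Im (f t)) x.
Proof.
have E (r s t : R) (z1 z2 z3 : R[i]) : r%:C * z1 + s%:C * z2 + t%:C * z3 =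
    (r * Re z1 + s * Re z2 + t * Re z3) +i* (r * Im z1 + s * Im z2 + t * Im z3).
  by case: z1 z2 z3 => [a1 b1] [a2 b2] [a3 b3]; simpc.
by rewrite /xjacobi_expr E.
Qed.

Lemma SL_eigen k x : D x -> L (horner (e k)) x = lam k * (e k).[x].
Proof.
rewrite Ioo11E => x11; rewrite SLhornerE /jcoef1 /jcoef0 /eigenvalue.
exact: (xjacobi_eigen k (eta_neq0 x11)).
Qed.

Lemma xjacobi_neq0 k : e k != 0.
Proof. by rewrite -size_poly_eq0 /e deg_xjacobi// leq_addr. Qed.

(** Division by eta^2 preserves the norm when W is replaced by eta^4 W; a polynomial r close to f /
    eta^2 there gives eta^2 r close to f. *)
Lemma xjacobi_dense f : wL2 D W f -> forall eps : R, 0 < eps ->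
  exists c, wsqn D W (f \- horner (lincomb e c)) < eps.
Proof.
move=> lf eps eps0; pose W4 x := h.[x] ^+ 4 * W x.
have W4_gt0 x : D x -> 0 < W4 x.
  move=> Dx; have hx : h.[x] != 0 by apply: eta_neq0; move: Dx; rewrite Ioo11E.
  by rewrite mulr_gt0 ?W_gt0// exprn_even_gt0.
have mh n : measurable_fun D (fun x => h.[x] ^+ n).
  apply: measurable_funX; apply: measurable_funTS.
  by apply: continuous_measurable_fun; exact: continuous_horner.
have mW4 : measurable_fun D W4 by exact: measurable_funM.
have W4_int : mu.-integrable D (EFin \o W4).
  have [M hM] := horner_bounded (h ^+ 4).
  have := integrableZl mD' M W_int; apply: le_integrable => //.
    exact/measurable_EFinP.
  move=> x Dx; rewrite /= lee_fin /W4 -horner_exp !normrM ler_wpM2r// (le_trans (hM x Dx))//.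
  exact: ler_norm.
pose g x := f x / h.[x] ^+ 2.
have hn x : D x -> h.[x] != 0 by rewrite Ioo11E; exact: eta_neq0.
have [mf if2] := lf.
have lg : wL2 D W4 g.
  split.
    apply: measurable_funM => //; apply: continuous_Ioo11_measurable => x Dx.
    apply: cvgV; first by rewrite expf_neq0// hn.
    under eq_fun do rewrite expr2; rewrite expr2.
    by apply: cvgM; exact: continuous_horner.
  apply: eq_integrable if2 => // x; rewrite inE => Dx; rewrite /W4 /g; congr EFin.
  by field; exact: hn.
have [r rE] := polynomials_dense mW4 W4_gt0 W4_int lg eps0.
have [N [c cE]] := eta2_in_span beta_gt sgn_eq deg_xjacobi r.
exists (\poly_(k < N) c k).
have -> : lincomb e (\poly_(k < N) c k) = h ^+ 2 * r.
  rewrite cE (@lincomb_widen _ _ N) ?size_poly//; apply: eq_bigr => k _.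
  by rewrite coef_poly ltn_ord.
apply: le_lt_trans rE; rewrite le_eqVlt; apply/orP; left; apply/eqP.
apply: eq_Rintegral => x; rewrite inE => Dx.
by rewrite /= /W4 /g hornerM horner_exp; field; exact: hn.
Qed.

Lemma maxdomP f : maxdom alpha beta m f <->
  [/\ forall x, D x -> derivable (fun t => Re (f t)) x 1, rAC_loc (derive1 (fun t => Re (f t))),
    wL2 D W (fun t => Re (f t)) & wL2 D W (L (fun t => Re (f t)))] /\
  [/\ forall x, D x -> derivable (fun t => Im (f t)) x 1, rAC_loc (derive1 (fun t => Im (f t))),
    wL2 D W (fun t => Im (f t)) & wL2 D W (L (fun t => Im (f t)))].
Proof.
have TE : T f = (fun x => L (fun t => Re (f t)) x +i* L (fun t => Im (f t)) x).
  by apply/funext => x; exact: xjacobi_exprE.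
split.
  move=> [_ df /AC_locP[a1 a2] /(inL2P mW W_gt0)[l1 l2]]; rewrite TE => /(inL2P mW W_gt0)[l3 l4].
  by split; split => // x /df[].
move=> [[d1 a1 l1 l3] [d2 a2 l2 l4]]; split.
- apply/AC_locP; split; [apply: (derivable_rAC_loc d1)|apply: (derivable_rAC_loc d2)];
    exact: continuous_derive1_dom.
- by move=> x Dx; split; [exact: d1|exact: d2].
- exact/AC_locP.
- exact/(inL2P mW W_gt0).
- by rewrite TE; exact/(inL2P mW W_gt0).
Qed.

Lemma bc_rightP f : bc_right alpha f <->
  (p x * derive1 (fun t => Re (f t)) x @[x --> (1 : R)^'-] --> 0) /\
  (p x * derive1 (fun t => Im (f t)) x @[x --> (1 : R)^'-] --> 0).
Proof.
have [k [K [k0 K0 [pk pK] _]]] := jp_equiv alpha_gt beta_gt eta_neq0_cc.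
apply: (normcZ_cvg0 (cderiv f) k0 K0); near=> x.
have x0 : 0 < x by near: x; apply: nbhs_left_gt; exact: ltr01.
have Dx : D x.
  by rewrite Ioo11E; apply/andP; split; [lra|near: x; exact: nbhs_left_lt].
by split; [exact: powR_ge0|apply: pk => //; exact: ltW|exact: pK].
Unshelve. all: by end_near. Qed.

Lemma bc_leftP f : bc_left beta f <->
  (p x * derive1 (fun t => Re (f t)) x @[x --> (-1 : R)^'+] --> 0) /\
  (p x * derive1 (fun t => Im (f t)) x @[x --> (-1 : R)^'+] --> 0).
Proof.
have [k [K [k0 K0 _ [pk pK]]]] := jp_equiv alpha_gt beta_gt eta_neq0_cc.
apply: (normcZ_cvg0 (cderiv f) k0 K0); near=> x.
have x0 : x < 0 by near: x; apply: nbhs_right_lt; exact: ltrN10.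
have Dx : D x.
  by rewrite Ioo11E; apply/andP; split; [near: x; exact: nbhs_right_gt|lra].
by split; [exact: powR_ge0|apply: pk => //; exact: ltW|exact: pK].
Unshelve. all: by end_near. Qed.

(** The case distinction disappears: at each end either the exponent is at least 1 and the
    limit-point lemmas supply the condition, or the definition of the domain contains it. *)
Lemma xjacobi_domP f : xjacobi_dom alpha beta m f <->
  dom (fun t => Re (f t)) /\ dom (fun t => Im (f t)).
Proof.
split.
  move=> [/maxdomP[[d1 a1 l1 l3] [d2 a2 l2 l4]] bc].
  have [bR bL] : (1 <= alpha \/ bc_right alpha f) /\ (1 <= beta \/ bc_left beta f).
    move: bc; have [al1|al1] := boolP (1 <= alpha); have [be1|be1] := boolP (1 <= beta) => /=.
    - by split; left.
    - by rewrite andbF; case: ifP => _; [move=> ?; split; [left|right]|move=> [? ?]; split; [left|right]].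
    - by rewrite andbT; case: ifP => _; [move=> ?; split; [right|left]|move=> [? ?]; split; [right|left]].
    - by rewrite andbF => -[? ?]; split; right.
  have R0 : bc_right alpha f.
    case: bR => // al1; apply/bc_rightP.
    split; first exact: (limit_point_right alpha_gt beta_gt eta_neq0_cc d1 a1 l1 l3 al1).
    exact: (limit_point_right alpha_gt beta_gt eta_neq0_cc d2 a2 l2 l4 al1).
  have L0 : bc_left beta f.
    case: bL => // be1; apply/bc_leftP.
    split; first exact: (limit_point_left alpha_gt beta_gt eta_neq0_cc d1 a1 l1 l3 be1).
    exact: (limit_point_left alpha_gt beta_gt eta_neq0_cc d2 a2 l2 l4 be1).
  by move: R0 L0 => /bc_rightP[r1 r2] /bc_leftP[h1 h2]; split; split.
move=> [[d1 a1 l1 l3 [h1 r1]] [d2 a2 l2 l4 [h2 r2]]].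
have R0 : bc_right alpha f by apply/bc_rightP.
have L0 : bc_left beta f by apply/bc_leftP.
split; first by apply/maxdomP; split; split.
by case: ifP => // _; case: ifP => // _; case: ifP.
Qed.

Notation S := (xjacobi_op alpha beta m).
Notation inj := (eigenvalue_inj alpha_gt beta_gt).

Lemma op_shiftE f (a t : R) : op_shift S (a +i* t) f =
  (fun x => (L (fun t => Re (f t)) x - a * Re (f x) + t * Im (f x)) +i*
            (L (fun t => Im (f t)) x - a * Im (f x) - t * Re (f x))).
Proof.
apply/funext => x; rewrite /op_shift /= xjacobi_exprE; case: (f x) => u v; simpc.
by apply: eq_complexP => /=; ring.
Qed.

Lemma eigenspaceP f (a t : R) : in_eigenspace S (a +i* t) f <->
  [/\ dom (fun t => Re (f t)), dom (fun t => Im (f t)),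
    {ae mu, forall x, D x -> L (fun t => Re (f t)) x - a * Re (f x) + t * Im (f x) = 0} &
    {ae mu, forall x, D x -> L (fun t => Im (f t)) x - a * Im (f x) - t * Re (f x) = 0}].
Proof.
have F_ := ae_filter_ringOfSetsType mu.
have E : ae_eq11 (opact S f) (fun x => (a +i* t) * f x) <->
    ae_eq11 (op_shift S (a +i* t) f) (fun=> 0).
  rewrite /op_shift; split; apply: filterS => x H Dx; first by rewrite H// subrr.
  by apply/eqP; rewrite -subr_eq0; apply/eqP; exact: H.
rewrite /in_eigenspace E op_shiftE; split.
  by move=> [/xjacobi_domP[d1 d2] /ae_eq11P[h1 h2]].
by move=> [d1 d2 h1 h2]; split; [exact/xjacobi_domP|exact/ae_eq11P].
Qed.

(** The terms are |lam k - lambda|^2 > 0. The eigenvalues tend to minus infinity, and once lam k <=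
    a - 1 the term is at least 1. *)
Lemma resolvent_gap (a t : R) : (forall k, a +i* t != (lam k)%:C) ->
  exists2 d : R, 0 < d & forall k, d <= (lam k - a) ^+ 2 + t ^+ 2.
Proof.
move=> ne; have [N HN] := eigenvalue_le alpha_gt beta_gt (a - 1).
have [||d d0 Hd] := @inf_gt0 R (fun=> True) (fun k => (lam k - a) ^+ 2 + t ^+ 2) N.
- move=> k _; rewrite lt_neqAle addr_ge0 ?sqr_ge0// andbT eq_sym paddr_eq0 ?sqr_ge0//.
  rewrite !sqrf_eq0 subr_eq0; apply/negP => /andP[/eqP l0 /eqP t0].
  by have := ne k; rewrite l0 t0 eqxx.
- by move=> k /HN lk; have := sqr_ge0 t; nra.
by exists d => // k; exact: Hd.
Qed.

Lemma resolventP (a t : R) : (forall k, a +i* t != (lam k)%:C) ->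
  resolvent_set S (a +i* t).
Proof.
move=> /resolvent_gap[d d0 dl].
have dl0 k : (lam k - a) ^+ 2 + t ^+ 2 != 0 by rewrite gt_eqF// (lt_le_trans d0).
split.
- move=> f /xjacobi_domP[d1 d2]; rewrite op_shiftE => /ae_eq11P[h1 h2]; apply/ae_eq11P.
  exact: (SL_inj reg SL_eigen xjacobi_dense d1 d2 h1 h2 dl0).
- move=> g /(inL2P mW W_gt0)[g1 g2].
  have [f1 [f2 [S1 S2 h1 h2 _]]] := SL_surj reg SL_eigen inj xjacobi_dense d0 dl g1 g2.
  exists (fun x => f1 x +i* f2 x); first by apply/xjacobi_domP.
  by rewrite op_shiftE; apply/ae_eq11P.
(* [SL_bound] gives d |f|^2 <= 4 |(T - lambda) f|^2. *)
exists (Num.sqrt (4 / d)) => f /xjacobi_domP[S1 S2].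
have [_ _ l1 l3 _] := S1; have [_ _ l2 l4 _] := S2.
have bd := SL_bound reg SL_eigen inj xjacobi_dense d0 dl S1 S2.
have lg1 : wL2 D W (fun x => L (fun t => Re (f t)) x - a * Re (f x) + t * Im (f x)).
  by apply: (wL2D mD mW W_gt0); [apply: (wL2B mD mW W_gt0)|]; [|exact: wL2Z..].
have lg2 : wL2 D W (fun x => L (fun t => Im (f t)) x - a * Im (f x) - t * Re (f x)).
  by apply: (wL2B mD mW W_gt0); [apply: (wL2B mD mW W_gt0)|]; [|exact: wL2Z..].
have -> : f = (fun x => Re (f x) +i* Im (f x)) by apply/funext => x; case: (f x).
rewrite (L2norm_parts mW W_gt0 l1 l2) op_shiftE (L2norm_parts mW W_gt0 lg1 lg2).
have d4 : 0 <= 4 / d by rewrite divr_ge0// ltW.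
rewrite -EFinM lee_fin -(sqrtrM _ d4); apply: ler_wsqrtr.
by rewrite mulrAC ler_pdivlMr// mulrC.
Qed.

Lemma xjacobi_eigenfunction k :
  eigenfunction_for S (lam k)%:C (polyfun (xjacobi alpha beta m (m + k))).
Proof.
have d1 := SLdom_horner reg (e k); have d2 := SLdom_horner reg 0.
have E0 : (fun t : R => Im (polyfun (e k) t)) = horner 0.
  by apply/funext => x; rewrite horner0.
split.
  apply/eigenspaceP; split; [exact: d1|by rewrite E0| |]; apply: aeW => x Dx.
    by rewrite mul0r addr0 SL_eigen// subrr.
  rewrite E0 SLhornerE !linear0 !horner0 mul0r subr0 !mulr0; ring.
move=> /ae_eq11P[h _]; exact: horner_ae_neq0 (xjacobi_neq0 k) h.
Qed.

(** Any other number belongs to the resolvent set, and injectivity there excludes eigenfunctions. *)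
Lemma point_spectrumE : point_spectrum S = [set z | exists k, z = (lam k)%:C].
Proof.
apply/seteqP; split => [z [f [ef f0]]|z [k ->]]; last first.
  by exists (polyfun (xjacobi alpha beta m (m + k))); exact: xjacobi_eigenfunction.
apply: contrapT => nz; apply: f0; case: z ef nz => a t ef nz.
have [] := @resolventP a t; first by move=> k; apply/eqP => zk; apply: nz; exists k.
move=> H _ _; have [df _] := ef; apply: H => //.
have [_ _ h1 h2] := (eigenspaceP _ _ _).1 ef.
by rewrite op_shiftE; apply/ae_eq11P.
Qed.

Lemma spectrumE : spectrum S = [set z | exists k, z = (lam k)%:C].
Proof.
apply/seteqP; split => [[a t] nr|z [k ->] [H _ _]].
  apply: contrapT => nz; apply: nr; apply: resolventP => k.
  by apply/eqP => zk; apply: nz; exists k.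
have [ef f0] := xjacobi_eigenfunction k; apply: f0; have [df _] := ef.
apply: H => //; have [_ _ h1 h2] := (eigenspaceP _ _ _).1 ef.
have -> : (lam k)%:C = lam k +i* 0 by [].
by rewrite op_shiftE; apply/ae_eq11P.
Qed.

(** The eigenvalue is real, so the real and imaginary parts of an eigenfunction each solve the real
    equation and are real multiples of e_k, which combine into one complex factor. *)
Lemma xjacobi_simple k : simple_eigenvalue S (lam k)%:C.
Proof.
have F_ := ae_filter_ringOfSetsType mu.
exists (polyfun (e k)); first exact: xjacobi_eigenfunction.
move=> f /eigenspaceP[d1 d2 h1 h2].
have simple u v : dom u -> {ae mu, forall x, D x -> L u x - lam k * u x + 0 * v x = 0} ->
    exists r : R, {ae mu, forall x, D x -> u x = r * (e k).[x]}.
  move=> du hu; apply: (SL_simple reg SL_eigen xjacobi_neq0 inj xjacobi_dense du).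
  apply: filterS hu => x H Dx; apply/eqP; rewrite -subr_eq0.
  by have := H Dx; rewrite mul0r addr0 => ->.
have [r hr] := simple _ _ d1 h1.
have [s hs] : exists s : R, {ae mu, forall x, D x -> Im (f x) = s * (e k).[x]}.
  apply: (simple (fun x => Im (f x)) (fun x => Re (f x)) d2).
  by apply: filterS h2 => x H Dx; rewrite -[RHS](H Dx) !mul0r addr0 subr0.
exists (r +i* s); apply/ae_eq11P; split.
  by apply: filterS hr => x H Dx; rewrite H//= mulr0 subr0.
by apply: filterS hs => x H Dx; rewrite H//= mulr0 add0r.
Qed.

(** Isolation holds because the distances |lam j - lam k| with j <> k are positive and at least 1
    for large j. *)
Lemma discrete_spectrumE : discrete_spectrum S = [set z | exists k, z = (lam k)%:C].
Proof.
apply/seteqP; split => [z [pz _ _]|z [k ->]]; first by rewrite -point_spectrumE.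
split; first by rewrite point_spectrumE; exists k.
  have [g _ H] := xjacobi_simple k.
  exists 1%N, (fun _ => g) => f /H[c cE]; exists (fun=> c).
  apply: filterS cE; first exact: (ae_filter_ringOfSetsType mu).
  by move=> x cx Dx; rewrite big_ord1 cx.
have [N HN] := eigenvalue_le alpha_gt beta_gt (lam k - 1).
have [||d d0 Hd] := @inf_gt0 R (fun j => j != k) (fun j => `|lam j - lam k|) N.
- by move=> j jk; rewrite normr_gt0 subr_eq0; apply: contra_neq jk; exact: inj.
- by move=> j /HN lj; rewrite ler0_norm; lra.
exists d => // nu; rewrite spectrumE => -[j ->] nud.
have [->//|/Hd] := eqVneq j k; rewrite leNgt => /negP; case.
by apply: le_lt_trans nud; have := Re_le_normc ((lam j)%:C - (lam k)%:C); rewrite ReB.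
Qed.

Lemma xjacobi_span_dense :
  span_dense W (fun k => polyfun (xjacobi alpha beta m (m + k))).
Proof.
move=> f /(inL2P mW W_gt0)[l1 l2] eps e0.
(* Squared norms of the real and imaginary parts add up, so each part is allotted half of eps^2. *)
have e2 : 0 < eps ^+ 2 / 2 by rewrite divr_gt0// exprn_gt0.
have [c1 h1] := xjacobi_dense l1 e2; have [c2 h2] := xjacobi_dense l2 e2.
pose N := maxn (size c1) (size c2).
exists N, (fun k => c1`_k +i* c2`_k).
have lh := wL2_horner mW W_gt0 W_int.
have sumE x : \sum_(k < N) (c1`_k +i* c2`_k) * polyfun (e k) x =
    (lincomb e c1).[x] +i* (lincomb e c2).[x].
  rewrite (@lincomb_widen _ e N c1) ?leq_maxl// (@lincomb_widen _ e N c2) ?leq_maxr//.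
  rewrite !horner_sum; elim/big_ind3: _ => [|z1 r1 s1 z2 r2 s2 -> ->|k _]//.
  have Z (a t r : R) : (a +i* t) * r%:C = (a * r) +i* (t * r) by simpc.
  by rewrite [polyfun _ _]/((e k).[x]%:C) Z !hornerZ.
have E : (fun x => f x - \sum_(k < N) (c1`_k +i* c2`_k) * polyfun (e k) x) =
    (fun x => (Re (f x) - (lincomb e c1).[x]) +i* (Im (f x) - (lincomb e c2).[x])).
  by apply/funext => x; rewrite sumE; apply: eq_complexP; rewrite ?ReB ?ImB.
have l1' := wL2B mD mW W_gt0 l1 (lh (lincomb e c1)).
have l2' := wL2B mD mW W_gt0 l2 (lh (lincomb e c2)).
rewrite E (L2norm_parts mW W_gt0 l1' l2').
rewrite lte_fin -(ger0_norm (ltW e0)) -sqrtr_sqr ltr_sqrt ?exprn_gt0//=.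
by rewrite [ltRHS]splitr; exact: ltrD.
Qed.

End ExceptionalOperator.

Theorem theorem3p3 (R : realType) (m : nat) (alpha beta : R)
  (m_ge1 : (1 <= m)%N)
  (alpha_gt : -1 < alpha) (beta_gt : -1 < beta)
  (notin : forall j : nat, (j < m)%N -> alpha + 1 - m%:R - beta != j%:R)
  (sgn_eq : Num.sg (alpha + 1 - m%:R) = Num.sg beta)
  (* the weight and the differential expression are defined on (-1,1) *)
  (eta_neq0 : forall x : R, -1 < x < 1 -> (eta alpha beta m).[x] != 0)
  (* the n-th exceptional polynomial has degree n *)
  (deg_xjacobi : forall n : nat, (m <= n)%N ->
     size (xjacobi alpha beta m n) = n.+1) :
  let S := xjacobi_op alpha beta m in
  [/\ forall n : nat, (m <= n)%N ->
        eigenfunction S (polyfun (xjacobi alpha beta m n)),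
      span_dense (xjacobi_weight alpha beta m)
        (fun k => polyfun (xjacobi alpha beta m (m + k)%N)),
      pure_discrete_spectrum S,
      spectrum S = point_spectrum S
      /\ point_spectrum S =
         [set lam : R[i] | exists2 n : nat, (m <= n)%N &
            lam = (- ((n%:R - m%:R) * (1 + alpha + beta + n%:R - m%:R)))%:C]
    & forall lam : R[i], point_spectrum S lam -> simple_eigenvalue S lam].
Proof.
move=> S.
have psE := point_spectrumE alpha_gt beta_gt sgn_eq eta_neq0 deg_xjacobi.
have sE := spectrumE alpha_gt beta_gt sgn_eq eta_neq0 deg_xjacobi.
split.
- move=> n mn; rewrite -(subnKC mn); eexists.
  exact: (xjacobi_eigenfunction alpha_gt beta_gt sgn_eq eta_neq0 deg_xjacobi).
- exact: (xjacobi_span_dense alpha_gt beta_gt sgn_eq eta_neq0 deg_xjacobi).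
- rewrite /pure_discrete_spectrum sE.
  by rewrite (discrete_spectrumE alpha_gt beta_gt sgn_eq eta_neq0 deg_xjacobi).
- split; first by rewrite sE psE.
  rewrite psE; apply/seteqP; split => z [].
    move=> k ->; exists (m + k)%N; first exact: leq_addr.
    by rewrite /eigenvalue natrD; congr (_%:C); ring.
  move=> n mn ->; exists (n - m)%N.
  by rewrite /eigenvalue natrB//; congr (_%:C); ring.
- move=> z; rewrite psE => -[k ->].
  exact: (xjacobi_simple alpha_gt beta_gt sgn_eq eta_neq0 deg_xjacobi).
Qed.
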